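(* Let $d>0$ and $Q(z)=|z|^{2d}$ for $z\in\mathbb{C}$, whose droplet is the disk $S=\{z\in\mathbb{C}: |z|\le d^{-\frac{1}{2d}}\}$. For each $n$ let $\{z_j\}_{1}^{n}$ be the eigenvalues of the hard edge ensemble associated with $Q^S$, let $|z|_n=\max_{1\le j\le n}|z_j|$, and define the rescaled spectral radius $$\omega_n = nd\left(d^{\frac{1}{2d}}|z|_n-1\right)\log 4 .$$ Then $\omega_n$ converges in distribution to the exponential distribution: $$\lim_{n\to\infty}\mathbf{P}[\omega_n\le \xi]=e^{\xi},\qquad \xi\le 0,$$ uniformly for $\xi$ in every compact subset of $\mathbb{R}^-$.
   Context: $\mathbb{R}^-=(-\infty,0]$. $dA(z)=dx\,dy/\pi$ is the normalized area measure on $\mathbb{C}$. For a potential $Q:\mathbb{C}\to\mathbb{R}\cup\{+\infty\}$, the droplet $S$ is the support of the equilibrium measure $\sigma_Q$, the unique minimizer of $$I_Q(\mu)=\iint_{\mathbb{C}^2}\log\frac{1}{|z-\zeta|}\,d\mu(\zeta)\,d\mu(z)+\int_{\mathbb{C}}Q\,d\mu$$ among compactly supported Borel probability measures $\mu$ on $\mathbb{C}$. The localized potential is $Q^S(z)=Q(z)$ for $z\in S$ and $Q^S(z)=+\infty$ for $z\notin S$. The hard edge ensemble associated with $Q^S$ (the eigenvalues of the random normal matrix model with potential $Q^S$) is the system of $n$ random points $z_1,\dots,z_n$ in $\mathbb{C}$ with joint probability density, with respect to $\prod_{j=1}^n dA(z_j)$, $$P_n(z_1,\dots,z_n)=\frac{1}{Z_n}\prod_{j\neq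 k}|z_j-z_k|\;e^{-n\sum_{j=1}^n Q^S(z_j)},$$ where the product is over all ordered pairs $(j,k)$ with $j\ne k$, $1\le j,k\le n$ (so that it equals $\prod_{j<k}|z_j-z_k|^2$), $e^{-\infty}=0$, and $Z_n$ is the normalizing constant. *)

(* Defs.v *)
From HB Require Import structures.
From mathcomp Require Import all_boot all_order all_algebra.
From mathcomp Require Import all_classical all_reals all_analysis.

Set Implicit Arguments.
Unset Strict Implicit.
Unset Printing Implicit Defensive.

Import Order.TTheory GRing.Theory Num.Theory.
Import numFieldNormedType.Exports.

Local Open Scope classical_set_scope.
Local Open Scope ring_scope.

(* The complex plane is represented by pairs z = (Re z, Im z), with the product
   (hence Borel) sigma-algebra. [measurableTypeR R] is [R] itself, with the
   Borel structure that carries [lebesgue_measure].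
   The library's norm on pairs is the sup norm, so the Euclidean modulus has to
   be defined separately; the topology is the same. *)
Notation plane R := (measurableTypeR R * measurableTypeR R)%type.

Definition cabs (R : realType) (z : plane R) : R :=
  Num.sqrt (z.1 ^+ 2 + z.2 ^+ 2).

Definition area (R : realType) : {measure set (plane R) -> \bar R} :=
  mscale (NngNum (ltW (divr_gt0 ltr01 (pi_gt0 R))))
    (@lebesgue_measure R \x @lebesgue_measure R)%E.

Section potential_theory.
Context {R : realType}.
Implicit Types (Q : plane R -> \bar R) (mu sigma : probability (plane R) R).

Definition msupport mu : set (plane R) :=
  [set z | forall U : set (plane R), open U -> U z -> (0 < mu U)%E].

(* [lne 0 = -oo], so the kernel is +oo on the diagonal. *)
Definition energy Q mu : \bar R :=
  (\int[mu]_z \int[mu]_w (- lne (cabs (z - w))%:E) + \int[mu]_z Q z)%E.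

Definition is_equilibrium_measure Q sigma : Prop :=
  [/\ compact (msupport sigma),
      (forall mu, compact (msupport mu) -> (energy Q sigma <= energy Q mu)%E)
    & forall mu, compact (msupport mu) -> energy Q mu = energy Q sigma ->
        forall A, measurable A -> mu A = sigma A].

Definition is_droplet Q (S : set (plane R)) : Prop :=
  exists2 sigma : probability (plane R) R,
    is_equilibrium_measure Q sigma & S = msupport sigma.

Definition localized Q (S : set (plane R)) (z : plane R) : \bar R :=
  if z \in S then Q z else +oo%E.

End potential_theory.

Section hard_edge_ensemble.
Context {R : realType}.
Implicit Types (Q : plane R -> \bar R) (S : set (plane R)).

(* Integral over C^n of a nonnegative function against the product of n copies
   of the area measure, as an iterated integral (Tonelli). *)
Fixpoint area_integral (n : nat) : (n.-tuple (plane R) -> \bar R) -> \bar R :=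
  match n with
  | 0 => fun f => f [tuple]
  | n'.+1 => fun f =>
      (\int[@area R]_z area_integral (fun x => f [tuple of z :: x]))%E
  end.

Definition gibbs_weight Q (n : nat) (x : n.-tuple (plane R)) : \bar R :=
  ((\prod_(j < n) \prod_(k < n | j != k) cabs (tnth x j - tnth x k))%:E *
   expeR (- (n%:R%:E * \sum_(j < n) Q (tnth x j))))%E.

Definition partition_function Q (n : nat) : \bar R :=
  area_integral (@gibbs_weight Q n).

Definition joint_density Q (n : nat) (x : n.-tuple (plane R)) : \bar R :=
  (gibbs_weight Q x / partition_function Q n)%E.

Definition is_hard_edge_ensemble Q S (n : nat) (dO : measure_display)
    (Omega : measurableType dO) (P : probability Omega R)
    (z : {RV P >-> n.-tuple (plane R)}) : Prop :=
  forall B : set (n.-tuple (plane R)), measurable B ->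
    distribution P z B = area_integral (@joint_density (localized Q S) n \_ B).

Definition spectral_radius (n : nat) (x : n.-tuple (plane R)) : R :=
  \big[Num.max/0]_(j < n) cabs (tnth x j).

Definition rescaled_radius (d : R) (n : nat) (x : n.-tuple (plane R)) : R :=
  n%:R * d * (d `^ (1 / (2 * d)) * spectral_radius x - 1) * ln 4.

End hard_edge_ensemble.

(* Main.v *)
Require Import Defs.
From HB Require Import structures.
From mathcomp Require Import all_boot all_order all_algebra all_fingroup cyclic separable cyclotomic.
From mathcomp Require Import all_classical all_reals all_analysis.
From mathcomp Require Import measurable_realfun complex ring lra.

Set Implicit Arguments.
Unset Strict Implicit.
Unset Printing Implicit Defensive.

Import Order.TTheory GRing.Theory Num.Theory.
Import numFieldNormedType.Exports.

Local Open Scope classical_set_scope.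
Local Open Scope ring_scope.

(** The theorem has two halves: the droplet of [|z| ^ (2 d)] is the disc of
    radius [edge d], and the rescaled spectral radius of the hard edge ensemble
    on that disc converges in law. Both are computed in the radial coordinate
    [logdepth d z = - ln (d |z| ^ (2 d))], which is nonnegative exactly on the
    disc and under which area has an exponential law ([integral_logdepth]).

    The droplet. Let [sigma] be the rotation invariant probability on the disc
    for which [logdepth] has the standard exponential law. Averaging
    [ln |z - w|] over the rotations of [w] by the [n]-th roots of unity gives
    [ln |z ^ n - w ^ n| / n], which tends to [ln (max |z| |w|)]; so the potential
    of [sigma] is explicit ([log_potentialE]), and twice this potential plus
    [|z| ^ (2 d)] is constant on the disc and at least that constant everywhere
    ([frostman_lower]). The logarithmic kernel is a mixture of Gaussians
    (Frullani's integral, [log_mixture_expRN]) and a Gaussian is the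
    autocorrelation of a narrower Gaussian; hence for measures [mu] and [sigma]
    the energies satisfy the polarization identity of a Hilbert norm
    ([cross_energy_dispersion]), whose defect, the dispersion, is the mean
    square distance of the Gaussian smoothings of [mu] and [sigma]. Together,
    the energy of [mu] exceeds that of [sigma] by at least the dispersion
    ([energy_equilibrium_le]), so [sigma] is a minimizer. The dispersion vanishes
    only if the smoothings agree at almost all scales, that is if [mu = sigma]
    ([eq_measure_dispersion]).

    The spectral radius. Averaged over independent rotations of the points by
    roots of unity, the squared Vandermonde determinant becomes a sum over
    permutations of products of powers of the moduli
    ([vandermonde_rotation_average]); so the probability that all points lie in a
    smaller concentric disc is a product of quotients of radial moments
    ([gap_probability]). These moments are incomplete gamma integrals: with
    [N = n / d] and [s] the depth of the smaller circle, the logarithm of the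
    [j]-th factor is [- N s] times, to leading order, the ratio of the density of
    a Gamma([j / d]) variable to its distribution function at [N] ([hazard]), and
    [N s] tends to [- xi / (d ln 2)]. It remains to see that these ratios add up to
    [d ln 2] ([sum_hazard]). Along unit steps of the shape [a], the sum of
    [ln (1 + hazard)] telescopes, by the recurrence of the incomplete gamma
    function, to the logarithm of [P (Gamma(a) <= N) / P (Gamma(N) <= N)], which
    tends to [ln 2] by Laplace's method; the ratios are small and monotone in the
    shape, so the sum is close to the integral of the ratio over [[0, N]], and so
    is [1 / d] times the sum along steps [1 / d]. This gives pointwise convergence
    ([edge_limit]); monotonicity in [xi] makes it uniform on compact sets. *)

(** * Lebesgue measure under affine maps *)

Section lebesgue_affine.
Context {R : realType}.
Notation leb := (@lebesgue_measure R).
Implicit Types (f : R -> \bar R) (a c : R).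

Lemma integral_shift f a : measurable_fun [set: R] f -> (forall x, 0 <= f x)%E ->
  (\int[leb]_x f (x + a)%R = \int[leb]_x f x)%E.
Proof.
move=> mf f0.
pose phi : measurableTypeR R -> measurableTypeR R := fun x => x + a.
have mphi : measurable_fun setT phi by exact: measurable_funD.
pose phim : {mfun _ >-> _} := HB.pack phi (isMeasurableFun.Build _ _ _ _ _ mphi).
transitivity (\int[pushforward leb phim]_x f x)%E.
  by rewrite ge0_integral_pushforward.
apply: eq_measure_integral => A mA _; apply/esym/lebesgue_measure_unique => //=.
move=> _ [[u v]] _ <-; rewrite /pushforward.
rewrite (_ : _ @^-1` _ = `]u - a, v - a]%classic); last first.
  by apply/seteqP; split => x; rewrite /= /phi !in_itv/= ltrBlDr lerBrDr.
rewrite !lebesgue_measure_itv/= !lte_fin ltrD2r; case: ifP => // _.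
by rewrite -!EFinD; congr EFin; lra.
Qed.

Lemma integral_scale f c : 0 < c -> measurable_fun [set: R] f ->
  (forall x, 0 <= f x)%E ->
  (\int[leb]_x f (c * x)%R = c^-1%:E * \int[leb]_x f x)%E.
Proof.
move=> c0 mf f0.
pose phi : measurableTypeR R -> measurableTypeR R := fun x => c * x.
have mphi : measurable_fun setT phi by exact: measurable_funM.
pose phim : {mfun _ >-> _} := HB.pack phi (isMeasurableFun.Build _ _ _ _ _ mphi).
transitivity (\int[pushforward leb phim]_x f x)%E.
  by rewrite ge0_integral_pushforward.
have c'0 : 0 <= c^-1 by rewrite invr_ge0 ltW.
rewrite -(@ge0_integral_mscale _ _ _ leb setT _ (NngNum c'0))//.
apply: eq_measure_integral => A mA _.
transitivity (c^-1%:E * (c%:E * pushforward leb phim A))%E.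
  by rewrite muleA -EFinM mulVf ?mul1e// gt_eqF.
rewrite /= [RHS]/mscale; congr (_ * _)%E.
rewrite (_ : (c%:E * _)%E = mscale (NngNum (ltW c0)) (pushforward leb phim) A)//.
apply/esym/lebesgue_measure_unique => //=.
move=> _ [[u v]] _ <-; rewrite /mscale/= /pushforward.
rewrite (_ : _ @^-1` _ = `]c^-1 * u, c^-1 * v]%classic); last first.
  apply/seteqP; split => x; rewrite /= /phi !in_itv/=;
  by rewrite ![c^-1 * _]mulrC ltr_pdivrMr// ler_pdivlMr// ![x * c]mulrC.
rewrite !lebesgue_measure_itv/= !lte_fin ltr_pM2l ?invr_gt0//.
case: ifP => // _; last by rewrite mule0.
by rewrite -!EFinD -EFinM; congr EFin; field; rewrite gt_eqF.
Qed.

End lebesgue_affine.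

(** * Area under shears, rotations and dilations *)

Section area_transformations.
Context {R : realType}.
Notation leb := (@lebesgue_measure R).
Implicit Types (f : plane R -> \bar R) (z : plane R).

Lemma area_integral_iterated f : measurable_fun setT f -> (forall z, 0 <= f z)%E ->
  (\int[@area R]_z f z = pi^-1%:E * \int[leb]_x \int[leb]_y f (x, y))%E.
Proof.
move=> mf f0; rewrite ge0_integral_mscale//= div1r.
by congr (_ * _)%E; rewrite fubini_tonelli1.
Qed.

Lemma area_integral_iteratedr f : measurable_fun setT f -> (forall z, 0 <= f z)%E ->
  (\int[@area R]_z f z = pi^-1%:E * \int[leb]_y \int[leb]_x f (x, y))%E.
Proof.
move=> mf f0; rewrite (area_integral_iterated mf f0); congr (_ * _)%E.
by rewrite (@fubini_tonelli _ _ _ _ _ leb leb).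
Qed.

Definition shearx (s : R) z : plane R := (z.1 + s * z.2, z.2).
Definition sheary (s : R) z : plane R := (z.1, z.2 + s * z.1).

Lemma measurable_shearx s : measurable_fun setT (shearx s).
Proof.
apply: measurable_fun_pair => //.
by apply: measurable_funD => //; exact: measurable_funM.
Qed.

Lemma measurable_sheary s : measurable_fun setT (sheary s).
Proof.
apply: measurable_fun_pair => //.
by apply: measurable_funD => //; exact: measurable_funM.
Qed.

Lemma integral_shearx s f : measurable_fun setT f -> (forall z, 0 <= f z)%E ->
  (\int[@area R]_z f (shearx s z) = \int[@area R]_z f z)%E.
Proof.
move=> mf f0.
have mfs := measurableT_comp mf (measurable_shearx s).
rewrite (area_integral_iteratedr mfs (fun z => f0 (shearx s z))).
rewrite (area_integral_iteratedr mf f0); congr (_ * _)%E.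
apply: eq_integral => y _; rewrite /shearx/=.
rewrite (@integral_shift _ (fun x => f (x, y)))//.
exact: measurableT_comp mf (pair2_measurable y).
Qed.

Lemma integral_sheary s f : measurable_fun setT f -> (forall z, 0 <= f z)%E ->
  (\int[@area R]_z f (sheary s z) = \int[@area R]_z f z)%E.
Proof.
move=> mf f0.
have mfs := measurableT_comp mf (measurable_sheary s).
rewrite (area_integral_iterated mfs (fun z => f0 (sheary s z))).
rewrite (area_integral_iterated mf f0); congr (_ * _)%E.
apply: eq_integral => x _; rewrite /sheary/=.
rewrite (@integral_shift _ (fun y => f (x, y)))//.
exact: measurableT_comp mf (pair1_measurable x).
Qed.

(** Complex multiplication in coordinates. *)
Definition pmul (u z : plane R) : plane R :=
  (u.1 * z.1 - u.2 * z.2, u.1 * z.2 + u.2 * z.1).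

Lemma measurable_pmul u : measurable_fun setT (pmul u).
Proof.
apply: measurable_fun_pair => //.
  by apply: measurable_funB => //; exact: measurable_funM.
by apply: measurable_funD => //; exact: measurable_funM.
Qed.

Lemma cabs_ge0 z : 0 <= cabs z. Proof. exact: sqrtr_ge0. Qed.

Lemma sqr_cabs z : cabs z ^+ 2 = z.1 ^+ 2 + z.2 ^+ 2.
Proof. by rewrite sqr_sqrtr// addr_ge0// sqr_ge0. Qed.

Lemma cabs_pmul u z : cabs (pmul u z) = cabs u * cabs z.
Proof.
apply/eqP; rewrite -(@eqrXn2 _ 2%N)// ?mulr_ge0 ?cabs_ge0//.
by rewrite exprMn !sqr_cabs /=; apply/eqP; ring.
Qed.

(** A rotation other than the half turn is a product of three shears, and
    shears preserve area by translation invariance on each line; the half turn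
    is a quarter turn applied twice. *)
Lemma integral_rotation u f : cabs u = 1 ->
  measurable_fun setT f -> (forall z, 0 <= f z)%E ->
  (\int[@area R]_z f (pmul u z) = \int[@area R]_z f z)%E.
Proof.
move=> u1.
have rot v : cabs v = 1 -> v.1 != -1 -> forall f,
    measurable_fun setT f -> (forall z, 0 <= f z)%E ->
    (\int[@area R]_z f (pmul v z) = \int[@area R]_z f z)%E.
  move=> v1 vN1 {}f mf f0.
  have v1' : v.1 ^+ 2 + v.2 ^+ 2 = 1 by rewrite -sqr_cabs v1 expr1n.
  have v10 : 1 + v.1 != 0 by rewrite addrC addr_eq0.
  pose t := - (v.2 / (1 + v.1)).
  have mf1 := measurableT_comp mf (measurable_shearx t).
  have mf2 := measurableT_comp mf1 (measurable_sheary v.2).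
  rewrite (_ : (fun z => f (pmul v z)) =
      (fun z => (f \o shearx t \o sheary v.2) (shearx t z))).
    rewrite (integral_shearx t mf2); last by move=> z; exact: f0.
    rewrite (integral_sheary v.2 mf1); last by move=> z; exact: f0.
    exact: integral_shearx.
  apply/funext => z; congr f; rewrite /pmul /shearx /sheary/=.
  have v2 : v.2 ^+ 2 = (1 - v.1) * (1 + v.1).
    by apply/(addrI (v.1 ^+ 2)); rewrite v1'; ring.
  have tv : t * v.2 = v.1 - 1.
    by rewrite /t mulNr mulrAC -expr2 v2 mulfK// opprB.
  have tt : (1 + v.1) * t = - v.2 by rewrite /t mulrN mulrC divfK.
  congr pair.
    rewrite -[- (v.2 * _)]mulNr -tt.
    rewrite [X in _ = _ + X](_ : _ = t * z.2 + t * v.2 * z.1 + t * v.2 * t * z.2); last by ring.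
    by rewrite tv; ring.
  rewrite [X in _ = _ + X](_ : _ = v.2 * z.1 + t * v.2 * z.2); last by ring.
  by rewrite tv; ring.
move=> mf f0; have [uN1|uN1] := eqVneq u.1 (-1); last exact: rot u1 uN1 f mf f0.
pose i : plane R := (0, 1).
have i1 : cabs i = 1 by rewrite /cabs/= expr0n/= add0r expr1n sqrtr1.
have iN1 : i.1 != -1 by rewrite eq_sym oppr_eq0 oner_eq0.
have u2 : u.2 = 0.
  apply/eqP; rewrite -sqrf_eq0; apply/eqP.
  by have := sqr_cabs u; rewrite u1 uN1; lra.
rewrite -(rot i i1 iN1 f mf f0).
rewrite -(rot i i1 iN1 _ (measurableT_comp mf (measurable_pmul i)) (fun z => f0 (pmul i z))).
apply: eq_integral => z _; congr f; rewrite /pmul uN1 u2 /=.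
by congr pair; ring.
Qed.

Definition pscale (c : R) z : plane R := (c * z.1, c * z.2).

Lemma cabs_pscale c z : 0 <= c -> cabs (pscale c z) = c * cabs z.
Proof.
move=> c0; apply/eqP; rewrite -(@eqrXn2 _ 2%N)// ?mulr_ge0 ?cabs_ge0//.
by rewrite exprMn !sqr_cabs /=; apply/eqP; ring.
Qed.

Lemma integral_area_scale c f : 0 < c ->
  measurable_fun setT f -> (forall z, 0 <= f z)%E ->
  (\int[@area R]_z f (pscale c z) = (c ^- 2)%:E * \int[@area R]_z f z)%E.
Proof.
move=> c0 mf f0.
have mpc : measurable_fun setT (pscale c).
  by apply: measurable_fun_pair => //; exact: measurable_funM.
rewrite (area_integral_iterated (measurableT_comp mf mpc) (fun z => f0 (pscale c z))).
rewrite (area_integral_iterated mf f0).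
rewrite muleCA; congr (_ * _)%E.
under eq_integral => x _.
  rewrite /pscale/= (@integral_scale _ (fun y => f (c * x, y)))//; last first.
    exact: measurableT_comp mf (pair1_measurable _).
  over.
have mF : measurable_fun setT (fun x => \int[leb]_y f (x, y))%E.
  exact: (@measurable_fun_fubini_tonelli_F _ _ _ _ _ leb f).
have F0 x : (0 <= \int[leb]_y f (x, y))%E by exact: integral_ge0.
rewrite ge0_integralZl; last 4 first.
- exact: measurableT.
- by apply: (measurableT_comp mF); exact: measurable_funM.
- by move=> x _; exact: F0.
- by rewrite lee_fin invr_ge0 ltW.
rewrite (@integral_scale _ (fun x => \int[leb]_y f (x, y))%E)//.
by rewrite muleA -EFinM -invfM.
Qed.

Lemma measurable_cabs : measurable_fun setT (@cabs R).
Proof.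
apply: measurableT_comp; first exact: continuous_measurable_fun (@sqrt_continuous R).
by apply: measurable_funD; exact: measurable_funX.
Qed.

End area_transformations.

(** * Measures given by a density *)

Section density.
Local Open Scope ereal_scope.
Context d (T : measurableType d) (R : realType).
Variables (mu : {measure set T -> \bar R}) (g : T -> R).
Hypotheses (mg : measurable_fun [set: T] g) (g0 : forall x, (0 <= g x)%R).

Let dens (A : set T) : \bar R := \int[mu]_(x in A) (g x)%:E.

Let dens0 : dens set0 = 0. Proof. exact: integral_set0. Qed.

Let dens_ge0 A : 0 <= dens A.
Proof. by apply: integral_ge0 => x _; rewrite lee_fin. Qed.

Let dens_sigma_additive : semi_sigma_additive dens.
Proof.
move=> /= F mF tF mUF; rewrite /dens; apply: cvg_toP.
  apply: ereal_nondecreasing_is_cvgn => m n mn.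
  by apply: lee_sum_nneg_natr => // k _ _; exact: dens_ge0.
rewrite ge0_integral_bigcup//=.
- exact/measurable_funTS/measurableT_comp.
- by move=> x _; rewrite lee_fin.
Qed.

Let dens_isMeasure := isMeasure.Build _ _ _ dens dens0 dens_ge0 dens_sigma_additive.

Lemma density_measure_exists : exists nu : {measure set T -> \bar R},
  forall A, nu A = \int[mu]_(x in A) (g x)%:E.
Proof.
pose nu : {measure set T -> \bar R} := HB.pack dens dens_isMeasure.
by exists nu.
Qed.

Variable nu : {measure set T -> \bar R}.
Hypothesis nuE : forall A, measurable A -> nu A = \int[mu]_(x in A) (g x)%:E.

Import HBNNSimple.

(** True for indicators by hypothesis; simple functions and monotone
    convergence do the rest. *)
Lemma integral_density (f : T -> \bar R) : measurable_fun [set: T] f ->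
  (forall x, 0 <= f x) ->
  \int[nu]_x f x = \int[mu]_x (f x * (g x)%:E).
Proof.
move=> mf f0; pose f_ := nnsfun_approx measurableT mf.
have cf x : (f_ n x)%:E @[n --> \oo] --> f x.
  by apply: cvg_nnsfun_approx => // y _; exact: f0.
have ndf x : {homo (fun n => (f_ n x)%:E) : a b / (a <= b)%N >-> a <= b}.
  by move=> a b ab; rewrite lee_fin; exact/lefP/nd_nnsfun_approx.
transitivity (limn (fun n => \int[nu]_x (f_ n x)%:E)).
  rewrite -monotone_convergence//.
  - by apply: eq_integral => x _; apply/esym/cvg_lim => //; exact: cf.
  - by move=> n; exact/measurable_EFinP.
  - by move=> n x _; rewrite lee_fin.
transitivity (limn (fun n => \int[mu]_x ((f_ n x)%:E * (g x)%:E))); last first.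
  rewrite -monotone_convergence//=.
  - apply: eq_integral => x _; apply/cvg_lim => //.
    by apply: cvgeZr => //; exact: cf.
  - by move=> n; apply: emeasurable_funM; exact/measurable_EFinP.
  - by move=> n x _; rewrite mule_ge0// lee_fin.
  - by move=> x _ a b ab; rewrite lee_wpmul2r ?lee_fin//; exact: ndf.
congr (limn _); apply/funext => n.
under eq_integral do rewrite fimfunE -fsumEFin//.
rewrite ge0_integral_fsum//; last 2 first.
- by move=> r; exact/measurable_EFinP/measurableT_comp.
- by move=> r x _; rewrite EFinM nnfun_muleindic_ge0.
under [RHS]eq_integral.
  move=> x _; rewrite fimfunE -fsumEFin// ge0_mule_fsuml; last first.
    by move=> r; rewrite EFinM nnfun_muleindic_ge0.
  over.
rewrite [RHS]ge0_integral_fsum//; last 2 first.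
- move=> r; apply: emeasurable_funM; last exact/measurable_EFinP.
  exact/measurable_EFinP/measurableT_comp.
- move=> r x _; apply: mule_ge0; last by rewrite lee_fin.
  by rewrite EFinM nnfun_muleindic_ge0.
apply: eq_fsbigr => r /set_mem [x0 _ r0].
have r_ge0 : (0 <= r)%R by rewrite -r0.
rewrite integralZl_indic_nnsfun//= integral_indic//= setIT nuE//.
under [RHS]eq_integral do rewrite EFinM -muleA.
rewrite ge0_integralZl//=; last 2 first.
- apply: emeasurable_funM; last exact/measurable_EFinP.
  exact/measurable_EFinP/measurable_indic.
- by move=> x _; rewrite mule_ge0// lee_fin.
congr (_ * _); rewrite integral_mkcond; apply: eq_integral => x _.
rewrite patchE indicE; case: ifPn => xr.
  by rewrite mul1e.
by rewrite mul0e.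
Qed.

End density.

(** * Calculus on half-lines *)

Section calculus.
Context {R : realType}.
Notation leb := (@lebesgue_measure R).
Implicit Types (f g F : R -> R) (a b c l t x : R).

Lemma is_derivefD f g t a b : is_derive t 1 f a -> is_derive t 1 g b ->
  is_derive t 1 (fun x => f x + g x) (a + b).
Proof. exact: is_deriveD. Qed.

Lemma is_derivefN f t a : is_derive t 1 f a -> is_derive t 1 (fun x => - f x) (- a).
Proof. exact: is_deriveN. Qed.

Lemma is_derivefB f g t a b : is_derive t 1 f a -> is_derive t 1 g b ->
  is_derive t 1 (fun x => f x - g x) (a - b).
Proof. exact: is_deriveB. Qed.

Lemma is_derivefM f g t a b : is_derive t 1 f a -> is_derive t 1 g b ->
  is_derive t 1 (fun x => f x * g x) (a * g t + f t * b).
Proof.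
move=> fa gb; apply: is_derive_eq (is_deriveM fa gb) _.
by rewrite /GRing.scale/= addrC [g t * _]mulrC.
Qed.

Lemma is_derivefMl c f t a : is_derive t 1 f a ->
  is_derive t 1 (fun x => c * f x) (c * a).
Proof.
move=> fa; apply: is_derive_eq (is_derivefM (is_derive_cst c t 1) fa) _.
by rewrite mul0r add0r.
Qed.

Lemma is_derivef_exp f t a : is_derive t 1 f a ->
  is_derive t 1 (fun x => expR (f x)) (expR (f t) * a).
Proof. by move=> fa; exact: is_derive1_comp (is_derive_expR _) fa. Qed.

Lemma is_derivef_ln f t a : 0 < f t -> is_derive t 1 f a ->
  is_derive t 1 (fun x => ln (f x)) ((f t)^-1 * a).
Proof. by move=> ft fa; exact: is_derive1_comp (is_derive1_ln ft) fa. Qed.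

Lemma is_derivef_lin c t : is_derive t 1 (fun x => c * x) c.
Proof.
by apply: is_derive_eq (is_derivefMl c (is_derive_id t 1)) _; rewrite mulr1.
Qed.

Lemma is_derive_continuous f (df : R -> R) :
  (forall t, is_derive t 1 f (df t)) -> continuous f.
Proof.
move=> fd t; apply: differentiable_continuous; apply/derivable1_diffP.
by have [] := fd t.
Qed.

Lemma integral_FTC2y f F x l : (forall t, is_derive t 1 F (f t)) ->
  continuous f -> (forall t, x <= t -> 0 <= f t) -> F t @[t --> +oo] --> l ->
  (\int[leb]_(t in `[x, +oo[) (f t)%:E = (l - F x)%:E)%E.
Proof.
move=> dF cf f0 Fl; rewrite (@ge0_continuous_FTC2y _ f F x l)//.
- exact: continuous_subspaceT.
- exact/cvg_at_right_filter/(is_derive_continuous dF).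
- by move=> t _; rewrite derive1E; have [] := dF t.
Qed.

Lemma integral_FTC2 f F x y : x <= y -> (forall t, is_derive t 1 F (f t)) ->
  continuous f ->
  (\int[leb]_(t in `[x, y]) (f t)%:E = (F y - F x)%:E)%E.
Proof.
move=> xy dF cf; have cF := is_derive_continuous dF.
move: xy; rewrite le_eqVlt => /predU1P[->|xy].
  by rewrite set_itv1 integral_set1 subrr.
rewrite (@continuous_FTC2 _ f F x y)//.
- exact: continuous_subspaceT.
- split.
  + by move=> t _; have [] := dF t.
  + exact/cvg_at_right_filter/cF.
  + exact/cvg_at_left_filter/cF.
- by move=> t _; rewrite derive1E; have [] := dF t.
Qed.

Lemma cvg_expRNM c : 0 < c -> expR (- (c * t)) @[t --> +oo] --> 0.
Proof.
move=> c0.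
apply: (@cvg_comp _ _ _ (fun t => c * t) (fun z => expR (- z)) _ (pinfty_nbhs R)).
  exact: gt0_cvgMry.
exact: cvgr_expR.
Qed.

Lemma integral_exp_tail c x : 0 < c ->
  (\int[leb]_(t in `[x, +oo[) (expR (- (c * t)))%:E = (c^-1 * expR (- (c * x)))%:E)%E.
Proof.
move=> c0.
have dE t : is_derive t 1 (fun t => expR (- (c * t))) (expR (- (c * t)) * - c).
  exact: is_derivef_exp (is_derivefN (is_derivef_lin c t)).
have dF t : is_derive t 1 (fun t => - c^-1 * expR (- (c * t))) (expR (- (c * t))).
  apply: is_derive_eq (is_derivefMl _ (dE t)) _.
  by field; rewrite gt_eqF.
have F0 : - c^-1 * expR (- (c * t)) @[t --> +oo] --> 0.
  rewrite -(mulr0 (- c^-1)); apply: cvgM; first exact: cvg_cst.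
  exact: cvg_expRNM.
rewrite (integral_FTC2y dF (is_derive_continuous dE) _ F0).
  by congr EFin; ring.
by move=> t _; exact: expR_ge0.
Qed.

End calculus.

(** * The radial law of area *)

Section radial_law.
Context {R : realType}.
Notation leb := (@lebesgue_measure R).
Implicit Types (d r s : R) (z : plane R).

Definition disc r : set (plane R) := [set z | cabs z <= r].

Lemma measurable_disc r : measurable (disc r).
Proof.
rewrite (_ : disc r = @cabs R @^-1` `]-oo, r]); last first.
  by apply/seteqP; split => z; rewrite /disc /= in_itv.
by rewrite -[X in measurable X]setTI; exact: measurable_cabs.
Qed.

Lemma area_disc r : 0 < r -> (@area R (disc r) = (r ^+ 2)%:E * @area R (disc 1))%E.
Proof.
move=> r0.
have mi : measurable_fun setT (fun z => (\1_(disc r) z)%:E : \bar R).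
  by apply/measurable_EFinP/measurable_indic; exact: measurable_disc.
have i0 z : (0 <= (\1_(disc r) z)%:E :> \bar R)%E by rewrite lee_fin.
have ai s : (\int[@area R]_z (\1_(disc s) z)%:E = @area R (disc s))%E.
  by rewrite integral_indic ?setIT//; exact: measurable_disc.
have := integral_area_scale r0 mi i0; rewrite ai.
rewrite (_ : (fun z => _) = (fun z => (\1_(disc 1) z)%:E)); last first.
  apply/funext => z; rewrite !indicE; congr ((_ : bool)%:R%:E).
  by apply/idP/idP; rewrite !inE /disc/= (cabs_pscale _ (ltW r0)) ger_pMr.
by rewrite ai => ->; rewrite muleA -EFinM divff ?mul1e// expf_neq0// gt_eqF.
Qed.

Lemma normr_fst_le_cabs z : `|z.1| <= cabs z.
Proof. by rewrite -sqrtr_sqr ler_wsqrtr// lerDl sqr_ge0. Qed.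

Lemma normr_snd_le_cabs z : `|z.2| <= cabs z.
Proof. by rewrite -sqrtr_sqr ler_wsqrtr// lerDr sqr_ge0. Qed.

Lemma area_rectangle (I J : set R) : measurable I -> measurable J ->
  (@area R (I `*` J) = pi^-1%:E * (leb I * leb J))%E.
Proof.
by move=> mI mJ; rewrite /area/= /mscale/= product_measure1E// div1r.
Qed.

Lemma area_disc1_lty : (@area R (disc 1) < +oo)%E.
Proof.
apply: (@le_lt_trans _ _ (@area R (`[-1, 1] `*` `[-1, 1]))).
  apply: le_measure; rewrite ?inE.
  - exact: measurable_disc.
  - exact: measurableX.
  - move=> z; rewrite /disc/= => z1; split; rewrite /= in_itv/= -ler_norml.
      exact: le_trans (normr_fst_le_cabs z) z1.
    exact: le_trans (normr_snd_le_cabs z) z1.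
rewrite area_rectangle// !lebesgue_measure_itv/=.
by rewrite !ifT ?lte_fin ?ltrN10 -?EFinD -?EFinM ?ltry//; lra.
Qed.

Lemma area_disc1_gt0 : (0 < @area R (disc 1))%E.
Proof.
apply: (@lt_le_trans _ _ (@area R (`[0, 2^-1] `*` `[0, 2^-1]))).
  rewrite area_rectangle// !lebesgue_measure_itv/= !lte_fin invr_gt0 ltr0n.
  by rewrite -EFinB -!EFinM lte_fin subr0 !mulr_gt0 ?invr_gt0 ?pi_gt0 ?ltr0n.
apply: le_measure; rewrite ?inE.
- exact: measurableX.
- exact: measurable_disc.
- move=> -[x y] [/=]; rewrite !in_itv/= => /andP[x0 x1] /andP[y0 y1].
  rewrite /disc/= -(@ler_pXn2r _ 2)// ?nnegrE ?cabs_ge0//.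
  rewrite sqr_cabs/= expr1n.
  by rewrite (@le_trans _ _ (2^-1 ^+ 2 + 2^-1 ^+ 2))//; [rewrite lerD// lerXn2r ?nnegrE|lra].
Qed.

Definition disc_area : R := fine (@area R (disc 1)).

Lemma disc_areaE : @area R (disc 1) = disc_area%:E.
Proof. by rewrite fineK// ge0_fin_numE// area_disc1_lty. Qed.

Lemma disc_area_gt0 : 0 < disc_area.
Proof. by rewrite -lte_fin -disc_areaE area_disc1_gt0. Qed.

Lemma cabs0 : cabs (0, 0) = 0 :> R.
Proof. by rewrite /cabs/= expr0n/= addr0 sqrtr0. Qed.

Lemma cabs_eq0 z : cabs z = 0 -> z = (0, 0).
Proof.
move=> z0; case: z z0 => x y z0.
have := normr_fst_le_cabs (x, y); have := normr_snd_le_cabs (x, y).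
by rewrite z0 !normr_le0/= => /eqP -> /eqP ->.
Qed.

Lemma set1_pair : [set (0, 0)] = [set 0] `*` [set 0] :> set (plane R).
Proof. by apply/seteqP; split => [z -> //|[x y] /= [-> ->]]. Qed.

Lemma area_origin : @area R [set (0, 0)] = 0%E.
Proof.
rewrite set1_pair area_rectangle// !lebesgue_measure_set1.
by rewrite !mule0.
Qed.

Lemma eq_area_off_origin (A B : set (plane R)) : measurable A -> measurable B ->
  (forall z, 0 < cabs z -> A z <-> B z) -> @area R A = @area R B.
Proof.
move=> mA mB AB.
have m0 : measurable ([set (0, 0)] : set (plane R)).
  by rewrite set1_pair; exact: measurableX.
rewrite -(measureU0 mA m0 area_origin) -(measureU0 mB m0 area_origin).
congr (@area R _); apply/seteqP; split => z [zAB|z0]; try by right.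
  have := cabs_ge0 z; rewrite le_eqVlt => /predU1P[/esym/cabs_eq0|z0]; first by right.
  by left; apply/AB.
have := cabs_ge0 z; rewrite le_eqVlt => /predU1P[/esym/cabs_eq0|z0]; first by right.
by left; apply/AB.
Qed.

(** Minus the logarithm of [d |z| ^ (2 d)]: a radial coordinate which vanishes
    on the boundary of the droplet and grows towards the origin. *)
Definition logdepth d z : R := - (ln d + 2 * d * ln (cabs z)).

Definition edge d : R := d `^ (- (1 / (2 * d))).

Lemma edge_gt0 d : 0 < d -> 0 < edge d.
Proof. exact: powR_gt0. Qed.

Lemma measurable_logdepth d : measurable_fun setT (logdepth d).
Proof.
apply: measurableT_comp => //; apply: measurable_funD => //.
apply: measurable_funM => //.
exact: measurableT_comp (@measurable_ln R) measurable_cabs.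
Qed.

Lemma le_logdepth d s z : 0 < d -> 0 < cabs z ->
  (s <= logdepth d z) = (cabs z <= edge d * expR (- (s / (2 * d)))).
Proof.
move=> d0 z0; have d20 : 0 < 2 * d by rewrite mulr_gt0.
rewrite -[in RHS](lnK z0) /edge /powR gt_eqF// -expRD ler_expR.
rewrite /logdepth -(ler_pM2l d20).
set L := ln (cabs z).
rewrite -[L <= _](ler_pM2l d20).
rewrite (_ : 2 * d * (- (1 / (2 * d)) * ln d - _) = - ln d - s); last first.
  by field; rewrite gt_eqF.
by rewrite ler_pM2l//; apply/idP/idP => h; lra.
Qed.

Lemma area_logdepth d s : 0 < d -> 0 <= s ->
  @area R (disc (edge d) `&` [set z | s <= logdepth d z]) =
  (disc_area * edge d ^+ 2 * expR (- (d^-1 * s)))%:E.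
Proof.
move=> d0 s0; have e0 := edge_gt0 d0.
pose r := edge d * expR (- (s / (2 * d))).
have r0 : 0 < r by rewrite mulr_gt0// expR_gt0.
have re : r <= edge d.
  rewrite ler_piMr ?(ltW e0)// -[leRHS]expR0 ler_expR oppr_le0 divr_ge0//.
  by rewrite mulr_ge0// ltW.
have mtau : measurable [set z | s <= logdepth d z].
  rewrite (_ : [set z | _] = logdepth d @^-1` `[s, +oo[); last first.
    by apply/seteqP; split => z; rewrite /= in_itv/= andbT.
  by rewrite -[X in measurable X]setTI; exact: measurable_logdepth.
transitivity (@area R (disc r)).
  apply: eq_area_off_origin.
  - by apply: measurableI => //; exact: measurable_disc.
  - exact: measurable_disc.
  - move=> z z0; rewrite /= le_logdepth//; split => [[]//|zr]; split => //.
    exact: le_trans zr re.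
rewrite area_disc// disc_areaE -EFinM; congr EFin.
rewrite /r exprMn -expRM_natl mulrC mulrA; congr (_ * expR _).
by field; rewrite gt_eqF.
Qed.

(** The disc of depth at least [s] has area proportional to [exp (- s / d)].
    *)
Lemma integral_logdepth d (f : R -> \bar R) : 0 < d ->
  measurable_fun setT f -> (forall x, 0 <= f x)%E ->
  (\int[@area R]_(z in disc (edge d)) f (logdepth d z) =
   (disc_area * edge d ^+ 2 / d)%:E *
   \int[leb]_(t in `[0%R, +oo[) (f t * (expR (- (d^-1 * t)))%:E))%E.
Proof.
move=> d0 mf f0; have d'0 : 0 < d^-1 by rewrite invr_gt0.
have e0 := edge_gt0 d0.
pose K := disc_area * edge d ^+ 2 / d.
have K0 : 0 <= K by rewrite !mulr_ge0// ?exprn_ge0 ?(ltW e0) ?(ltW d'0) ?(ltW disc_area_gt0).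
pose g t := (K * expR (- (d^-1 * t))) * \1_(`[0, +oo[%classic : set R) t.
have mexp : measurable_fun setT (fun t : R => expR (- (d^-1 * t))).
  by apply: measurableT_comp => //; apply: measurableT_comp => //; exact: measurable_funM.
have mg : measurable_fun [set: R] g.
  apply: measurable_funM; first exact: measurable_funM.
  exact: measurable_indic.
have g0 x : 0 <= g x by rewrite mulr_ge0// mulr_ge0// expR_ge0.
have [m2 m2E] := density_measure_exists leb mg g0.
have mS := measurable_disc (edge d).
have mI : measurable_fun setT (\1_(disc (edge d)) : plane R -> R).
  exact: measurable_indic.
have I0 (z : plane R) : 0 <= (\1_(disc (edge d)) z : R) by rewrite indicE.
have [m0 m0E] := density_measure_exists (@area R) mI I0.
pose ld : plane R -> measurableTypeR R := logdepth d.
have mld : measurable_fun setT ld := measurable_logdepth d.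
pose m1_ : {measure set (measurableTypeR R) -> \bar R} :=
  pushforward m0 ld.
pose m1 := m1_ mld.
have m1E (B : set (measurableTypeR R)) :
  measurable B -> m1 B = @area R (logdepth d @^-1` B `&` disc (edge d)).
  move=> mB; rewrite (_ : m1 B = m0 (ld @^-1` B))// m0E.
  rewrite integral_indic//; first by rewrite setIC.
  by rewrite -[X in measurable X]setTI; exact: measurable_logdepth.
have m2r x : m2 `[x, +oo[%classic = (disc_area * edge d ^+ 2 * expR (- (d^-1 * Num.max x 0)))%:E.
  rewrite m2E.
  transitivity (\int[leb]_(t in `[Num.max x 0%R, +oo[) (K * expR (- (d^-1 * t)))%:E)%E.
    rewrite integral_mkcond [RHS]integral_mkcond; apply: eq_integral => t _.
    rewrite !patchE /g indicE !mem_setE !in_itv/= !andbT ge_max.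
    by case: leP => _; case: leP => _; rewrite ?mulr1 ?mulr0.
  under eq_integral do rewrite EFinM.
  rewrite ge0_integralZl//; last first.
    by apply/measurable_EFinP; exact: measurable_funTS.
  rewrite integral_exp_tail// -EFinM; congr EFin; rewrite /K.
  by field; rewrite gt_eqF.
have m1r x : m1 `[x, +oo[%classic = (disc_area * edge d ^+ 2 * expR (- (d^-1 * Num.max x 0)))%:E.
  have x0 : 0 <= Num.max x 0 by rewrite le_max lexx orbT.
  rewrite m1E// -(area_logdepth d0 x0); apply: eq_area_off_origin.
  - apply: measurableI => //; rewrite -[X in measurable X]setTI.
    exact: measurable_logdepth.
  - apply: measurableI => //.
    rewrite (_ : [set z | _] = logdepth d @^-1` `[Num.max x 0, +oo[); last first.
      by apply/seteqP; split => z; rewrite /= in_itv/= andbT.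
    by rewrite -[X in measurable X]setTI; exact: measurable_logdepth.
  - move=> z z0; rewrite /= in_itv/= andbT ge_max; split.
      move=> [xz zS]; split => //; rewrite xz/= le_logdepth//.
      by rewrite mul0r oppr0 expR0 mulr1.
    by move=> [zS /andP[xz _]].
have m12 : forall A, measurable A -> m1 A = m2 A.
  move=> A mA; apply: (@measure_unique _ R (measurableTypeR R) (RGenCInfty.G (R := R))
    (fun n => `[- n%:R, +oo[%classic) _ _ _ _ m1 m2) => //.
  - exact: RGenCInfty.measurableE.
  - move=> _ _ [x ->] [y ->]; exists (Num.max x y).
    by apply/seteqP; split => t /=; rewrite !in_itv/= !andbT ge_max => /andP.
  - by move=> n; exists (- n%:R).
  - rewrite -subTset => x _; exists (Num.bound `|x|) => //=.
    rewrite in_itv/= andbT lerNl; apply: le_trans (ltW (archi_boundP _)) => //.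
    by rewrite -normrN ler_norm.
  - by move=> _ [x ->]; rewrite m1r m2r.
  - by move=> n; rewrite m1r ltry.
have -> : (\int[@area R]_(z in disc (edge d)) f (logdepth d z) = \int[m1]_x f x)%E.
  rewrite (@ge0_integral_pushforward _ _ _ _ _ ld mld m0 setT f)//.
  rewrite preimage_setT (@integral_density _ _ _ (@area R) (\1_(disc (edge d))) mI I0 m0).
  - rewrite [LHS]integral_mkcond; apply: eq_integral => z _.
    by rewrite patchE indicE; case: ifPn; rewrite ?mule1 ?mule0.
  - by move=> A mA; exact: m0E.
  - exact: measurableT_comp mf (measurable_logdepth d).
  - by move=> z; exact: f0.
have -> : (\int[m1]_x f x = \int[m2]_x f x)%E.
  by apply: eq_measure_integral => A mA _; exact: m12.
transitivity (\int[leb]_x (f x * (g x)%:E))%E.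
  have := @integral_density _ (measurableTypeR R) R leb g mg g0 m2 (fun A _ => m2E A) f mf f0.
  by move=> h; rewrite h.
rewrite -ge0_integralZl//; last 2 first.
- apply: emeasurable_funM; first exact: measurable_funTS.
  exact/measurable_EFinP/measurable_funTS.
- by move=> t _; rewrite mule_ge0// lee_fin expR_ge0.
rewrite [RHS]integral_mkcond; apply: eq_integral => t _.
rewrite patchE /g indicE; case: ifPn => _; last by rewrite mulr0 mule0.
by rewrite mulr1 EFinM muleCA.
Qed.

End radial_law.

(** * Averages of Vandermonde determinants over roots of unity *)

Section vandermonde_average.
Variable C : numClosedFieldType.
Implicit Types (w : C).

Lemma prim_root_exists n : (n > 0)%N -> {w : C | n.-primitive_root w}.
Proof.
pose p : {poly C} := 'X^n - 1; have [r Dp] := closed_field_poly_normal p.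
move=> n_gt0; apply/sigW; rewrite (monicP _) ?monicXnsubC // scale1r in Dp.
have rn1 : all n.-unity_root r by apply/allP => w; rewrite -root_prod_XsubC -Dp.
have sz_r : (n < (size r).+1)%N.
  by rewrite -(size_prod_XsubC r id) -Dp size_XnsubC.
have [|w] := hasP (has_prim_root n_gt0 rn1 _ sz_r); last by exists w.
by rewrite -separable_prod_XsubC -Dp separable_Xn_sub_1 // pnatr_eq0 -lt0n.
Qed.

Lemma norm_prim_root n w : n.-primitive_root w -> `|w| = 1.
Proof.
move=> wn; have n0 := prim_order_gt0 wn.
apply/eqP; rewrite -(@pexpr_eq1 _ _ n)// ?normr_ge0//.
by rewrite -normrX prim_expr_order// normr1.
Qed.

(** Orthogonality of the characters of the cyclic group of order [n]. *)
Lemma sum_prim_root_conj n w (p q : 'I_n) : n.-primitive_root w ->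
  \sum_(k < n) (w ^+ k) ^+ p * ((w ^+ k) ^+ q)^* = n%:R * (p == q)%:R.
Proof.
move=> wn; have n0 := prim_order_gt0 wn.
pose z := w ^+ p * (w ^+ q)^*.
have zE (k : nat) : (w ^+ k) ^+ p * ((w ^+ k) ^+ q)^* = z ^+ k.
  by rewrite /z exprMn -rmorphXn /= -!exprM ![(k * _)%N]mulnC.
under eq_bigr do rewrite zE.
have ww : w ^+ q * (w ^+ q)^* = 1.
  by rewrite -normCK normrX (norm_prim_root wn) !expr1n.
have zn : z ^+ n = 1.
  rewrite /z exprMn -rmorphXn /= -!exprM ![(_ * n)%N]mulnC !exprM.
  by rewrite (prim_expr_order wn) !expr1n rmorph1 mulr1.
have z1 : (z == 1) = (p == q).
  have wq : (w ^+ q)^* = (w ^+ q)^-1.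
    have wq0 : w ^+ q != 0.
      by rewrite -normr_eq0 normrX (norm_prim_root wn) expr1n oner_eq0.
    by apply: (mulfI wq0); rewrite ww divff.
  have wq0 : w ^+ q != 0.
    by rewrite -normr_eq0 normrX (norm_prim_root wn) expr1n oner_eq0.
  rewrite /z wq -subr_eq0 -[1](divff wq0) -mulrBl mulf_eq0 invr_eq0 (negbTE wq0) orbF.
  by rewrite subr_eq0 (eq_prim_root_expr wn) !modn_small.
have [pq|pq] := eqVneq p q.
  rewrite mulr1 (eq_bigr (fun=> 1)) ?sumr_const ?card_ord// => k _.
  by move: z1; rewrite pq eqxx => /eqP ->; rewrite expr1n.
rewrite mulr0; apply/eqP; have z10 : z - 1 != 0 by rewrite subr_eq0 z1.
by rewrite -(mulrI_eq0 _ (mulfI z10)) -subrX1 zn subrr.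
Qed.

Lemma prod_pairs n (F : 'I_n -> 'I_n -> C) : (forall j k, F j k = F k j) ->
  \prod_(j < n) \prod_(k < n | j != k) F j k =
  (\prod_(j < n) \prod_(k < n | (j < k)%N) F j k) ^+ 2.
Proof.
move=> Fsym; rewrite expr2 [X in _ = _ * X](exchange_big_dep predT)//= -big_split/=.
apply: eq_bigr => j _.
rewrite (bigID (fun k : 'I_n => (j < k)%N))/=; congr (_ * _).
  by apply: eq_bigl => k; rewrite andb_idl// => jk; rewrite neq_ltn jk.
rewrite (eq_bigl (fun k : 'I_n => (k < j)%N)); last first.
  by move=> k; rewrite -leqNgt [(k < j)%N]ltn_neqAle eq_sym.
by apply: eq_bigr => k _; rewrite Fsym.
Qed.

Lemma vandermonde_norm n (a : 'I_n -> C) :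
  \prod_(j < n) \prod_(k < n | j != k) `|a j - a k| =
  \sum_(s : 'S_n) \sum_(t : 'S_n) (-1) ^+ s * (-1) ^+ t *
    \prod_(j < n) (a j ^+ s j * (a j ^+ t j)^*).
Proof.
rewrite prod_pairs; last by move=> j k; exact: distrC.
pose V := (Vandermonde n (\row_j a j))^T.
have dV : \det V = \prod_(j < n) \prod_(k < n | (j < k)%N) (a k - a j).
  rewrite det_tr det_Vandermonde; apply: eq_bigr => j _; apply: eq_bigr => k _.
  by rewrite !mxE.
transitivity (`|\det V| ^+ 2).
  rewrite dV; congr (_ ^+ 2); rewrite normr_prod; apply: eq_bigr => j _.
  by rewrite normr_prod; apply: eq_bigr => k _; rewrite distrC.
rewrite normCK /determinant rmorph_sum mulr_suml; apply: eq_bigr => s _.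
rewrite mulr_sumr; apply: eq_bigr => t _.
rewrite rmorphM rmorph_sign rmorph_prod mulrACA -big_split/=; congr (_ * _).
by apply: eq_bigr => j _; rewrite !mxE.
Qed.

(** Expanding both the determinant and its conjugate gives a sum over pairs of
    permutations; the sum over the rotations of each separate point kills the
    pairs whose exponents differ at that point, and only the diagonal remains.
    *)
Lemma vandermonde_rotation_sum n w (a : 'I_n -> C) : n.-primitive_root w ->
  \sum_(f : {ffun 'I_n -> 'I_n}) \prod_(j < n) \prod_(k < n | j != k)
    `|w ^+ f j * a j - w ^+ f k * a k| =
  (n ^ n)%:R * \sum_(s : 'S_n) \prod_(j < n) `|a j| ^+ (2 * s j).
Proof.
move=> wn.
under eq_bigr do rewrite (vandermonde_norm (fun j => w ^+ _ * a j)).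
rewrite exchange_big/= mulr_sumr; apply: eq_bigr => s _.
rewrite exchange_big/= (bigD1 s)//= [X in _ + X]big1 ?addr0; last first.
  move=> t ts; rewrite -mulr_sumr.
  rewrite -(bigA_distr_bigA (fun j k : 'I_n => (w ^+ k * a j) ^+ s j * ((w ^+ k * a j) ^+ t j)^*)).
  have [j sj] : exists j, s j != t j.
    apply/existsP; rewrite -[X in is_true X]negbK negb_exists; apply/negP => /forallP h.
    move/eqP: ts; apply; apply/permP => j.
    by apply/esym/eqP; have := h j; rewrite negbK.
  rewrite (bigD1 j)//=.
  rewrite (eq_bigr (fun k : 'I_n => (w ^+ k) ^+ s j * ((w ^+ k) ^+ t j)^* * (a j ^+ s j * (a j ^+ t j)^*))).
    by rewrite -mulr_suml sum_prim_root_conj// (negbTE sj) mulr0 !mul0r mulr0.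
  by move=> k _; rewrite !exprMn rmorphM mulrACA.
rewrite -mulr_sumr -expr2 sqrr_sign mul1r.
rewrite -(bigA_distr_bigA (fun j k : 'I_n => (w ^+ k * a j) ^+ s j * ((w ^+ k * a j) ^+ s j)^*)).
transitivity (\prod_(j < n) (n%:R * `|a j| ^+ (2 * s j))).
  apply: eq_bigr => j _.
  rewrite (eq_bigr (fun k : 'I_n => (w ^+ k) ^+ s j * ((w ^+ k) ^+ s j)^* * (a j ^+ s j * (a j ^+ s j)^*))).
    rewrite -mulr_suml sum_prim_root_conj// eqxx mulr1 -normCK normrX -exprM.
    by rewrite mulnC.
  by move=> k _; rewrite !exprMn rmorphM mulrACA.
by rewrite big_split/= prodr_const card_ord natrX.
Qed.

End vandermonde_average.

Section vandermonde_plane.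
Context {R : realType}.
Implicit Types (u z : plane R).

Definition toC z : R[i] := Complex z.1 z.2.

Lemma normC_toC z : `|toC z| = real_complex R (cabs z).
Proof. by rewrite normc_def. Qed.

Lemma toC_pmul u z : toC (pmul u z) = toC u * toC z.
Proof.
by case: u z => [a b] [x y]; rewrite /toC /pmul/=; congr Complex; rewrite [b * _]mulrC addrC.
Qed.

Lemma toC_sub u z : toC (u - z) = toC u - toC z.
Proof. by []. Qed.

(** The case of points of the plane: independent rotations of the points by
    roots of unity average the squared Vandermonde determinant. *)
Lemma vandermonde_rotation_average n : (n > 0)%N -> exists rot : 'I_n -> plane R,
  (forall k, cabs (rot k) = 1) /\
  forall z : 'I_n -> plane R,
  \sum_(f : {ffun 'I_n -> 'I_n}) \prod_(j < n) \prod_(k < n | j != k)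
    cabs (pmul (rot (f j)) (z j) - pmul (rot (f k)) (z k)) =
  (n ^ n)%:R * \sum_(s : 'S_n) \prod_(j < n) cabs (z j) ^+ (2 * s j).
Proof.
move=> n0; have [w wn] := prim_root_exists R[i] n0.
pose rot (k : 'I_n) : plane R := (complex.Re (w ^+ k), complex.Im (w ^+ k)).
have rotE k : toC (rot k) = w ^+ k by rewrite /toC/=; case: (w ^+ k).
exists rot; split.
  move=> k; apply: (@complexI R); rewrite -normC_toC rotE normrX.
  by rewrite (norm_prim_root wn) expr1n.
move=> z; apply: (@complexI R); rewrite rmorphM rmorph_nat !rmorph_sum/=.
have := vandermonde_rotation_sum (fun j => toC (z j)) wn.
have nE u v : real_complex R (cabs (u - v)) = `|toC u - toC v|.
  by rewrite -toC_sub normC_toC.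
move=> h; transitivity (\sum_(f : {ffun 'I_n -> 'I_n}) \prod_(j < n)
    \prod_(k < n | j != k) `|w ^+ f j * toC (z j) - w ^+ f k * toC (z k)|).
  apply: eq_bigr => f _; rewrite rmorph_prod; apply: eq_bigr => j _.
  rewrite rmorph_prod; apply: eq_bigr => k _.
  by rewrite -!rotE -!toC_pmul; exact: nE.
rewrite h; congr (_ * _); apply: eq_bigr => s _.
rewrite rmorph_prod; apply: eq_bigr => j _.
by rewrite normC_toC; apply/esym; exact: rmorphXn.
Qed.

End vandermonde_plane.

(** * The product of the distances to the rotations of a point *)

Section cyclotomic_product.
Context {R : realType}.
Implicit Types (z w u : plane R).

Lemma prod_prim_root (C : numClosedFieldType) n (zeta x y : C) :
  n.-primitive_root zeta -> \prod_(k < n) (x - zeta ^+ k * y) = x ^+ n - y ^+ n.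
Proof.
move=> zn; have n0 := prim_order_gt0 zn.
have [->|y0] := eqVneq y 0.
  rewrite expr0n eqn0Ngt n0/= subr0.
  under eq_bigr do rewrite mulr0 subr0.
  by rewrite prodr_const card_ord.
have P := factor_Xn_sub_1 zn; have := congr1 (fun p => p.[x / y]) P.
rewrite hornerD hornerN hornerXn hornerC horner_prod => E.
transitivity (y ^+ n * ((x / y) ^+ n - 1)); last first.
  by rewrite expr_div_n mulrBr mulr1 mulrCA divff ?mulr1// expf_neq0.
rewrite -E big_mkord -[in y ^+ n](card_ord n) -prodr_const -big_split/=.
apply: eq_bigr => k _; rewrite hornerXsubC mulrBr mulrCA divff// mulr1.
by rewrite [y * _]mulrC.
Qed.

(** The product is [|z ^ n - w ^ n|]. *)
Lemma cyclotomic_product_bounds n : (n > 0)%N -> exists rot : 'I_n -> plane R,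
  (forall k, cabs (rot k) = 1) /\
  forall z w, `|cabs z ^+ n - cabs w ^+ n| <=
    \prod_(k < n) cabs (z - pmul (rot k) w) <= cabs z ^+ n + cabs w ^+ n.
Proof.
move=> n0; have [zeta zn] := @prim_root_exists R[i] n n0.
pose rot (k : 'I_n) : plane R := (complex.Re (zeta ^+ k), complex.Im (zeta ^+ k)).
have rotC k : toC (rot k) = zeta ^+ k by rewrite /toC /rot/=; case: (zeta ^+ k).
exists rot; split.
  move=> k; apply: (@complexI R); rewrite -normC_toC rotC normrX (norm_prim_root zn).
  by rewrite expr1n.
move=> z w.
have E : real_complex R (\prod_(k < n) cabs (z - pmul (rot k) w)) =
   `|toC z ^+ n - toC w ^+ n|.
  rewrite -(prod_prim_root _ _ zn) normr_prod rmorph_prod/=; apply: eq_bigr => k _.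
  by rewrite -normC_toC toC_sub toC_pmul rotC.
have X v : `|toC v| ^+ n = real_complex R (cabs v ^+ n).
  by rewrite normC_toC rmorphXn.
have tri (a b : R[i]) : `|a| - `|b| <= `|a - b| := lerB_dist a b.
rewrite ler_norml lerNl opprB; apply/andP; split; [apply/andP; split|].
- rewrite -(@lecR R) E distrC rmorphB/= -!X -!normrX.
  exact: tri.
- by rewrite -(@lecR R) E rmorphB/= -!X -!normrX; exact: tri.
- by rewrite -(@lecR R) E rmorphD/= -!X -!normrX; exact: ler_normB.
Qed.

End cyclotomic_product.

(** * Iterated area integrals *)

Section iterated_area_integral.
Context {R : realType}.
Local Open Scope ereal_scope.
Notation leb := (@lebesgue_measure R).
Notation tup n := (n.-tuple (plane R)).

Lemma measurable_integral_area d (U : measurableType d) (f : U * plane R -> \bar R) :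
  measurable_fun setT f -> (forall z, 0 <= f z) ->
  measurable_fun setT (fun u => \int[@area R]_z f (u, z)).
Proof.
move=> mf f0.
have mfu u : measurable_fun setT (fun z => f (u, z)).
  exact: measurableT_comp mf (pair1_measurable u).
rewrite (_ : (fun u => _) = (fun u => (pi^-1)%:E * \int[leb]_a \int[leb]_b f (u, (a, b)))).
  apply: measurable_funeM.
  pose g (ua : U * measurableTypeR R) := \int[leb]_b f (ua.1, (ua.2, b)).
  have mg : measurable_fun setT g.
    pose h (uab : (U * measurableTypeR R) * measurableTypeR R) :=
      f (uab.1.1, (uab.1.2, uab.2)).
    have mh : measurable_fun setT h.
      apply: (measurableT_comp mf); apply: measurable_fun_pair.
        exact: measurableT_comp measurable_fst measurable_fst.
      apply: measurable_fun_pair => //.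
      exact: measurableT_comp measurable_snd measurable_fst.
    exact: (@measurable_fun_fubini_tonelli_F _ _ _ _ _ leb h mh (fun _ => f0 _)).
  apply: (@measurable_fun_fubini_tonelli_F _ _ _ _ _ leb g mg) => ua.
  exact: integral_ge0.
by apply/funext => u; rewrite area_integral_iterated.
Qed.

Lemma area_integral_ge0 n (f : tup n -> \bar R) : (forall x, 0 <= f x) ->
  0 <= area_integral f.
Proof.
elim: n f => [|n IH] f f0 /=; first exact: f0.
by apply: integral_ge0 => z _; exact: IH.
Qed.

Lemma measurable_area_integral_param n d (U : measurableType d)
    (f : U * tup n -> \bar R) : measurable_fun setT f -> (forall z, 0 <= f z) ->
  measurable_fun setT (fun u => area_integral (fun x => f (u, x))).
Proof.
elim: n d U f => [|n IH] d U f mf f0 /=.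
  exact: measurableT_comp mf (pair2_measurable _).
apply: (@measurable_integral_area _ _ (fun uz => area_integral
  (fun x => f (uz.1, [tuple of uz.2 :: x])))); last first.
  by move=> z; exact: area_integral_ge0.
apply: (IH _ _ (fun uzx => f (uzx.1.1, [tuple of uzx.1.2 :: uzx.2]))) => //.
apply: (measurableT_comp mf); apply: measurable_fun_pair.
  exact: measurableT_comp measurable_fst measurable_fst.
apply: measurable_cons => //.
exact: measurableT_comp measurable_snd measurable_fst.
Qed.

Lemma measurable_cons_slice n (f : tup n.+1 -> \bar R) z : measurable_fun setT f ->
  measurable_fun setT (fun x : tup n => f [tuple of z :: x]).
Proof.
by move=> mf; apply: (measurableT_comp mf); exact: measurable_cons.
Qed.

Lemma measurable_area_integral_slice n (f : tup n.+1 -> \bar R) :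
  measurable_fun setT f -> (forall x, 0 <= f x) ->
  measurable_fun setT (fun z => area_integral (fun x : tup n => f [tuple of z :: x])).
Proof.
move=> mf f0.
apply: (@measurable_area_integral_param _ _ _ (fun zx => f [tuple of zx.1 :: zx.2])) => //.
by apply: (measurableT_comp mf); exact: measurable_cons.
Qed.

Lemma area_integralZl n (f : tup n -> \bar R) (c : R) : (0 <= c)%R ->
  measurable_fun setT f -> (forall x, 0 <= f x) ->
  area_integral (fun x => c%:E * f x) = c%:E * area_integral f.
Proof.
move=> c0; elim: n f => [|n IH] f mf f0 //=.
rewrite -ge0_integralZl//; last 2 first.
- exact: measurable_area_integral_slice.
- by move=> z _; exact: area_integral_ge0.
by apply: eq_integral => z _; rewrite IH//; exact: measurable_cons_slice.
Qed.

Lemma area_integral_sum n (I : Type) (s : seq I) (f : I -> tup n -> \bar R) :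
  (forall i, measurable_fun setT (f i)) -> (forall i x, 0 <= f i x) ->
  area_integral (fun x => \sum_(i <- s) f i x) = \sum_(i <- s) area_integral (f i).
Proof.
elim: n f => [|n IH] f mf f0 //=.
rewrite -ge0_integral_sum//; last 2 first.
- by move=> i; exact: measurable_area_integral_slice.
- by move=> i z _; exact: area_integral_ge0.
apply: eq_integral => z _; rewrite (IH (fun i x => f i [tuple of z :: x]))//.
by move=> i; exact: measurable_cons_slice.
Qed.

Definition rotate_tuple n (r : 'I_n -> plane R) (x : tup n) : tup n :=
  [tuple pmul (r j) (tnth x j) | j < n].

Lemma measurable_rotate_tuple n (r : 'I_n -> plane R) :
  measurable_fun setT (rotate_tuple r).
Proof.
apply/measurable_fun_tnthP => j.
rewrite (_ : _ \o _ = pmul (r j) \o (fun x => tnth x j)).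
  by apply: measurableT_comp; [exact: measurable_pmul|exact: measurable_tnth].
by apply/funext => x /=; rewrite tnth_mktuple.
Qed.

Lemma area_integral_rotate n (r : 'I_n -> plane R) (f : tup n -> \bar R) :
  (forall j, cabs (r j) = 1%R) -> measurable_fun setT f -> (forall x, 0 <= f x) ->
  area_integral (fun x => f (rotate_tuple r x)) = area_integral f.
Proof.
move=> r1; elim: n r r1 f => [|n IH] r r1 f mf f0 /=.
  by congr f; rewrite [rotate_tuple _ _]tuple0.
rewrite -(integral_rotation (r1 ord0) (measurable_area_integral_slice mf f0)); last first.
  by move=> z; exact: area_integral_ge0.
apply: eq_integral => z _.
rewrite -(IH (fun j => r (lift ord0 j)) (fun j => r1 _) _ (measurable_cons_slice _ mf) (fun x => f0 _)).
congr area_integral; apply/funext => x; congr f; apply: eq_from_tnth => j.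
rewrite tnth_mktuple; case: (unliftP ord0 j) => [k ->|->].
  by rewrite !tnthS tnth_mktuple.
by rewrite !tnth0.
Qed.

Lemma area_integral_prod n (F : 'I_n -> plane R -> R) (m : 'I_n -> R) :
  (forall j, measurable_fun setT (F j)) -> (forall j z, (0 <= F j z)%R) ->
  (forall j, \int[@area R]_z (F j z)%:E = (m j)%:E) ->
  area_integral (fun x => (\prod_(j < n) F j (tnth x j))%:E) = (\prod_(j < n) m j)%:E.
Proof.
elim: n F m => [|n IH] F m mF F0 Fm /=; first by rewrite !big_ord0.
rewrite big_ord_recl EFinM -Fm -ge0_integralZr//; last 3 first.
- exact/measurable_EFinP.
- by move=> z _; rewrite lee_fin.
- rewrite lee_fin; apply: prodr_ge0 => j _; rewrite -lee_fin -Fm.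
  by apply: integral_ge0 => z _; rewrite lee_fin.
apply: eq_integral => z _.
rewrite -(IH (fun j => F (lift ord0 j)))//.
rewrite -area_integralZl//; last 2 first.
- apply/measurable_EFinP; apply: measurable_prod => j _.
  by apply: measurableT_comp => //; exact: measurable_tnth.
- by move=> x; rewrite lee_fin; apply: prodr_ge0.
congr area_integral; apply/funext => x; rewrite -EFinM; congr EFin.
rewrite big_ord_recl tnth0; congr (_ * _)%R.
by apply: eq_bigr => j _; rewrite tnthS.
Qed.

End iterated_area_integral.

(** * Partition functions of radial ensembles *)

Section determinantal_partition_function.
Context {R : realType}.
Notation tup n := (n.-tuple (plane R)).

Definition vandermonde_sq n (x : tup n) : R :=
  \prod_(j < n) \prod_(k < n | j != k) cabs (tnth x j - tnth x k).

Lemma vandermonde_sq_ge0 n (x : tup n) : 0 <= vandermonde_sq x.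
Proof.
by apply: prodr_ge0 => j _; apply: prodr_ge0 => k _; exact: cabs_ge0.
Qed.

Lemma measurable_vandermonde_sq n : measurable_fun setT (@vandermonde_sq n).
Proof.
apply: measurable_prod => j _.
rewrite (_ : (fun x => _) = (fun x : tup n => \prod_(k < n)
    (if j != k then cabs (tnth x j - tnth x k) else 1))); last first.
  by apply/funext => x; rewrite big_mkcond.
apply: measurable_prod => k _; case: (j != k) => //.
apply: (measurableT_comp (@measurable_cabs R)).
have mt i : measurable_fun setT (fun x : tup n => tnth x i) by exact: measurable_tnth.
apply: measurable_fun_pair => /=.
  by apply: measurable_funB; apply: measurableT_comp (mt _).
by apply: measurable_funB; apply: measurableT_comp (mt _).
Qed.

(** Independent rotations of the points preserve both the area and the weight
    [w]; averaged over them the squared Vandermonde determinant is a permanent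
    of monomials in the moduli, whose integral factorizes. *)
Lemma area_integral_radial n (w : plane R -> R) (m : nat -> R) :
  measurable_fun setT w -> (forall z, 0 <= w z) ->
  (forall u z, cabs u = 1 -> w (pmul u z) = w z) ->
  (forall p, (p < n)%N ->
    \int[@area R]_z (cabs z ^+ (2 * p) * w z)%:E = (m p)%:E)%E ->
  area_integral (fun x : tup n =>
    (vandermonde_sq x * \prod_(j < n) w (tnth x j))%:E) =
  ((n`!)%:R * \prod_(p < n) m p)%:E.
Proof.
move=> mw w0 wrot wm.
case: n wm => [|n] wm.
  by rewrite /vandermonde_sq /= !big_ord0 mulr1.
set N := n.+1 in wm *.
have [rot [rot1 rotE]] := @vandermonde_rotation_average R N isT.
pose F (x : tup N) : \bar R := (vandermonde_sq x * \prod_(j < N) w (tnth x j))%:E.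
have mF : measurable_fun setT F.
  apply/measurable_EFinP; apply: measurable_funM; first exact: measurable_vandermonde_sq.
  apply: measurable_prod => j _; apply: (measurableT_comp mw).
  exact: measurable_tnth.
have F0 x : (0 <= F x)%E.
  by rewrite lee_fin mulr_ge0 ?vandermonde_sq_ge0// prodr_ge0.
pose G (s : 'S_N) (x : tup N) : R :=
  \prod_(j < N) (cabs (tnth x j) ^+ (2 * s j) * w (tnth x j)).
have mc p : measurable_fun setT (fun z : plane R => cabs z ^+ (2 * p) * w z).
  by apply: measurable_funM => //; apply: measurable_funX; exact: measurable_cabs.
have mG s : measurable_fun setT (EFin \o G s).
  apply/measurable_EFinP; apply: measurable_prod => j _.
  apply: (measurableT_comp (mc (s j))); exact: measurable_tnth.
have G0 s x : (0 <= (G s x)%:E)%E.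
  by rewrite lee_fin prodr_ge0// => j _; rewrite mulr_ge0// exprn_ge0// cabs_ge0.
have GE s : area_integral (fun x => (G s x)%:E) = (\prod_(p < N) m p)%:E.
  rewrite (@area_integral_prod R N (fun j z => cabs z ^+ (2 * s j) * w z) (fun j => m (s j))).
  - by congr EFin; rewrite [RHS](reindex_inj (@perm_inj _ s)).
  - by move=> j; exact: mc.
  - by move=> j z; rewrite mulr_ge0// exprn_ge0// cabs_ge0.
  - by move=> j; apply: wm; exact: ltn_ord.
have sumF x : (\sum_(f : {ffun 'I_N -> 'I_N}) F (rotate_tuple (fun j => rot (f j)) x) =
    (N ^ N)%:R%:E * \sum_(s : 'S_N) (G s x)%:E)%E.
  rewrite !sumEFin -EFinM; congr EFin.
  have wE f : \prod_(j < N) w (tnth (rotate_tuple (fun j => rot (f j)) x) j) =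
      \prod_(j < N) w (tnth x j).
    by apply: eq_bigr => j _; rewrite tnth_mktuple wrot.
  under eq_bigr => f _ do rewrite wE.
  rewrite -mulr_suml /G; under [in RHS]eq_bigr => s _ do rewrite big_split/=.
  rewrite -mulr_suml mulrA; congr (_ * _).
  rewrite -rotE; apply: eq_bigr => f _; apply: eq_bigr => j _.
  by apply: eq_bigr => k _; rewrite !tnth_mktuple.
have NN : (0 < (N ^ N)%:R :> R) by rewrite ltr0n expn_gt0.
have key : ((N ^ N)%:R%:E * area_integral F = (N ^ N)%:R%:E * ((N`!)%:R * \prod_(p < N) m p)%:E)%E.
  transitivity (\sum_(f : {ffun 'I_N -> 'I_N})
      area_integral (fun x => F (rotate_tuple (fun j => rot (f j)) x)))%E.
    under eq_bigr => f _ do rewrite (area_integral_rotate (fun j => rot1 _) mF F0).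
    rewrite big_const cardT -cardE card_ffun card_ord.
    rewrite (_ : iter _ _ _ = area_integral F *+ (N ^ N))%E; last first.
      by case: (N ^ N)%N => //; elim => [|k] /=; [rewrite adde0|move=> ->].
    by rewrite -mule_natl.
  rewrite -area_integral_sum; last 2 first.
  - move=> f; apply: (measurableT_comp mF); exact: measurable_rotate_tuple.
  - by move=> f x; exact: F0.
  rewrite (_ : (fun x => _) = (fun x => (N ^ N)%:R%:E * \sum_(s : 'S_N) (G s x)%:E)%E);
    last exact/funext.
  rewrite area_integralZl ?ltW//; last 2 first.
  - by apply: emeasurable_sum => s; exact: mG.
  - by move=> x; apply: sume_ge0.
  congr (_ * _)%E; rewrite area_integral_sum//.
  under eq_bigr => s _ do rewrite GE.
  by rewrite sumEFin sumr_const card_Sn mulr_natl.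
have -> : area_integral (fun x : tup N => (vandermonde_sq x * \prod_(j < N) w (tnth x j))%:E) =
   area_integral F by [].
move: key NN; move: (area_integral F) (_ * _)%R ((N ^ N)%:R) => a b c.
move=> key c0; rewrite -[LHS]mul1e -[RHS]mul1e -(@mulVf _ c) ?gt_eqF//.
by rewrite EFinM -!muleA key.
Qed.

End determinantal_partition_function.

(** * Integrals over half-lines *)

Section half_line_integrals.
Context {R : realType}.
Notation leb := (@lebesgue_measure R).
Implicit Types (f g F : R -> R) (a b c l t x : R).

Definition tail x : set (measurableTypeR R) := `[x, +oo[%classic.

Lemma measurable_tail x : measurable (tail x).
Proof. exact: measurable_itv. Qed.

Lemma integrable_exp_tail c x : 0 < c ->
  leb.-integrable (tail x) (EFin \o (fun t => expR (- (c * t)))).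
Proof.
move=> c0; have mE : measurable_fun setT (fun t : R => expR (- (c * t))).
  apply: continuous_measurable_fun.
  exact: (is_derive_continuous (fun t => is_derivef_exp (is_derivefN (is_derivef_lin c t)))).
apply/integrableP; split.
  exact/measurable_EFinP/measurable_funTS.
under eq_integral do rewrite /= ger0_norm ?expR_ge0//.
by rewrite integral_exp_tail// ltry.
Qed.

Lemma integrable_exp_dom f C c x : 0 < c -> measurable_fun setT f ->
  (forall t, x <= t -> `|f t| <= C * expR (- (c * t))) ->
  leb.-integrable (tail x) (EFin \o f).
Proof.
move=> c0 mf fC.
apply: (@le_integrable _ _ _ leb (tail x) _ _ (fun t => C%:E * (expR (- (c * t)))%:E)%E).
- exact: measurable_tail.
- exact/measurable_EFinP/measurable_funTS.
- move=> t; rewrite /tail /= in_itv/= andbT => xt.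
  rewrite lee_fin (le_trans (fC t xt))//.
  exact: ler_norm.
- apply: integrableZl; first exact: measurable_tail.
  exact: integrable_exp_tail.
Qed.

Lemma cvg_Rintegral_itv f x : measurable_fun setT f ->
  leb.-integrable (tail x) (EFin \o f) ->
  \int[leb]_(t in `[x, x + n%:R]) f t @[n --> \oo] --> \int[leb]_(t in tail x) f t.
Proof.
move=> mf fi; have mt := measurable_tail x.
have sub n : `[x, x + n%:R]%classic `<=` tail x.
  by move=> t; rewrite /tail/= !in_itv/= andbT => /andP[].
have fin : (\int[leb]_(t in tail x) (f t)%:E)%E \is a fin_num.
  exact: integrable_fin_num.
rewrite -[X in _ --> X]/(fine _); apply: fine_cvg; rewrite fineK//.
have -> : (fun n => \int[leb]_(t in `[x, (x + n%:R)%R]) (f t)%:E)%E =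
    (fun n => \int[leb]_(t in tail x) ((EFin \o f) \_ `[x, (x + n%:R)%R]%classic) t)%E.
  apply/funext => n; rewrite [RHS]integral_mkcond [LHS]integral_mkcond.
  apply: eq_integral => t _; rewrite !patchE.
  case: ifPn => tn; last by case: ifPn => //; rewrite patchE (negbTE tn).
  rewrite ifT ?patchE ?tn//.
  by move: tn; rewrite !inE; exact: sub.
apply: (@dominated_cvg _ _ _ leb (tail x) mt _ (EFin \o f) (fun t => `|(f t)%:E|)%E).
- move=> n; apply: measurable_funTS; apply: (measurable_restrictT _ _).1 => //.
  exact/measurable_EFinP/measurable_funTS.
- move=> t; rewrite /tail/= in_itv/= andbT => xt; apply: cvg_near_cst.
  exists (Num.bound `|t - x|) => // n /= nt; rewrite patchE ifT// inE/= in_itv/= xt/=.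
  rewrite -lerBlDl (le_trans (ler_norm _))// (le_trans (ltW (archi_boundP _)))//.
  by rewrite ler_nat.
- by [].
- exact: integrable_abse.
- move=> n t _; rewrite patchE; case: ifPn => //= _.
  by rewrite normr0 lee_fin.
Qed.

Lemma Rintegral_FTC2y f F x l : (forall t, is_derive t 1 F (f t)) ->
  continuous f -> leb.-integrable (tail x) (EFin \o f) ->
  F t @[t --> +oo] --> l -> \int[leb]_(t in tail x) f t = l - F x.
Proof.
move=> dF cf fi Fl.
have := cvg_Rintegral_itv (continuous_measurable_fun cf) fi.
have -> : (fun n : nat => \int[leb]_(t in `[x, x + n%:R]) f t) =
    (fun n : nat => F (x + n%:R) - F x).
  by apply/funext => n; rewrite /Rintegral (integral_FTC2 _ dF cf)// lerDl.
move=> c1; apply: cvg_unique c1 _; first exact: norm_hausdorff.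
apply: cvgB; last exact: cvg_cst.
apply: (@cvg_comp _ _ _ (fun n : nat => x + n%:R) F _ (pinfty_nbhs R)) => //.
exact: (@cvg_comp _ _ _ (fun n : nat => n%:R) (fun r => x + r) _ _ _ cvgr_idn (cvg_addrl x)).
Qed.

Lemma Rintegral_tail_shift f x a : measurable_fun setT f -> (forall t, 0 <= f t) ->
  \int[leb]_(t in tail x) f (t + a) = \int[leb]_(t in tail (x + a)) f t.
Proof.
move=> mf f0; rewrite /Rintegral; congr fine.
rewrite [RHS]integral_mkcond.
rewrite -(@integral_shift _ ((EFin \o f) \_ (tail (x + a))) a).
- rewrite [LHS]integral_mkcond; apply: eq_integral => t _.
  by rewrite !patchE /tail !mem_setE !in_itv/= !andbT lerD2r.
- apply: (measurable_restrictT _ _).1; first exact: measurable_tail.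
  exact/measurable_EFinP/measurable_funTS.
- by move=> t; rewrite patchE; case: ifPn => // _; rewrite lee_fin.
Qed.

End half_line_integrals.

(** * Incomplete gamma integrals *)

Section incomplete_gamma.
Context {R : realType}.
Notation leb := (@lebesgue_measure R).
Implicit Types (N a s t : R).

(** In the variables [t = ln (N / u)] and [t = ln (u / N)], the integrands of
    the lower and the upper incomplete gamma function of [a] at [N], up to the
    common factor [exp N / N ^ a]. *)
Definition lowk N a t : R := expR (N * (1 - expR (- t)) - a * t).
Definition uppk N a t : R := expR (a * t + N * (1 - expR t)).

Fact low_key : unit. Proof. exact: tt. Qed.
Fact upp_key : unit. Proof. exact: tt. Qed.
Definition low N a : R := locked_with low_key (\int[leb]_(t in tail 0) lowk N a t).
Definition upp N a : R := locked_with upp_key (\int[leb]_(t in tail 0) uppk N a t).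

Lemma lowE N a : low N a = \int[leb]_(t in tail 0) lowk N a t.
Proof. by rewrite /low unlock. Qed.

Lemma uppE N a : upp N a = \int[leb]_(t in tail 0) uppk N a t.
Proof. by rewrite /upp unlock. Qed.

Lemma is_derive_lowk N a t :
  is_derive t 1 (lowk N a) (N * lowk N (a + 1) t - a * lowk N a t).
Proof.
have dexpN : is_derive t 1 (fun t : R => expR (- t)) (expR (- t) * -1).
  exact: is_derivef_exp (is_derivefN (is_derive_id t 1)).
have d1 : is_derive t 1 (fun t => 1 - expR (- t)) (0 - expR (- t) * -1).
  exact: is_derivefB (is_derive_cst (1 : R) t 1) dexpN.
have d2 := is_derivef_exp (is_derivefB (is_derivefMl N d1) (is_derivef_lin a t)).
apply: is_derive_eq d2 _.
rewrite /lowk (_ : N * (1 - expR (- t)) - (a + 1) * t =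
  N * (1 - expR (- t)) - a * t + - t); last by ring.
by rewrite (expRD _ (- t)); ring.
Qed.

Lemma is_derive_uppk N a t :
  is_derive t 1 (uppk N a) (a * uppk N a t - N * uppk N (a + 1) t).
Proof.
have d1 : is_derive t 1 (fun t => 1 - expR t) (0 - expR t).
  exact: is_derivefB (is_derive_cst (1 : R) t 1) (is_derive_expR t).
have d2 := is_derivef_exp (is_derivefD (is_derivef_lin a t) (is_derivefMl N d1)).
apply: is_derive_eq d2 _.
rewrite /uppk (_ : (a + 1) * t + N * (1 - expR t) =
  a * t + N * (1 - expR t) + t); last by ring.
by rewrite (expRD _ t); ring.
Qed.

Lemma continuous_lowk N a : continuous (lowk N a).
Proof. exact: (is_derive_continuous (is_derive_lowk N a)). Qed.

Lemma continuous_uppk N a : continuous (uppk N a).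
Proof. exact: (is_derive_continuous (is_derive_uppk N a)). Qed.

Lemma lowk_le N a t : 0 <= N -> lowk N a t <= expR N * expR (- (a * t)).
Proof.
move=> N0; rewrite -expRD ler_expR lerD2r.
by rewrite ler_piMr// lerBlDr lerDl expR_ge0.
Qed.

Lemma sqr_le_expR t : 0 <= t -> 1 + t + t ^+ 2 / 4 <= expR t.
Proof.
move=> t0; rewrite (_ : t = t / 2 + t / 2) ?expRD; last by field.
have h := expR_ge1Dx (t / 2).
rewrite (_ : 1 + _ + _ = (1 + t / 2) * (1 + t / 2)); last by field.
by apply: ler_pM => //; lra.
Qed.

Lemma uppk_le N a t : a <= N -> 0 <= N -> 0 <= t ->
  uppk N a t <= expR N * expR (- (N * t)).
Proof.
move=> aN N0 t0; rewrite -expRD ler_expR.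
have h1 : a * t <= N * t by rewrite ler_wpM2r.
have h2 : N * (1 - expR t) <= N * (1 - 2 * t).
  rewrite ler_wpM2l// lerD2l lerN2 (le_trans _ (sqr_le_expR t0))//.
  by have := sqr_ge0 (t - 2); lra.
nra.
Qed.

Lemma lowk_ge0 N a t : 0 <= lowk N a t. Proof. exact: expR_ge0. Qed.
Lemma uppk_ge0 N a t : 0 <= uppk N a t. Proof. exact: expR_ge0. Qed.

Lemma lowk_at0 N a : lowk N a 0 = 1.
Proof. by rewrite /lowk mulr0 subr0 oppr0 expR0 subrr mulr0 expR0. Qed.

Lemma uppk_at0 N a : uppk N a 0 = 1.
Proof. by rewrite /uppk mulr0 add0r expR0 subrr mulr0 expR0. Qed.

Lemma integrable_lowk N a x : 0 <= N -> 0 < a ->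
  leb.-integrable (tail x) (EFin \o lowk N a).
Proof.
move=> N0 a0; apply: (integrable_exp_dom a0).
  exact: continuous_measurable_fun (@continuous_lowk N a).
by move=> t _; rewrite ger0_norm ?lowk_ge0//; exact: lowk_le.
Qed.

Lemma integrable_uppk N a x : 0 <= x -> 0 < N -> a <= N ->
  leb.-integrable (tail x) (EFin \o uppk N a).
Proof.
move=> x0 N0 aN; apply: (integrable_exp_dom N0).
  exact: continuous_measurable_fun (@continuous_uppk N a).
move=> t xt; rewrite ger0_norm ?uppk_ge0//; apply: uppk_le => //.
  exact: ltW.
exact: le_trans xt.
Qed.

Lemma cvg0_exp_dom (f : R -> R) (C c : R) : 0 < c ->
  (forall t, 0 <= f t) -> (forall t, 0 <= t -> f t <= C * expR (- (c * t))) ->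
  f t @[t --> +oo] --> 0.
Proof.
move=> c0 f0 fC.
apply: (@squeeze_cvgr _ _ _ _ (fun=> 0) (fun t => C * expR (- (c * t)))).
- near=> t; rewrite f0/= fC//; near: t; exact: nbhs_pinfty_ge.
- exact: cvg_cst.
- rewrite -(mulr0 C); apply: cvgM; first exact: cvg_cst.
  exact: cvg_expRNM.
Unshelve. all: by end_near. Qed.

(** Integration by parts: the recurrence of the lower incomplete gamma
    function. *)
Lemma low_rec N a : 0 < N -> 0 < a -> a * low N a = 1 + N * low N (a + 1).
Proof.
move=> N0 a0; have a10 : 0 < a + 1 by rewrite addr_gt0.
have i0 := integrable_lowk 0 (ltW N0) a0.
have i1 := integrable_lowk 0 (ltW N0) a10.
have mt := measurable_tail (0 : R).
have dF t : is_derive t 1 (fun t => - lowk N a t) (a * lowk N a t - N * lowk N (a + 1) t).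
  by apply: is_derive_eq (is_derivefN (is_derive_lowk N a t)) _; rewrite opprB.
have i0' : leb.-integrable (tail 0) (EFin \o (fun t => a * lowk N a t)).
  by have := integrableZl mt a i0; apply: eq_integrable.
have i1' : leb.-integrable (tail 0) (EFin \o (fun t => N * lowk N (a + 1) t)).
  by have := integrableZl mt N i1; apply: eq_integrable.
have F0 : - lowk N a t @[t --> +oo] --> 0.
  rewrite -oppr0; apply: cvgN; apply: (cvg0_exp_dom a0 (lowk_ge0 N a)) => t _.
  exact/lowk_le/ltW.
have cf : continuous (fun t => a * lowk N a t - N * lowk N (a + 1) t).
  exact: (is_derive_continuous (fun t => is_derivefB
    (is_derivefMl a (is_derive_lowk N a t)) (is_derivefMl N (is_derive_lowk N (a + 1) t)))).
have := Rintegral_FTC2y dF cf (integrableB mt i0' i1') F0.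
rewrite RintegralB// !RintegralZl// -!lowE.
by rewrite lowk_at0 => h; clear -h; lra.
Qed.

(** Integration by parts: the recurrence of the upper incomplete gamma
    function. *)
Lemma upp_rec N a : 0 < a -> a + 1 <= N -> a * upp N a + 1 = N * upp N (a + 1).
Proof.
move=> a0 aN; have N0 : 0 < N by apply: lt_le_trans aN; rewrite addr_gt0.
have aN' : a <= N by apply: le_trans aN; rewrite lerDl.
have i0 := integrable_uppk (lexx 0) N0 aN'.
have i1 := integrable_uppk (lexx 0) N0 aN.
have mt := measurable_tail (0 : R).
have i0' : leb.-integrable (tail 0) (EFin \o (fun t => a * uppk N a t)).
  by have := integrableZl mt a i0; apply: eq_integrable.
have i1' : leb.-integrable (tail 0) (EFin \o (fun t => N * uppk N (a + 1) t)).
  by have := integrableZl mt N i1; apply: eq_integrable.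
have F0 : uppk N a t @[t --> +oo] --> 0.
  apply: (cvg0_exp_dom N0 (uppk_ge0 N a)) => t t0.
  by apply: uppk_le => //; exact: ltW.
have cf : continuous (fun t => a * uppk N a t - N * uppk N (a + 1) t).
  exact: (is_derive_continuous (fun t => is_derivefB
    (is_derivefMl a (is_derive_uppk N a t)) (is_derivefMl N (is_derive_uppk N (a + 1) t)))).
have := Rintegral_FTC2y (is_derive_uppk N a) cf (integrableB mt i0' i1') F0.
rewrite RintegralB// !RintegralZl// -!uppE.
by rewrite uppk_at0 => h; clear -h; lra.
Qed.

Lemma low_le N N' a b : 0 <= N -> N <= N' -> 0 < a -> a <= b ->
  low N b <= low N' a.
Proof.
move=> N0 NN a0 ab; rewrite !lowE; apply: le_Rintegral.
- exact: measurable_tail.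
- by apply: integrable_lowk => //; exact: lt_le_trans ab.
- by apply: integrable_lowk => //; exact: le_trans NN.
move=> t; rewrite /tail/= in_itv/= andbT => t0; rewrite ler_expR.
have e1 : expR (- t) <= 1 by rewrite -[leRHS]expR0 ler_expR oppr_le0.
have h1 : N * (1 - expR (- t)) <= N' * (1 - expR (- t)).
  by rewrite ler_wpM2r// subr_ge0.
have h2 : a * t <= b * t by rewrite ler_wpM2r.
by lra.
Qed.

Lemma low_ge_inv N a : 0 <= N -> 0 < a -> a^-1 <= low N a.
Proof.
move=> N0 a0; apply: le_trans (low_le (lexx 0) N0 a0 (lexx a)).
rewrite lowE /Rintegral (_ : (\int[leb]_(t in tail 0) (lowk 0 a t)%:E)%E =
  (\int[leb]_(t in `[0%R, +oo[) (expR (- (a * t)))%:E)%E); last first.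
  by apply: eq_integral => t _; rewrite /lowk mul0r add0r.
by rewrite integral_exp_tail//= mulr0 oppr0 expR0 mulr1.
Qed.

Lemma low_gt0 N a : 0 <= N -> 0 < a -> 0 < low N a.
Proof. by move=> N0 a0; apply: lt_le_trans (low_ge_inv N0 a0); rewrite invr_gt0. Qed.

Lemma upp_ge0 N a : 0 <= upp N a.
Proof. by rewrite uppE; apply: Rintegral_ge0 => t _; exact: uppk_ge0. Qed.

Lemma upp_le_inv N a : 0 < N -> a < N -> upp N a <= (N - a)^-1.
Proof.
move=> N0 aN; have Na : 0 < N - a by rewrite subr_gt0.
rewrite (_ : (N - a)^-1 = \int[leb]_(t in tail 0) expR (- ((N - a) * t))); last first.
  by rewrite /Rintegral integral_exp_tail//= mulr0 oppr0 expR0 mulr1.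
rewrite uppE; apply: le_Rintegral.
- exact: measurable_tail.
- exact: integrable_uppk (ltW aN).
- exact: integrable_exp_tail.
move=> t; rewrite /tail/= in_itv/= andbT => t0; rewrite ler_expR.
have h := expR_ge1Dx t.
have h1 : N * (1 - expR t) <= N * - t by rewrite ler_pM2l//; lra.
by lra.
Qed.

Lemma Rintegral_tail_ge (f : R -> R) (b c : R) : 0 <= b -> 0 <= c ->
  leb.-integrable (tail 0) (EFin \o f) -> (forall t, 0 <= f t) ->
  (forall t, 0 <= t -> t <= b -> c <= f t) ->
  c * b <= \int[leb]_(t in tail 0) f t.
Proof.
move=> b0 c0 fi f0 fc.
have fi' : (\int[leb]_(t in tail 0) (f t)%:E)%E \is a fin_num.
  exact: (integrable_fin_num (measurable_tail 0) fi).
rewrite -lee_fin /Rintegral fineK//.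
have -> : (c * b)%:E = (\int[leb]_(t in `[0%R, b]) c%:E)%E.
  rewrite integral_cst//= lebesgue_measure_itv/= lte_fin.
  move: b0; rewrite le_eqVlt => /predU1P[<-|->]; first by rewrite ltxx mulr0 mule0.
  by rewrite sube0 EFinM.
rewrite [X in (X <= _)%E]integral_mkcond [X in (_ <= X)%E]integral_mkcond.
apply: ge0_le_integral => //.
- by move=> t _; rewrite patchE; case: ifPn => // _; rewrite lee_fin.
- by apply: (measurable_restrictT _ _).1.
- apply: (measurable_restrictT _ _).1; first exact: measurable_tail.
  by case/integrableP : fi.
- move=> t _; rewrite !patchE /tail !mem_setE !in_itv/= andbT.
  case: ifPn => [/andP[t0 tb]|_]; last by case: ifPn => // _; rewrite lee_fin.
  by rewrite t0 lee_fin fc.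
Qed.

(** The integrand stays above [1 / 2] on an interval of length [2 A / N]. *)
Lemma low_large (A C : R) : 0 <= A -> 0 <= C -> exists N0, 0 < N0 /\
  forall N a, N0 <= N -> 0 < a -> a <= N + C -> A <= N * low N a.
Proof.
move=> A0 C0.
pose D := (2 * A) ^+ 2 + C * (2 * A).
have D0 : 0 <= D by rewrite addr_ge0 ?sqr_ge0// !mulr_ge0.
exists (D / ln 2 + 1); have l2 : 0 < ln 2 :> R by rewrite ln_gt0// ltr1n.
have N00 : 0 < D / ln 2 + 1 by rewrite ltr_wpDl// divr_ge0// ltW.
split => // N a NN a0 aN; have N0 : 0 < N by apply: lt_le_trans NN.
have DN : D / N <= ln 2.
  rewrite ler_pdivrMr// mulrC -ler_pdivrMr//.
  by apply: le_trans NN; rewrite lerDl.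
have h : 2^-1 * (2 * A / N) <= low N a.
  rewrite lowE; apply: Rintegral_tail_ge.
  - by rewrite divr_ge0 ?mulr_ge0// ltW.
  - by rewrite invr_ge0.
  - exact: integrable_lowk (ltW N0) a0.
  - by move=> t; exact: lowk_ge0.
  move=> t t0 tA; rewrite -[2^-1](@lnK R) ?posrE ?invr_gt0// lnV ?posrE// ler_expR.
  have t1 : 0 < 1 + t by rewrite ltr_pwDl.
  have e1 : expR (- t) <= 1 - t + t ^+ 2.
    rewrite expRN -[leRHS]invrK lef_pV2 ?posrE ?expR_gt0//; last first.
      by rewrite invr_gt0; have := sqr_ge0 (t - 1); nra.
    apply: le_trans (expR_ge1Dx t).
    rewrite -div1r ler_pdivrMr; last by have := sqr_ge0 (t - 1); nra.
    have : 0 <= t ^+ 3 by rewrite exprn_ge0.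
    by nra.
  have tN : N * t <= 2 * A by rewrite mulrC -ler_pdivlMr.
  have h1 : N * (1 - expR (- t)) >= N * (t - t ^+ 2).
    by rewrite ler_pM2l//; lra.
  have h2 : a * t <= (N + C) * t by rewrite ler_wpM2r.
  have h3 : N * t ^+ 2 + C * t <= D / N.
    rewrite ler_pdivlMr// /D.
    have := ler_pM (mulr_ge0 (ltW N0) t0) (mulr_ge0 (ltW N0) t0) tN tN.
    have := ler_wpM2l C0 tN.
    by nra.
  by lra.
have := ler_wpM2l (ltW N0) h.
rewrite (_ : N * (2^-1 * (2 * A / N)) = A)//.
by field; rewrite gt_eqF.
Qed.

Lemma derive_ge0_le (f f' : R -> R) t : (forall t, is_derive t 1 f (f' t)) ->
  (forall t, 0 <= t -> 0 <= f' t) -> 0 <= t -> f 0 <= f t.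
Proof.
move=> df f'0; rewrite le_eqVlt => /predU1P[<-//|t0].
have cf : {within `[0, t], continuous f}.
  exact/continuous_subspaceT/(is_derive_continuous df).
have [c] := MVT t0 (fun x _ => df x) cf.
rewrite in_itv/= => /andP[c0 ct] e.
by rewrite -subr_ge0 e mulr_ge0 ?f'0 ?subr_ge0// ltW.
Qed.

(** Both integrands at [a = N] are exponentials of [- N] times one of these
    functions, which are [t ^ 2 / 2] to leading order. *)
Definition lowexp t : R := expR (- t) - 1 + t.
Definition uppexp t : R := expR t - 1 - t.

Lemma is_derive_expRN t : is_derive t 1 (fun t : R => expR (- t)) (- expR (- t)).
Proof.
apply: is_derive_eq (is_derivef_exp (is_derivefN (is_derive_id t 1))) _.
by rewrite mulrN1.
Qed.

Lemma is_derive_lowexp t : is_derive t 1 lowexp (1 - expR (- t)).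
Proof.
apply: is_derive_eq (is_derivefD (is_derivefB (is_derive_expRN t)
  (is_derive_cst (1 : R) t 1)) (is_derive_id t 1)) _.
by ring.
Qed.

Lemma is_derive_uppexp t : is_derive t 1 uppexp (expR t - 1).
Proof.
apply: is_derive_eq (is_derivefB (is_derivefB (is_derive_expR t)
  (is_derive_cst (1 : R) t 1)) (is_derive_id t 1)) _.
by ring.
Qed.

Lemma lowexp0 : lowexp 0 = 0.
Proof. by rewrite /lowexp oppr0 expR0 subrr addr0. Qed.

Lemma uppexp0 : uppexp 0 = 0.
Proof. by rewrite /uppexp expR0 subrr subr0. Qed.

Lemma lowexp_ge t : 0 <= t -> t ^+ 2 / 2 * expR (- t) <= lowexp t.
Proof.
move=> t0; rewrite -subr_ge0.
pose f t := lowexp t - 2^-1 * (t * t * expR (- t)).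
have df (u : R) : is_derive u 1 f (1 - (1 + u) * expR (- u) + u ^+ 2 / 2 * expR (- u)).
  apply: is_derive_eq (is_derivefB (is_derive_lowexp u) (is_derivefMl 2^-1
    (is_derivefM (is_derivefM (is_derive_id u 1) (is_derive_id u 1))
    (is_derive_expRN u)))) _.
  by field.
rewrite (_ : lowexp t - _ = f t); last by rewrite /f; field.
have <- : f 0 = 0 by rewrite /f lowexp0 mul0r mul0r mulr0 subrr.
apply: derive_ge0_le df _ t0 => u u0; apply: addr_ge0.
  rewrite subr_ge0 -[leRHS](expR0) -(subrr u) expRD ler_wpM2r ?expR_ge0//.
  exact: expR_ge1Dx.
by rewrite mulr_ge0 ?expR_ge0// divr_ge0 ?sqr_ge0.
Qed.

Lemma uppexp_le t : 0 <= t -> uppexp t <= t ^+ 2 / 2 * expR t.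
Proof.
move=> t0; rewrite -subr_ge0.
pose f t := 2^-1 * (t * t * expR t) - uppexp t.
have df (u : R) : is_derive u 1 f (1 - (1 - u) * expR u + u ^+ 2 / 2 * expR u).
  apply: is_derive_eq (is_derivefB (is_derivefMl 2^-1
    (is_derivefM (is_derivefM (is_derive_id u 1) (is_derive_id u 1))
    (is_derive_expR u))) (is_derive_uppexp u)) _.
  by field.
rewrite (_ : _ - uppexp t = f t); last by rewrite /f; field.
have <- : f 0 = 0 by rewrite /f uppexp0 mul0r mul0r mulr0 subrr.
apply: derive_ge0_le df _ t0 => u u0; apply: addr_ge0.
  have := ler_wpM2l (expR_ge0 u) (expR_ge1Dx (- u)).
  by rewrite expRxMexpNx_1 subr_ge0 mulrC.
by rewrite mulr_ge0 ?expR_ge0// divr_ge0 ?sqr_ge0.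
Qed.

Lemma lowexp_le_uppexp t : 0 <= t -> lowexp t <= uppexp t.
Proof.
move=> t0; rewrite -subr_ge0; pose f t := uppexp t - lowexp t.
have df (u : R) : is_derive u 1 f (expR u - 1 - (1 - expR (- u))).
  exact: is_derivefB (is_derive_uppexp u) (is_derive_lowexp u).
rewrite -/(f t); have <- : f 0 = 0 by rewrite /f lowexp0 uppexp0 subrr.
apply: derive_ge0_le df _ t0 => u _.
have := expR_ge1Dx u; have := expR_ge1Dx (- u).
by lra.
Qed.

Lemma expRN_tangent s t : expR (- s) * (1 + (s - t)) <= expR (- t).
Proof.
have -> : expR (- t) = expR (- s) * expR (s - t) by rewrite -expRD; congr expR; ring.
by rewrite ler_wpM2l ?expR_ge0// expR_ge1Dx.
Qed.

Lemma lowexp_homo s t : 0 <= s -> s <= t -> lowexp s <= lowexp t.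
Proof.
move=> s0 st; have es : expR (- s) <= 1 by rewrite -[leRHS]expR0 ler_expR oppr_le0.
have := expRN_tangent s t.
by rewrite /lowexp; nra.
Qed.

(** By convexity [lowexp] is above its tangent line at [b / 2], which for
    [t >= b] is above [t] times half of its slope. *)
Lemma lowexp_linear b t : 0 < b -> b <= t -> (1 - expR (- (b / 2))) / 2 * t <= lowexp t.
Proof.
move=> b0 bt; set s := b / 2; have s0 : 0 < s by rewrite divr_gt0.
have es : expR (- s) <= 1 by rewrite -[leRHS]expR0 ler_expR oppr_le0 ltW.
have := expRN_tangent s t.
have := lowexp_homo (lexx 0) (ltW s0); rewrite lowexp0 /lowexp.
have : 2 * s <= t by rewrite /s; lra.
set x := expR (- s) in es *; move=> h1 h2 h3.
have : 0 <= (1 - x) * (t - 2 * s) by rewrite mulr_ge0 ?subr_ge0.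
by nra.
Qed.

Lemma uppexp_le_lowexp l t : 1 < l -> 0 <= t -> t <= 2 * ln l / (1 + l) ->
  uppexp t <= lowexp (l * t).
Proof.
move=> l1 t0 tl; have l0 : 0 < l by apply: lt_trans l1.
apply: le_trans (uppexp_le t0) _.
apply: le_trans (lowexp_ge (mulr_ge0 (ltW l0) t0)).
rewrite exprMn [leRHS](_ : _ = t ^+ 2 / 2 * (l ^+ 2 * expR (- (l * t)))); last by ring.
rewrite ler_wpM2l ?divr_ge0 ?sqr_ge0//.
rewrite -[X in X ^+ 2]lnK ?posrE// -expRM_natl -expRD ler_expR.
have : t * (1 + l) <= 2 * ln l by rewrite -ler_pdivlMr// addr_gt0.
by lra.
Qed.

Lemma lowkE N t : lowk N N t = expR (- (N * lowexp t)).
Proof. by rewrite /lowk /lowexp; congr expR; ring. Qed.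

Lemma uppkE N t : uppk N N t = expR (- (N * uppexp t)).
Proof. by rewrite /uppk /uppexp; congr expR; ring. Qed.

Lemma upp_le_low N : 0 < N -> upp N N <= low N N.
Proof.
move=> N0; rewrite uppE lowE; apply: le_Rintegral.
- exact: measurable_tail.
- exact: integrable_uppk.
- exact: integrable_lowk (ltW N0) N0.
move=> t; rewrite /tail/= in_itv/= andbT => t0.
by rewrite lowkE uppkE ler_expR lerN2 ler_pM2l// lowexp_le_uppexp.
Qed.

Lemma Rintegral_tail_scale (f : R -> R) c : 0 < c -> measurable_fun setT f ->
  (forall t, 0 <= f t) ->
  \int[leb]_(t in tail 0) f (c * t) = c^-1 * \int[leb]_(t in tail 0) f t.
Proof.
move=> c0 mf f0; have c'0 : 0 < c^-1 by rewrite invr_gt0.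
have -> : c^-1 = fine c^-1%:E by [].
rewrite /Rintegral [X in _ = _ * fine X]integral_mkcond.
have := @integral_scale _ ((EFin \o f) \_ (tail 0)) c c0.
have mp : measurable_fun setT ((EFin \o f) \_ (tail 0)).
  apply: (measurable_restrictT _ _).1; first exact: measurable_tail.
  exact/measurable_EFinP/measurable_funTS.
have p0 t : (0 <= ((EFin \o f) \_ (tail 0)) t)%E.
  by rewrite patchE; case: ifPn => // _; rewrite lee_fin.
move=> /(_ mp p0) h.
rewrite (_ : (\int[leb]_(t in tail 0) (f (c * t))%:E)%E =
  (c^-1%:E * \int[leb]_t ((EFin \o f) \_ (tail 0)) t)%E); last first.
  rewrite -h integral_mkcond; apply: eq_integral => t _.
  by rewrite !patchE /tail !mem_setE !in_itv/= !andbT pmulr_rge0.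
have : (0 <= \int[leb]_t ((EFin \o f) \_ (tail 0)) t)%E.
  by apply: integral_ge0 => t _; exact: p0.
case: (integral _ _ _) => [r _|_|//] /=; first by [].
by rewrite gt0_muley ?lte_fin//= mulr0.
Qed.

(** Laplace's method: near 0 the two exponents differ at most by a dilation of
    factor [l], and beyond a fixed distance [lowexp] grows at least linearly,
    which leaves an error of order [1 / N]. *)
Lemma upp_ge_low l N : 1 < l -> 0 < N ->
  low N N / l - (N * ((1 - expR (- (ln l / (1 + l)))) / 2))^-1 <= upp N N.
Proof.
move=> l1 N0; have l0 : 0 < l by apply: lt_trans l1.
pose b := 2 * ln l / (1 + l).
have l10 : 0 < 1 + l by rewrite addr_gt0.
have b0 : 0 < b by rewrite divr_gt0// mulr_gt0// ln_gt0.
have -> : ln l / (1 + l) = b / 2 by rewrite /b; field; rewrite gt_eqF.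
set k := (1 - expR (- (b / 2))) / 2.
have k0 : 0 < k.
  by rewrite divr_gt0// subr_gt0 -[ltRHS]expR0 ltr_expR oppr_lt0 divr_gt0.
have mlow : measurable_fun setT (lowk N N).
  exact: continuous_measurable_fun (@continuous_lowk N N).
have -> : low N N / l = \int[leb]_(t in tail 0) lowk N N (l * t).
  by rewrite (Rintegral_tail_scale l0 mlow (lowk_ge0 N N)) lowE mulrC.
have dom t : 0 <= t -> lowk N N (l * t) <= uppk N N t + expR (- (N * k * t)).
  move=> t0; rewrite lowkE uppkE.
  have [tb|bt] := leP t b.
    apply: (@le_trans _ _ (expR (- (N * uppexp t)))).
      by rewrite ler_expR lerN2 ler_pM2l// uppexp_le_lowexp.
    by rewrite lerDl expR_ge0.
  apply: (@le_trans _ _ (expR (- (N * k * t)))); last by rewrite lerDr expR_ge0.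
  rewrite ler_expR lerN2 -mulrA ler_pM2l//.
  apply: le_trans (lowexp_linear b0 (ltW bt)) _.
  by apply: lowexp_homo => //; rewrite ler_peMl// ltW.
have Nk : 0 < N * k by rewrite mulr_gt0.
have i1 := integrable_uppk (lexx 0) N0 (lexx N).
have i2 := integrable_exp_tail 0 Nk.
have i3 : leb.-integrable (tail 0) (EFin \o (fun t => lowk N N (l * t))).
  apply: (integrable_exp_dom (mulr_gt0 N0 l0)).
    by apply: measurableT_comp mlow _; exact: measurable_funM.
  move=> t _; rewrite ger0_norm ?lowk_ge0// -mulrA.
  exact/lowk_le/ltW.
rewrite lerBlDr.
have -> : (N * k)^-1 = \int[leb]_(t in tail 0) expR (- (N * k * t)).
  by rewrite /Rintegral integral_exp_tail//= mulr0 oppr0 expR0 mulr1.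
rewrite uppE -RintegralD//; last exact: measurable_tail.
apply: le_Rintegral.
- exact: measurable_tail.
- exact: i3.
- exact: (integrableD (measurable_tail 0) i1 i2).
- by move=> t; rewrite /tail/= in_itv/= andbT; exact: dom.
Qed.

Lemma upp_low_ratio (e : R) : 0 < e -> e < 1 -> exists N0, 0 < N0 /\
  forall N, N0 <= N -> (1 - e) * low N N <= upp N N.
Proof.
move=> e0 e1.
pose l := (1 - e / 2)^-1.
have e2 : 0 < 1 - e / 2 by lra.
have l1 : 1 < l by rewrite /l invf_gt1//; lra.
pose k := (1 - expR (- (ln l / (1 + l)))) / 2.
have k0 : 0 < k.
  rewrite divr_gt0// subr_gt0 -[ltRHS]expR0 ltr_expR oppr_lt0 divr_gt0 ?ln_gt0//.
  by rewrite addr_gt0// (lt_trans _ l1).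
have A0 : 0 <= (k * (e / 2))^-1 by rewrite invr_ge0 ltW// mulr_gt0// divr_gt0.
have [N0 [N00 HN]] := low_large A0 (lexx 0).
exists N0; split => // N NN; have Np : 0 < N by apply: lt_le_trans NN.
apply: le_trans (upp_ge_low l1 Np); rewrite -/k /l invrK.
have := HN N N NN Np; rewrite addr0 => /(_ (lexx _)).
have ke0 : 0 < k * (e / 2) by apply: mulr_gt0 => //; lra.
rewrite -div1r (ler_pdivrMr _ _ ke0) => h.
suff : (N * k)^-1 <= e / 2 * low N N by lra.
by rewrite -div1r (ler_pdivrMr _ _ (mulr_gt0 Np k0)); lra.
Qed.

(** The density of the Gamma([a]) law at [N] divided by its distribution
    function at [N]. The value 0 for [a <= 0] is the limit at 0 and keeps the
    function monotone. *)
Definition hazard N a : R := if 0 < a then (N * low N a)^-1 else 0.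

Lemma hazardE N a : 0 < a -> hazard N a = (N * low N a)^-1.
Proof. by rewrite /hazard => ->. Qed.

Lemma hazard_ge0 N a : 0 < N -> 0 <= hazard N a.
Proof.
move=> N0; rewrite /hazard; case: ifPn => // a0.
by rewrite invr_ge0 mulr_ge0 ?ltW// low_gt0// ltW.
Qed.

Lemma hazard_homo N : 0 < N -> {homo hazard N : a b / a <= b}.
Proof.
move=> N0 a b ab; rewrite {1}/hazard; case: ifPn => [a0|_]; last exact: hazard_ge0.
have b0 : 0 < b by apply: lt_le_trans ab.
rewrite (hazardE _ b0) lef_pV2 ?posrE; last 2 first.
- exact: mulr_gt0 N0 (low_gt0 (ltW N0) a0).
- exact: mulr_gt0 N0 (low_gt0 (ltW N0) b0).
by rewrite (ler_pM2l N0); exact: low_le (ltW N0) (lexx N) a0 ab.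
Qed.

Lemma hazard0 N : hazard N 0 = 0. Proof. by rewrite /hazard ltxx. Qed.

Lemma ln_ratio_rec (x x' u u' a N : R) :
  0 < x -> 0 < x' -> 0 <= u -> 0 <= u' -> 0 < a -> 0 < N ->
  a * x = 1 + N * x' -> a * u + 1 = N * u' ->
  ln (1 + (N * x')^-1) = ln (x / (x + u)) - ln (x' / (x' + u')).
Proof.
move=> x0 x'0 u0 u'0 a0 N0 r1 r2.
have t0 : 0 < x + u by rewrite ltr_wpDr.
have t1 : 0 < x' + u' by rewrite ltr_wpDr.
rewrite -ln_div ?posrE ?divr_gt0//; congr ln.
have rt : x + u = N * (x' + u') / a.
  have -> : N * (x' + u') = a * (x + u) by lra.
  by field; rewrite gt_eqF.
have -> : 1 + (N * x')^-1 = a * x / (N * x').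
  by rewrite r1; field; rewrite gt_eqF// gt_eqF.
by rewrite rt; field; rewrite !gt_eqF.
Qed.

(** The logarithm of the probability that a Gamma([a]) variable is at most
    [N]. *)
Definition lnratio N a : R := ln (low N a / (low N a + upp N a)).

(** The recurrence of the Gamma distribution functions, in a form that makes
    sums over unit steps telescope. *)
Lemma ln_hazard N a : 0 < a -> a + 1 <= N ->
  ln (1 + hazard N (a + 1)) = lnratio N a - lnratio N (a + 1).
Proof.
move=> a0 aN; have N0 : 0 < N by apply: lt_le_trans aN; rewrite addr_gt0.
have a10 : 0 < a + 1 by rewrite addr_gt0.
rewrite hazardE//.
exact: ln_ratio_rec (low_gt0 (ltW N0) a0) (low_gt0 (ltW N0) a10) (upp_ge0 N a)
  (upp_ge0 N (a + 1)) a0 N0 (low_rec N0 a0) (upp_rec a0 aN).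
Qed.

Lemma sum_ln_hazard N a m : 0 < a -> a + m%:R <= N ->
  \sum_(0 <= i < m) ln (1 + hazard N (a + i.+1%:R)) = lnratio N a - lnratio N (a + m%:R).
Proof.
move=> a0; elim: m => [|m IH] am; first by rewrite big_geq// addr0 subrr.
have am1 : a + m%:R + 1 <= N by rewrite -addrA natr1.
rewrite big_nat_recr//= IH; last by rewrite (le_trans _ am1)// lerDl.
have am0 : 0 < a + m%:R by rewrite ltr_wpDr.
have := ln_hazard am0 am1; rewrite -addrA natr1 => ->.
by rewrite addrA subrK.
Qed.

End incomplete_gamma.

(** * Riemann sums of monotone functions *)

Section monotone_sums.
Context {R : realType}.
Notation leb := (@lebesgue_measure R).
Variable g : R -> R.
Hypotheses (g0 : forall x, 0 <= g x) (gm : {homo g : x y / x <= y}).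

Fact prim_key : unit. Proof. exact: tt. Qed.
Definition prim x : R := locked_with prim_key (\int[leb]_(t in `[0, x]) g t).

Lemma primE x : prim x = \int[leb]_(t in `[0, x]) g t.
Proof. by rewrite /prim unlock. Qed.

Let integrable_g x y : leb.-integrable `[x, y] (EFin \o g).
Proof.
apply: measurable_bounded_integrable => //.
- have [xy|yx] := leP x y.
    by rewrite /= lebesgue_measure_itv/= lte_fin; case: ifP => // _; rewrite -EFinB ltry.
  by rewrite set_itv_ge ?measure0// bnd_simp -ltNge.
- by apply: nondecreasing_measurable => // a b _ _; exact: gm.
- exists (g y); split; first exact: num_real.
  move=> M yM t /=; rewrite in_itv/= => /andP[_ ty].
  by rewrite ger0_norm// (le_trans (gm ty))// ltW.
Qed.

Lemma prim_bounds x y : 0 <= x -> x <= y ->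
  (y - x) * g x <= prim y - prim x <= (y - x) * g y.
Proof.
move=> x0 xy.
have -> : prim y - prim x = \int[leb]_(t in `]x, y]) g t.
  by rewrite !primE Rintegral_itvB ?bnd_simp//; exact: integrable_g.
have hcst c : (y - x) * c = \int[leb]_(t in `]x, y]) (cst c) t.
  rewrite Rintegral_cst//= lebesgue_measure_itv/= lte_fin mulrC.
  move: xy; rewrite le_eqVlt => /predU1P[->|->]; first by rewrite ltxx subrr mulr0.
  by [].
have sub : `]x, y]%classic `<=` `[x, y]%classic.
  by move=> t; rewrite /= !in_itv/= => /andP[/ltW -> ->].
have ig : leb.-integrable `]x, y] (EFin \o g).
  by apply: (@integrableS _ (measurableTypeR R) R leb `[x, y]%classic `]x, y]%classic) => //; exact: integrable_g.
have ic c : leb.-integrable `]x, y] (EFin \o cst c).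
  apply: (@integrableS _ (measurableTypeR R) R leb `[x, y]%classic `]x, y]%classic) => //.
  apply: continuous_compact_integrable; first exact: segment_compact.
  exact/continuous_subspaceT/cst_continuous.
rewrite !hcst; apply/andP; split; apply: le_Rintegral => // t;
  rewrite /= in_itv/= => /andP[xt ty]; apply: gm => //.
exact: ltW.
Qed.

(** Sums of a monotone function over steps of different lengths will be
    compared through its primitive. *)
Lemma sum_prim_bounds x s m : 0 <= x -> 0 <= s ->
  prim (x + m%:R * s) - prim x <= s * \sum_(0 <= i < m) g (x + i.+1%:R * s)
  <= prim (x + m%:R * s) - prim x + s * (g (x + m%:R * s) - g x).
Proof.
move=> x0 s0; elim: m => [|m /andP[IH1 IH2]].
  by rewrite big_geq// mul0r addr0 !subrr !mulr0 addr0 lexx.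
rewrite big_nat_recr//=.
have xm0 : 0 <= x + m%:R * s by rewrite addr_ge0 ?mulr_ge0.
have xm1 : x + m%:R * s <= x + m.+1%:R * s by rewrite lerD2l ler_wpM2r// ler_nat.
have := prim_bounds xm0 xm1.
have -> : x + m.+1%:R * s - (x + m%:R * s) = s by rewrite -natr1; ring.
by move=> /andP[h1 h2]; clear -h1 h2 IH1 IH2; apply/andP; split; lra.
Qed.

End monotone_sums.

(** * Sums of reversed hazard rates of Gamma laws *)

Section hazard_sums.
Context {R : realType}.
Implicit Types (N a d e C : R).

Lemma ln_diff_bounds e (q r : R) : 0 < e -> e < 1 -> 0 <= q -> q <= e / 2 ->
  1 - e / 4 <= r -> r <= 1 -> ln 2 - e <= ln (1 + r) - ln (1 + q) <= ln 2.
Proof.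
move=> e0 e1 q0 qe r1 r2.
have q1 : -1 < q by lra.
have q2 : 1 <= 1 + q by lra.
have r3 : 0 < 1 + r by lra.
have r4 : 1 + r <= 2 by lra.
have p0 : 0 < 1 - e / 8 by lra.
have p1 : 2 * (1 - e / 8) <= 1 + r by lra.
have p2 : (1 - e / 8)^-1 = 1 + (e / 8) / (1 - e / 8).
  apply: (mulIf (lt0r_neq0 p0)).
  by rewrite mulVf ?gt_eqF// mulrDl divfK ?gt_eqF//; ring.
have p3 : e / 8 <= e / 2 * (1 - e / 8) by clear -e0 e1; nra.
have p4 : 0 <= e / 8 by lra.
have l1 := le_trans (le_ln1Dx q1) qe.
have l10 := ln_ge0 q2.
have l2 : ln (1 + r) <= ln 2 by rewrite ler_ln ?posrE.
have l3 : ln 2 + ln (1 - e / 8) <= ln (1 + r).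
  by rewrite -lnM ?posrE// ler_ln ?posrE// mulr_gt0.
have l4 : - ln (1 - e / 8) <= e / 2.
  rewrite -lnV ?posrE// p2; apply: le_trans (le_ln1Dx _) _.
    by apply: (@lt_le_trans _ _ 0); [rewrite oppr_lt0|rewrite divr_ge0// ltW].
  by rewrite ler_pdivrMr.
move: l1 l10 l2 l3 l4; clear.
by move=> l1 l10 l2 l3 l4; apply/andP; split; lra.
Qed.

Lemma lnratioE N a : 0 < low N a -> 0 <= upp N a ->
  lnratio N a = - ln (1 + upp N a / low N a).
Proof.
rewrite /lnratio; move: (low N a) (upp N a) => x y x0 y0.
have -> : 1 + y / x = (x / (x + y))^-1.
  by field; rewrite !gt_eqF// ltr_wpDr.
by rewrite lnV ?opprK// posrE divr_gt0// ltr_wpDr.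
Qed.

(** For bounded [a] a Gamma([a]) variable is below [N] with probability close
    to 1, while a Gamma([N]) variable is so with probability close to [1 / 2].
    *)
Lemma lnratio_bounds e : 0 < e -> e < 1 -> exists N0, 2 < N0 /\ forall N a : R, N0 <= N ->
  1 <= a -> a <= 2 -> ln 2 - e <= lnratio N a - lnratio N N <= ln 2.
Proof.
move=> e0 e1.
have e20 : 0 < e / 4 by lra.
have e21 : e / 4 < 1 by lra.
have [N0 [N00 HN]] := upp_low_ratio e20 e21.
exists (Num.max N0 (2 + 4 / e + 1)); split.
  by rewrite lt_max; apply/orP; right; have := divr_gt0 (ltr0n R 4) e0; lra.
move=> N a; rewrite ge_max => /andP[NN Ne] a1 a2.
have N0' : 0 < N by apply: lt_le_trans NN.
have e4 := divr_gt0 (ltr0n R 4) e0.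
have a0 : 0 < a by lra.
have aN : a < N by lra.
have Na : 4 / e <= N - a by lra.
have r2 : (1 - e / 4) * low N N <= upp N N by exact: HN.
have h1 := upp_le_inv N0' aN.
have h2 : 2^-1 <= low N a.
  by apply: le_trans (low_ge_inv (ltW N0') a0); rewrite lef_pV2 ?posrE.
have h3 : (N - a)^-1 <= e / 4.
  by rewrite -(invf_div 4 e) lef_pV2 ?posrE ?subr_gt0 ?(lt_le_trans e4 Na).
have r3 := upp_le_low N0'.
rewrite (lnratioE (low_gt0 (ltW N0') a0) (upp_ge0 N a)).
rewrite (lnratioE (low_gt0 (ltW N0') N0') (upp_ge0 N N)) opprK [X in _ <= X <= _]addrC.
move: (low_gt0 (ltW N0') a0) (low_gt0 (ltW N0') N0') (upp_ge0 N a) (upp_ge0 N N) h1 h2 r2 r3.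
move: (low N a) (low N N) (upp N a) (upp N N) => x x' y y' x0 x'0 y0 y'0 h1 h2 r2 r3.
apply: ln_diff_bounds => //.
- by rewrite divr_ge0// ltW.
- rewrite ler_pdivrMr//; apply: le_trans h1 (le_trans h3 _).
  clear -e0 h2; nra.
- by rewrite ler_pdivlMr.
- by rewrite ler_pdivrMr// mul1r.
Qed.

Lemma le_ln1D_inv (x y : R) : 0 <= x -> x <= y -> x <= (1 + y) * ln (1 + x).
Proof.
move=> x0 xy; have x1 : 0 < 1 + x by lra.
have y1 : 0 < 1 + y by lra.
have e1 : (1 + x)^-1 = 1 + - (x / (1 + x)).
  apply: (mulIf (lt0r_neq0 x1)).
  by rewrite mulVf ?gt_eqF// mulrDl mulNr divfK ?gt_eqF//; ring.
have h : x / (1 + x) <= ln (1 + x).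
  rewrite -lerN2 -lnV ?posrE// [X in ln X]e1; apply: le_ln1Dx.
  by rewrite ltrN2 ltr_pdivrMr//; lra.
apply: le_trans (_ : (1 + y) * (x / (1 + x)) <= _); last by rewrite ler_pM2l.
by rewrite mulrA ler_pdivlMr// mulrC ler_wpM2r//; lra.
Qed.

(** The telescoping sum over unit steps gives [ln 2]; by monotonicity it is
    close to the integral of [hazard N], and so is [1 / d] times the sum over
    steps [1 / d]. *)
Lemma sum_hazard d e C : 0 < d -> 0 < e -> 0 <= C -> exists N0 : R, 0 < N0 /\
  forall (N : R) (n : nat), N0 <= N -> `|n%:R / d - N| <= C ->
  `|\sum_(0 <= j < n) hazard N (j.+1%:R / d) - d * ln 2| <= e.
Proof.
move=> d0 e0 C0.
have d'0 : 0 < d^-1 by rewrite invr_gt0.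
pose K := 4 + C + d^-1.
have K0 : 0 < K by rewrite /K; lra.
(* A bound on single hazards: it controls the errors of the Riemann sums and of
   replacing [ln (1 + x)] by [x]. *)
pose e' := Num.min (e / d) 1.
have e'0 : 0 < e' by rewrite lt_min divr_gt0//= ltr01.
have e'1 : e' <= 1 by rewrite ge_min lexx orbT.
have e'e : d * e' <= e.
  by rewrite mulrC -ler_pdivlMr// ge_min lexx.
pose eta := e' / (2 * (K + 1)).
have eta0 : 0 < eta by rewrite divr_gt0// mulr_gt0// addr_gt0.
have etaE : eta * (K + 1) = e' / 2 by rewrite /eta; field; rewrite gt_eqF// addr_gt0.
have e2 : 0 < e' / 2 by lra.
have e21 : e' / 2 < 1 by lra.
have [N1 [N10 H1]] := lnratio_bounds e2 e21.
have eta'0 : 0 <= eta^-1 by rewrite invr_ge0 ltW.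
have [N2 [N20 H2]] := low_large eta'0 C0.
exists (Num.max N1 (Num.max N2 3)); split.
  by rewrite lt_max (lt_trans _ N10).
move=> N n; rewrite !ge_max => /and3P[NN1 NN2 N3] nC.
have N0 : 0 < N by apply: lt_le_trans N3.
have g0 := @hazard_ge0 R N _ N0; have gm := hazard_homo N0.
have geta a : a <= N + C -> hazard N a <= eta.
  move=> aN; have [a0|a0] := ltP 0 a; last by rewrite /hazard ltNge a0 ltW.
  rewrite hazardE// -[leRHS]invrK lef_pV2 ?posrE ?invr_gt0//; first exact: H2.
  by rewrite mulr_gt0// low_gt0// ltW.
(* Unit steps ending at [N] make the sum telescope. *)
pose m := (Num.truncn N).-1; pose a := N - m%:R.
have tN : (1 < Num.truncn N)%N.
  have /andP[_ t1] := truncn_itv (ltW N0).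
  by rewrite -ltnS -(ltr_nat R) (le_lt_trans _ t1)//; lra.
have mE : m.+1 = Num.truncn N by rewrite /m prednK// ltnW.
have tr : m.+1%:R <= N < m.+2%:R.
  by rewrite mE; apply: truncn_itv; exact: ltW.
have a1 : 1 <= a by move: tr => /andP[]; rewrite -!natr1 /a; lra.
have a2 : a <= 2 by move: tr => /andP[]; rewrite -!natr1 /a; lra.
have a0 : 0 < a by exact: lt_le_trans a1.
have amN : a + m%:R = N by rewrite /a subrK.
have /andP[L1 L2] := H1 N a NN1 a1 a2.
have amN' : a + m%:R <= N by rewrite amN.
have := sum_ln_hazard a0 amN'; rewrite amN.
move: (lnratio N a - lnratio N N) L1 L2 => L L1 L2 sl.
have hz := hazard0 N.
have pb := fun x y => @prim_bounds _ _ g0 gm x y.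
have sp := fun x s m => @sum_prim_bounds _ _ g0 gm x s m.
move: (prim (hazard N)) pb sp; move: (hazard N) g0 gm geta sl hz.
move=> {H1 H2} g g0 gm geta sl hz P pb sp.
have /andP[u1 u2] := sp _ _ m (ltW a0) ler01.
rewrite mulr1 amN mul1r in u1 u2.
have su : \sum_(0 <= i < m) g (a + i.+1%:R * 1) = \sum_(0 <= i < m) g (a + i.+1%:R).
  by apply: eq_bigr => i _; rewrite mulr1.
rewrite su in u1 u2; set S := \sum_(0 <= i < m) g (a + i.+1%:R) in u1 u2.
have LS : L <= S.
  rewrite -sl; apply: ler_sum => i _; apply: le_ln1Dx.
  by apply: lt_le_trans (g0 _) => //; rewrite oppr_lt0.
have SL : S <= (1 + eta) * L.
  rewrite -sl mulr_sumr; apply: ler_sum_nat => i /andP[_ im].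
  have : g (a + i.+1%:R) <= eta.
    apply: geta; apply: (@le_trans _ _ (a + m%:R)).
      by rewrite lerD2l ler_nat.
    by rewrite amN lerDl.
  exact: le_ln1D_inv.
(* The steps [1 / d] start at 0, where the hazard rate vanishes. *)
have nd0 : 0 <= n%:R / d by rewrite divr_ge0// ltW.
have /andP[v1 v2] := sp _ _ n (lexx 0) (ltW d'0).
rewrite !add0r in v1 v2.
have sv : \sum_(0 <= i < n) g (0 + i.+1%:R * d^-1) = \sum_(0 <= i < n) g (i.+1%:R / d).
  by apply: eq_bigr => i _; rewrite add0r.
rewrite sv hz subr0 in v1 v2; set T := \sum_(0 <= i < n) g (i.+1%:R / d) in v1 v2 *.
have ndC : n%:R / d <= N + C by move: nC; rewrite ler_norml => /andP[_]; rewrite lerBlDl.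
have gn := geta _ ndC.
have NC : N <= N + C by rewrite lerDl.
have aC : a <= N + C by apply: le_trans NC; rewrite -amN lerDl.
have /andP[w1 w2] := pb _ _ (lexx 0) (ltW a0).
have ga := geta _ aC; have gN := geta _ NC.
rewrite !subr0 in w1 w2; rewrite hz mulr0 in w1.
have w3 : a * g a <= 2 * eta by apply: ler_pM => //; exact: ltW a0.
have Ceta : 0 <= C * eta by rewrite mulr_ge0// ltW.
have Nn1 : N - n%:R / d <= C by move: nC; rewrite ler_norml => /andP[]; clear; lra.
have Nn2 : n%:R / d - N <= C by move: nC; rewrite ler_norml => /andP[].
have /andP[y1 y2] : - (C * eta) <= P (n%:R / d) - P N <= C * eta.
  have [le_nN|lt_nN] := leP (n%:R / d) N.
    have /andP[x1 x2] := pb _ _ nd0 le_nN.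
    have z1 : (N - n%:R / d) * g N <= C * eta.
      by apply: ler_pM => //; rewrite subr_ge0.
    have z2 : 0 <= (N - n%:R / d) * g (n%:R / d) by rewrite mulr_ge0// subr_ge0.
    by move: x1 x2 z1 z2 Ceta; clear; move=> *; apply/andP; split; lra.
  have /andP[x1 x2] := pb _ _ (ltW N0) (ltW lt_nN).
  have z1 : (n%:R / d - N) * g (n%:R / d) <= C * eta.
    by apply: ler_pM => //; rewrite subr_ge0 ltW.
  have z2 : 0 <= (n%:R / d - N) * g N by rewrite mulr_ge0// subr_ge0 ltW.
  by move: x1 x2 z1 z2 Ceta; clear; move=> *; apply/andP; split; lra.
have gd : d^-1 * g (n%:R / d) <= d^-1 * eta by rewrite ler_pM2l.
have l2 : ln 2 <= 1 :> R.
  by rewrite (_ : 2 = 1 + 1)// le_ln1Dx// (lt_trans _ ltr01)// oppr_lt0.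
have Leta : eta * L <= eta by rewrite ler_piMr ?(ltW eta0)// (le_trans L2).
have hga := g0 a.
have KE : eta * (K + 1) = 5 * eta + C * eta + d^-1 * eta by rewrite /K; ring.
have d'eta : 0 <= d^-1 * eta by rewrite mulr_ge0// ltW.
have -> : T - d * ln 2 = d * (d^-1 * T - ln 2).
  by rewrite mulrBr mulrA divff ?mul1r// gt_eqF.
rewrite normrM gtr0_norm//; apply: le_trans e'e.
rewrite ler_pM2l// ler_norml.
move: v1 v2 u1 u2 w1 w2 w3 y1 y2 gd Leta hga KE d'eta LS SL L1 L2 gN etaE eta0.
clear; move: (P _) (P _) (P _) (P _) (g _) (g _) (g _) => *.
by apply/andP; split; lra.
Qed.

End hazard_sums.

(** * Truncated gamma integrals *)

Section log_tail.
Context {R : realType}.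
Notation leb := (@lebesgue_measure R).
Implicit Types (N a s t : R).

(** Restricting [t] to [t >= s] truncates the lower incomplete gamma integral
    at [N exp (- s)]. *)
Definition lowtail N a s : R := \int[leb]_(t in tail s) lowk N a t.

Lemma lowtail0 N a : lowtail N a 0 = low N a.
Proof. by rewrite lowE. Qed.

Lemma lowtailE N a s : lowtail N a s = lowk N a s * low (N * expR (- s)) a.
Proof.
have mk b : measurable_fun setT (lowk b a).
  exact: continuous_measurable_fun (@continuous_lowk _ b a).
rewrite /lowtail -[in LHS](add0r s) -Rintegral_tail_shift//; last exact: lowk_ge0.
rewrite lowE /Rintegral.
rewrite (_ : (\int[leb]_(t in tail 0) (lowk N a (t + s))%:E)%E =
  ((lowk N a s)%:E * \int[leb]_(t in tail 0) (lowk (N * expR (- s)) a t)%:E)%E).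
  have : (0 <= \int[leb]_(t in tail 0) (lowk (N * expR (- s)) a t)%:E)%E.
    by apply: integral_ge0 => t _; rewrite lee_fin lowk_ge0.
  case: (integral _ _ _) => [r _|_|//] /=; first by [].
  by rewrite gt0_muley ?lte_fin ?expR_gt0//= mulr0.
rewrite -ge0_integralZl//; last 4 first.
- exact: measurable_tail.
- by apply/measurable_EFinP; apply: measurable_funTS; exact: mk.
- by move=> t _; rewrite lee_fin lowk_ge0.
- by rewrite lee_fin lowk_ge0.
apply: eq_integral => t _; rewrite -EFinM /lowk -expRD; congr (expR _)%:E.
by rewrite opprD expRD; ring.
Qed.

Lemma lowtail_gt0 N a s : 0 <= N -> 0 < a -> 0 < lowtail N a s.
Proof.
move=> N0 a0; rewrite lowtailE mulr_gt0 ?expR_gt0// low_gt0//.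
by rewrite mulr_ge0 ?expR_ge0.
Qed.

Lemma is_derive_lowtail N a s : 0 <= N -> 0 < a ->
  is_derive s 1 (lowtail N a) (- lowk N a s).
Proof.
move=> N0 a0.
pose b := s - 1.
pose F x := \int[leb]_(t in [set` `[b, x]]) (lowk N a t).
have ib : leb.-integrable (tail b) (EFin \o lowk N a) by exact: integrable_lowk.
have sub : `[b, s + 1]%classic `<=` tail b.
  by move=> t; rewrite /tail/= !in_itv/= andbT => /andP[].
have ibs : leb.-integrable `[b, s + 1]%classic (EFin \o lowk N a).
  apply: (@integrableS _ (measurableTypeR R) R leb (tail b) `[b, s + 1]%classic) => //.
  exact: measurable_tail.
have sS : s < s + 1 by rewrite ltrDl.
have bs : b < s by rewrite /b ltrBlDr ltrDl.
have [dF F'] := continuous_FTC1_closed sS ibs bs (@continuous_lowk _ N a s).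
have E x : b <= x -> lowtail N a x = lowtail N a b - F x.
  move=> bx; rewrite /lowtail /F /tail Rintegral_itvB ?bnd_simp//.
  rewrite Rintegral_itv_obnd_cbnd//.
  apply: (@integrableS _ (measurableTypeR R) R leb (tail x) `]x, +oo[%classic) => //.
  - exact: measurable_tail.
  - by move=> t; rewrite /tail/= !in_itv/= !andbT => /ltW.
  - exact: integrable_lowk.
have F'' : 'D_1 F s = lowk N a s by rewrite -derive1E; exact: F'.
have dF' : is_derive s 1 F (lowk N a s) := DeriveDef dF F''.
have dG : is_derive s 1 (fun x => lowtail N a b - F x) (0 - lowk N a s).
  exact: is_derivefB (is_derive_cst (lowtail N a b) s 1) dF'.
rewrite -[- lowk N a s]sub0r; apply: near_eq_is_derive dG.
near=> x; apply/esym/E; near: x.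
exact: lt_le_nbhsr.
Unshelve. all: by end_near. Qed.

(** The mean value theorem: the logarithmic derivative of [lowtail N a] at [u]
    is [- 1 / low (N exp (- u)) a]. *)
Lemma ln_lowtail_bounds N a s : 0 < N -> 0 < a -> 0 <= s ->
  s / low N a <= ln (low N a / lowtail N a s) <= s / low (N * expR (- s)) a.
Proof.
move=> N0 a0; rewrite le_eqVlt => /predU1P[<-|s0].
  by rewrite lowtail0 (divff (lt0r_neq0 (low_gt0 (ltW N0) a0))) ln1 !mul0r lexx.
have Nu u : 0 <= N * expR (- u) by rewrite mulr_ge0 ?expR_ge0// ltW.
have dl (u : R) : is_derive u 1 (fun u => ln (lowtail N a u)) (- (low (N * expR (- u)) a)^-1).
  apply: is_derive_eq (is_derivef_ln (lowtail_gt0 u (ltW N0) a0)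
    (is_derive_lowtail u (ltW N0) a0)) _.
  rewrite lowtailE invfM mulrN mulrAC mulVf ?mul1r// gt_eqF// expR_gt0//.
have cl : {within `[0, s], continuous (fun u => ln (lowtail N a u))}.
  exact/continuous_subspaceT/(is_derive_continuous dl).
have [c] := MVT s0 (fun u _ => dl u) cl.
rewrite in_itv/= subr0 => /andP[c0 cs] e.
rewrite -lowtail0 ln_div ?posrE; [|exact: lowtail_gt0 (ltW N0) a0..].
have -> : ln (lowtail N a 0) - ln (lowtail N a s) = s / low (N * expR (- c)) a.
  by rewrite -opprB e mulNr opprK mulrC.
rewrite lowtail0 !(ler_pM2l s0) !lef_pV2 ?posrE; [|by apply: low_gt0 a0; first [exact: Nu|exact: ltW]..].
by apply/andP; split; apply: low_le => //;
  rewrite ?(ler_pM2l N0) ?(ler_piMr (ltW N0))// -?[leRHS]expR0 ler_expR ?lerN2 ?oppr_le0 ltW.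
Qed.

End log_tail.

(** * The limit of the gap product *)

Section edge_limit.
Context {R : realType}.
Implicit Types (d e xi s : R).

Lemma norm_expRB (x y : R) : x <= 0 -> y <= 0 -> `|expR x - expR y| <= `|x - y|.
Proof.
wlog xy : x y / x <= y.
  move=> h x0 y0; have [xy|/ltW yx] := leP x y; first exact: h.
  by rewrite distrC [leRHS]distrC; exact: h.
move=> x0 y0.
rewrite [X in X <= _]distrC [leRHS]distrC !ger0_norm ?subr_ge0 ?ler_expR//.
have h : expR x = expR y * expR (x - y) by rewrite -expRD addrC subrK.
have h1 := expR_ge1Dx (x - y).
have y1 : expR y <= 1 by rewrite -[leRHS]expR0 ler_expR.
have y2 := expR_gt0 y.
move: h1 y1 y2 xy; rewrite h; move: (expR y) (expR (x - y)) => p q; clear; nra.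
Qed.

(** The depth of the circle bounding the event that the rescaled spectral
    radius is at most [xi]. *)
Definition edge_shift d xi (n : nat) : R := - (2 * d * ln (1 + xi / (n%:R * d * ln 4))).

(** The logarithm of each factor lies between [- N s hazard N] and [- N' s
    hazard N'] with [N' = N exp (- s)] within a bounded distance of [N]; both
    sums of hazard rates are close to [d ln 2]. *)
Lemma edge_limit d xi e : 0 < d -> xi <= 0 -> 0 < e -> exists n0 : nat, forall n, (n0 <= n)%N ->
  [/\ (0 < n)%N, 0 < 1 + xi / (n%:R * d * ln 4), 0 <= edge_shift d xi n &
  `|\prod_(j < n) (lowtail (n%:R / d) (j.+1%:R / d) (edge_shift d xi n)
      / low (n%:R / d) (j.+1%:R / d)) - expR xi| <= e].
Proof.
move=> d0 xi0 e0.
have l2 : 0 < ln 2 :> R by rewrite ln_gt0// ltr1n.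
have l4 : ln 4 = 2 * ln 2 :> R by rewrite (_ : 4 = 2 ^+ 2) ?lnXn ?mulr_natl//; ring.
(* [c] is the limit of [N * s]. *)
pose c := - xi / (d * ln 2).
have c0 : 0 <= c by rewrite divr_ge0 ?oppr_ge0// mulr_ge0// ltW.
have cE : c * (d * ln 2) = - xi by rewrite /c divfK// gt_eqF// mulr_gt0.
pose e' := Num.min 1 (e / (2 * (c + 1))).
have c1 : 0 < c + 1 by rewrite ltr_wpDl.
have e'0 : 0 < e' by rewrite lt_min ltr01 divr_gt0// mulr_gt0.
have e'1 : e' <= 1 by rewrite ge_min lexx.
have e'e : e' * (c + 1) <= e / 2.
  rewrite -ler_pdivlMr// -mulrA -invfM [_ * (c + 1)]mulrC -[X in _ <= X]mulrC.
  by rewrite ge_min; apply/orP; right; rewrite mulrC [(c+1) * 2]mulrC.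
have [N0 [N00 HN]] := sum_hazard d0 e'0 (addr_ge0 c0 c0).
have d1 : 0 < d + 1 by rewrite addr_gt0.
pose dl := Num.min 2^-1 (e / (4 * ((c + 1) * (d + 1)))).
have dl0 : 0 < dl by rewrite lt_min invr_gt0 ltr0n/= divr_gt0// !mulr_gt0.
have dl2 : dl <= 2^-1 by rewrite ge_min lexx.
have dle : dl * (4 * ((c + 1) * (d + 1))) <= e.
  by rewrite -ler_pdivlMr ?mulr_gt0// ge_min lexx orbT.
pose X := d * (N0 + (c + c)) + c / (2 * dl) + 1.
have X1 : 1 <= X.
  rewrite lerDr; apply: addr_ge0.
    by rewrite mulr_ge0 ?(ltW d0)// addr_ge0 ?(ltW N00)// addr_ge0.
  by rewrite divr_ge0// mulr_ge0// ltW.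
exists (Num.bound X) => n nX.
have Xn : X <= n%:R.
  apply: le_trans (ltW (archi_boundP _)) _; last by rewrite ler_nat.
  exact: le_trans X1.
have n0 : 0 < n%:R :> R by apply: lt_le_trans Xn; apply: lt_le_trans X1.
have n0' : (0 < n)%N by rewrite -(ltr_nat R).
pose y := c / (2 * n%:R).
have y0 : 0 <= y by rewrite divr_ge0// mulr_ge0.
have ydl : y <= dl.
  have h : c / (2 * dl) <= n%:R.
    apply: le_trans Xn; rewrite /X addrAC lerDr.
    by rewrite addr_ge0// mulr_ge0 ?(ltW d0)// addr_ge0 ?(ltW N00)// addr_ge0.
  rewrite ler_pdivrMr ?mulr_gt0//.
  rewrite (_ : dl * (2 * n%:R) = n%:R * (2 * dl)); last by ring.
  by rewrite -ler_pdivrMr// mulr_gt0.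
have y2 : y <= 2^-1 := le_trans ydl dl2.
have yE : 1 + xi / (n%:R * d * ln 4) = 1 - y.
  by rewrite /y /c l4; field; rewrite !gt_eqF.
have y1 : 0 < 1 - y by move: y2; clear; lra.
set s := edge_shift d xi n.
have sE : s = 2 * d * - ln (1 - y) by rewrite /s /edge_shift yE mulrN.
have ly1 : y <= - ln (1 - y).
  by rewrite lerNr; apply: le_ln1Dx; move: y1; clear; lra.
have ly2 : - ln (1 - y) <= y * (1 + 2 * y).
  rewrite -lnV ?posrE//.
  have -> : (1 - y)^-1 = 1 + y / (1 - y).
    apply: (mulIf (lt0r_neq0 y1)).
    by rewrite mulVf ?gt_eqF// mulrDl divfK ?gt_eqF//; ring.
  apply: le_trans (le_ln1Dx _) _.
    by apply: (@lt_le_trans _ _ 0); [rewrite oppr_lt0|rewrite divr_ge0// ltW].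
  by rewrite ler_pdivrMr//; move: y0 y2; clear; nra.
have s0 : 0 <= s by rewrite sE mulr_ge0 ?mulr_ge0 ?(ltW d0)// (le_trans y0).
pose N := n%:R / d; have Np : 0 < N by rewrite divr_gt0.
have NsE : N * s = 2 * n%:R * - ln (1 - y) by rewrite sE /N; field; rewrite gt_eqF.
have nyE : 2 * n%:R * y = c by rewrite /y; field; rewrite gt_eqF.
have Ns1 : c <= N * s by rewrite NsE -nyE ler_pM2l// mulr_gt0.
have Ns2 : N * s <= c * (1 + 2 * y).
  by rewrite NsE -nyE -(mulrA (2 * n%:R)) ler_pM2l// mulr_gt0.
have Ns3 : N * s <= c + c.
  by apply: le_trans Ns2 _; move: c0 y0 y2; clear; nra.
pose N' := N * expR (- s).
have N'p : 0 < N' by rewrite mulr_gt0// expR_gt0.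
have N'N : N' <= N.
  by rewrite ler_piMr ?(ltW Np)// -[leRHS]expR0 ler_expR oppr_le0.
have N'C : N - N' <= c + c.
  apply: le_trans Ns3; rewrite /N' -{1}[N]mulr1 -mulrBr ler_pM2l//.
  by have := expR_ge1Dx (- s); clear; lra.
have NN0 : N0 + (c + c) <= N.
  rewrite /N ler_pdivlMr// mulrC; apply: le_trans Xn.
  by rewrite /X -addrA lerDl addr_ge0// divr_ge0// mulr_ge0// ltW.
have N'N0 : N0 <= N' by move: NN0 N'C; clear; lra.
have NN0' : N0 <= N := le_trans N'N0 N'N.
pose T := \sum_(0 <= j < n) hazard N (j.+1%:R / d).
pose T' := \sum_(0 <= j < n) hazard N' (j.+1%:R / d).
have NNC : `|n%:R / d - N| <= c + c by rewrite subrr normr0 addr_ge0.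
have N'NC : `|n%:R / d - N'| <= c + c by rewrite ger0_norm ?subr_ge0.
have : `|T - d * ln 2| <= e' by exact: HN.
rewrite ler_norml => /andP[T1 _].
have : `|T' - d * ln 2| <= e' by exact: HN.
rewrite ler_norml => /andP[_ T'1].
have jd0 (j : nat) : 0 < j.+1%:R / d by rewrite divr_gt0.
pose W := \sum_(0 <= j < n) ln (low N (j.+1%:R / d) / lowtail N (j.+1%:R / d) s).
have r0 (j : nat) : 0 < low N (j.+1%:R / d) / lowtail N (j.+1%:R / d) s.
  by rewrite divr_gt0 ?low_gt0 ?lowtail_gt0// ltW.
have -> : \prod_(j < n) (lowtail N (j.+1%:R / d) s / low N (j.+1%:R / d)) = expR (- W).
  rewrite /W big_mkord -sumrN expR_sum; apply: eq_bigr => j _.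
  by rewrite expRN lnK ?posrE// invf_div.
have W1 : N * s * T <= W.
  rewrite /T /W mulr_sumr; apply: ler_sum => j _.
  have /andP[+ _] := ln_lowtail_bounds Np (jd0 j) s0.
  rewrite hazardE// (_ : N * s * _ = s / low N (j.+1%:R / d))//.
  by field; rewrite !gt_eqF// low_gt0// ltW.
have W2 : W <= N' * s * T'.
  rewrite /T' /W mulr_sumr; apply: ler_sum => j _.
  have /andP[_] := ln_lowtail_bounds Np (jd0 j) s0.
  rewrite hazardE// -/N' (_ : N' * s * _ = s / low N' (j.+1%:R / d))//.
  by field; rewrite !gt_eqF// low_gt0// ltW.
have l21 : ln 2 <= 1 :> R.
  by rewrite (_ : 2 = 1 + 1)// le_ln1Dx// (lt_trans _ ltr01)// oppr_lt0.
have dl21 : d * ln 2 <= d by rewrite ler_piMr// ltW.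
have W3 : - xi - c * e' <= W.
  apply: le_trans W1; rewrite -cE.
  have [T0|T0] := leP 0 T.
    apply: le_trans (_ : c * T <= _); last by rewrite ler_wpM2r.
    by rewrite -mulrBr ler_wpM2l//; move: T1; clear; lra.
  exfalso; move: T0; apply/negP; rewrite -leNgt; apply: sumr_ge0 => j _.
  exact: hazard_ge0.
have W4 : W <= - xi + e.
  apply: le_trans W2 _.
  have T'0 : 0 <= T' by apply: sumr_ge0 => j _; exact: hazard_ge0.
  apply: (@le_trans _ _ (N * s * T')).
    by rewrite ler_wpM2r// ler_wpM2r.
  apply: (@le_trans _ _ (c * (1 + 2 * y) * T')).
    by rewrite ler_wpM2r.
  apply: (@le_trans _ _ (c * (1 + 2 * y) * (d * ln 2 + e'))).
    rewrite ler_wpM2l//; last by move: T'1; clear; lra.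
    by rewrite mulr_ge0// addr_ge0// mulr_ge0.
  have b1 : c * (1 + 2 * y) * (d * ln 2 + e') =
      - xi + c * e' + 2 * (c * (y * (d * ln 2 + e'))) by rewrite -cE; ring.
  have b2 : y * (d * ln 2 + e') <= dl * (d + 1).
    by apply: ler_pM => //; [rewrite addr_ge0 ?mulr_ge0 ?(ltW d0) ?(ltW l2) ?(ltW e'0)|exact: lerD].
  have b3 : c * (y * (d * ln 2 + e')) <= (c + 1) * (dl * (d + 1)).
    apply: ler_pM => //; last by rewrite lerDl.
    by rewrite mulr_ge0// addr_ge0 ?mulr_ge0 ?(ltW d0) ?(ltW l2) ?(ltW e'0).
  have b4 : 4 * ((c + 1) * (dl * (d + 1))) <= e.
    by apply: le_trans dle; rewrite le_eqVlt; apply/orP; left; apply/eqP; ring.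
  rewrite b1; move: b3 b4 e'e e'0; clear; move: (c * (y * _)) ((c + 1) * (dl * _)) => p q.
  by move=> *; lra.
split => //.
- by rewrite yE.
- have W0 : 0 <= W.
    apply: le_trans W1; apply: mulr_ge0; first exact: mulr_ge0 (ltW Np) s0.
    by apply: sumr_ge0 => j _; exact: hazard_ge0.
  apply: le_trans (norm_expRB _ xi0) _; first by rewrite oppr_le0.
  rewrite ler_norml; move: W3 W4 e'e e'0 e0; clear; move=> *.
  by apply/andP; split; lra.
Qed.

End edge_limit.

(** * Radial moments of the truncated weight *)

Section truncated_moments.
Context {R : realType}.
Notation leb := (@lebesgue_measure R).
Notation tup n := (n.-tuple (plane R)).

Lemma cabs_logdepth (d : R) z : 0 < d -> 0 < cabs z ->
  cabs z = edge d * expR (- (logdepth d z / (2 * d))).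
Proof.
move=> d0 z0; rewrite /edge /logdepth /powR gt_eqF// -expRD -[LHS]lnK ?posrE//.
by congr expR; field; rewrite gt_eqF.
Qed.

Lemma powR_cabs (d : R) z : 0 < d -> 0 < cabs z ->
  cabs z `^ (2 * d) = expR (- logdepth d z) / d.
Proof.
move=> d0 z0; rewrite /logdepth /powR gt_eqF// opprK expRD lnK ?posrE//.
by rewrite [d * _]mulrC mulfK// gt_eqF.
Qed.

Definition truncated_weight (d : R) (n : nat) (r : R) (z : plane R) : R :=
  if cabs z <= r then expR (- (n%:R * cabs z `^ (2 * d))) else 0.

Lemma truncated_weight_ge0 d n r z : 0 <= truncated_weight d n r z.
Proof. by rewrite /truncated_weight; case: ifP => // _; exact: expR_ge0. Qed.

Lemma measurable_truncated_weight d n r : measurable_fun setT (truncated_weight d n r).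
Proof.
apply: measurable_fun_ifT => //.
- by apply: measurable_fun_ler => //; exact: measurable_cabs.
- apply: measurableT_comp => //; apply: measurableT_comp => //.
  apply: measurable_funM => //; apply: (measurableT_comp (measurable_powR _)).
  exact: measurable_cabs.
Qed.

Lemma truncated_weight_rotation d n r u z : cabs u = 1 ->
  truncated_weight d n r (pmul u z) = truncated_weight d n r z.
Proof. by move=> u1; rewrite /truncated_weight cabs_pmul u1 mul1r. Qed.

(** The factor of the moments which does not depend on the truncation, and
    cancels in the gap probability. *)
Definition moment_scale (d : R) (n p : nat) : R :=
  disc_area * edge d ^+ 2 / d * edge d ^+ (2 * p) * expR (- (n%:R / d)).

Lemma moment_scale_gt0 d n p : 0 < d -> 0 < moment_scale d n p.
Proof.
move=> d0; rewrite /moment_scale !mulr_gt0 ?expR_gt0 ?invr_gt0 ?exprn_gt0 ?edge_gt0//.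
exact: disc_area_gt0.
Qed.

(** At depth [t] the weight is [exp (- (n / d) exp (- t))] and [|z| ^ (2 p)]
    is proportional to [exp (- p t / d)], so the moments are incomplete gamma
    integrals. *)
Lemma integral_truncated_weight (d : R) n p (s : R) : 0 < d -> 0 <= s ->
  (\int[@area R]_z (cabs z ^+ (2 * p) *
     truncated_weight d n (edge d * expR (- (s / (2 * d)))) z)%:E =
   (moment_scale d n p * lowtail (n%:R / d) (p.+1%:R / d) s)%:E)%E.
Proof.
move=> d0 s0; set r := edge d * _.
have e0 := edge_gt0 d0.
have re : r <= edge d.
  rewrite /r ger_pMr// -[leRHS]expR0 ler_expR oppr_le0.
  by rewrite divr_ge0// mulr_ge0// ltW.
pose N := n%:R / d; pose g t : R := edge d ^+ (2 * p) * expR (- (p%:R / d * t)) *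
  expR (- (N * expR (- t))).
pose f t : R := if s <= t then g t else 0.
have g0 t : 0 <= g t by rewrite !mulr_ge0 ?expR_ge0// exprn_ge0// ltW.
have mg : measurable_fun setT g.
  apply: measurable_funM.
    apply: measurable_funM => //; apply: measurableT_comp => //.
    by apply: measurableT_comp => //; apply: measurable_funM.
  apply: measurableT_comp => //; apply: measurableT_comp => //.
  by apply: measurable_funM => //; apply: measurableT_comp.
have mf : measurable_fun setT f.
  by apply: measurable_fun_ifT => //; apply: measurable_fun_ler.
have f0 t : 0 <= f t by rewrite /f; case: ifP.
transitivity (\int[@area R]_(z in disc (edge d)) (f (logdepth d z))%:E)%E.
  rewrite [RHS]integral_mkcond; apply: ae_eq_integral => //.
  - apply/measurable_EFinP; apply: measurable_funM.
      by apply: measurable_funX; exact: measurable_cabs.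
    exact: measurable_truncated_weight.
  - apply: (measurable_restrictT _ _).1; first exact: measurable_disc.
    apply: measurable_funTS; apply/measurable_EFinP.
    exact: measurableT_comp (measurable_logdepth _).
  exists [set (0, 0)]; split; [|exact: area_origin|].
    by rewrite set1_pair; apply: measurableX.
  move=> z /=; apply: contra_notP => z0 _.
  have {z0} z0 : 0 < cabs z.
    by rewrite lt_neqAle cabs_ge0 andbT; apply/eqP => /esym/cabs_eq0.
  rewrite patchE; case: ifPn => [_|]; last first.
    rewrite notin_setE /disc/= => /negP; rewrite -ltNge => ez.
    by rewrite /truncated_weight leNgt (le_lt_trans re ez)/= mulr0.
  rewrite /f /truncated_weight -le_logdepth//; case: ifP => _; last by rewrite mulr0.
  congr EFin; rewrite /g powR_cabs// (cabs_logdepth d0 z0) exprMn -expRM_natl.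
  congr (_ * expR _ * expR _).
    by rewrite natrM; field; rewrite gt_eqF.
  by rewrite /N; field; rewrite gt_eqF.
rewrite (@integral_logdepth _ d (EFin \o f))//; last exact/measurable_EFinP.
set K := disc_area * _ / d.
have K0 : 0 < K by rewrite !mulr_gt0 ?invr_gt0 ?exprn_gt0// disc_area_gt0.
have lowtailE' : (\int[leb]_(t in tail s) (lowk N (p.+1%:R / d) t)%:E =
    (lowtail N (p.+1%:R / d) s)%:E)%E.
  rewrite /lowtail /Rintegral fineK//; apply: integrable_fin_num; first exact: measurable_tail.
  by apply: integrable_lowk; [exact: divr_ge0 (ler0n _ _) (ltW d0)|exact: divr_gt0].
transitivity (K%:E * ((edge d ^+ (2 * p) * expR (- N))%:E *
    (lowtail N (p.+1%:R / d) s)%:E))%E; last first.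
  by rewrite -!EFinM /moment_scale -/K -/N; congr EFin; rewrite !mulrA.
congr (_ * _)%E; rewrite -lowtailE' -ge0_integralZl; last 4 first.
- exact: measurable_tail.
- apply/measurable_EFinP; apply: measurable_funTS.
  exact: continuous_measurable_fun (@continuous_lowk _ _ _).
- by move=> t _; rewrite lee_fin lowk_ge0.
- by rewrite lee_fin mulr_ge0 ?expR_ge0 ?exprn_ge0 ?ltW.
rewrite [LHS]integral_mkcond [RHS]integral_mkcond; apply: eq_integral => t _.
rewrite !patchE /tail !mem_setE !in_itv/= !andbT /f.
case: (leP s t) => st; last by case: ifP; rewrite ?mul0e.
rewrite (le_trans s0 st) -!EFinM; congr EFin; rewrite /g /lowk -!mulrA; congr (_ * _).
by rewrite -!expRD; congr expR; rewrite /N -natr1; field; rewrite gt_eqF.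
Qed.

End truncated_moments.

(** * The gap probability of the hard edge ensemble *)

Section gap_probability.
Context {R : realType}.
Notation tup n := (n.-tuple (plane R)).
Notation power_potential d := (fun z : plane R => (cabs z `^ (2 * d))%:E).

Lemma gibbs_weight_disc (d r : R) n (x : tup n) :
  gibbs_weight (localized (power_potential d) (disc r)) x =
  (vandermonde_sq x * \prod_(j < n) truncated_weight d n r (tnth x j))%:E.
Proof.
rewrite /gibbs_weight -/(vandermonde_sq x) EFinM; congr (_ * _)%E.
have [/forallP inS|/forallPn/= [j xj]] := boolP [forall j, cabs (tnth x j) <= r].
  rewrite (eq_bigr (fun j => (cabs (tnth x j) `^ (2 * d))%:E)); last first.
    by move=> j _; rewrite /localized mem_set//; exact: inS.
  rewrite sumEFin -EFinM -EFinN/=; congr EFin.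
  rewrite mulr_sumr -sumrN expR_sum; apply: eq_bigr => j _.
  by rewrite /truncated_weight inS.
have -> : (\sum_(j < n) localized (power_potential d) (disc r) (tnth x j) = +oo)%E.
  apply/esum_eqyP.
    by move=> i _; rewrite /localized; case: ifP.
  exists j; split => //.
  by rewrite /localized memNset//=; exact/negP.
have n0 : (0 < n)%N by apply: leq_trans (ltn_ord j).
rewrite gt0_muley ?lte_fin ?ltr0n//=.
by rewrite (bigD1 j)//= /truncated_weight (negbTE xj) mul0r.
Qed.

Lemma spectral_radius_le n (x : tup n) (r : R) : 0 <= r ->
  (spectral_radius x <= r) = [forall j, cabs (tnth x j) <= r].
Proof.
move=> r0; apply/bigmax_leP/forallP => [[_ +] j|xr].
  exact.
by split.
Qed.

Definition edge_radius (d s : R) : R := edge d * expR (- (s / (2 * d))).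

Lemma edge_radius0 (d : R) : edge_radius d 0 = edge d.
Proof. by rewrite /edge_radius mul0r oppr0 expR0 mulr1. Qed.

Lemma rescaled_radius_le (d xi : R) n (x : tup n) : 0 < d -> (0 < n)%N ->
  0 < 1 + xi / (n%:R * d * ln 4) ->
  (rescaled_radius d x <= xi) =
  [forall j, cabs (tnth x j) <= edge_radius d (edge_shift d xi n)].
Proof.
move=> d0 n0 xi0.
have l4 : 0 < ln 4 :> R by rewrite ln_gt0// ltr1n.
have n0' : 0 < n%:R :> R by rewrite ltr0n.
rewrite -spectral_radius_le ?mulr_ge0 ?expR_ge0 ?(ltW (edge_gt0 _))//.
rewrite /edge_radius /edge_shift mulNr opprK mulrAC mulfV ?gt_eqF ?mulr_gt0//.
rewrite mul1r lnK ?posrE// /edge powRN /rescaled_radius.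
have c0 : 0 < d `^ (1 / (2 * d)) by exact: powR_gt0.
move: (d `^ _) c0 => c c0.
rewrite mulrAC -ler_pdivlMl; last by rewrite !mulr_gt0.
rewrite lerBlDl [RHS]ler_pdivlMl//; congr (_ <= 1 + _).
by rewrite mulrC; congr (_ / _); ring.
Qed.

Definition gap_product (d : R) n (s : R) : R :=
  \prod_(j < n) (lowtail (n%:R / d) (j.+1%:R / d) s / low (n%:R / d) (j.+1%:R / d)).

Lemma partition_functionE (d : R) n (s : R) : 0 < d -> 0 <= s ->
  area_integral (fun x : tup n => (vandermonde_sq x *
     \prod_(j < n) truncated_weight d n (edge_radius d s) (tnth x j))%:E) =
  (n`!%:R * \prod_(p < n) (moment_scale d n p * lowtail (n%:R / d) (p.+1%:R / d) s))%:E.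
Proof.
move=> d0 s0; apply: (area_integral_radial (m := fun p => moment_scale d n p * lowtail (n%:R / d) (p.+1%:R / d) s)).
- exact: measurable_truncated_weight.
- exact: truncated_weight_ge0.
- by move=> u z; exact: truncated_weight_rotation.
- by move=> p _; exact: integral_truncated_weight.
Qed.

(** Numerator and denominator are both products of moments, by
    [area_integral_radial]. *)
Lemma gap_probability (d : R) n (s : R) : 0 < d -> 0 <= s ->
  area_integral (@joint_density R (localized (power_potential d) (disc (edge d))) n
     \_ [set x | [forall j, cabs (tnth x j) <= edge_radius d s]]) =
  (gap_product d n s)%:E.
Proof.
move=> d0 s0.
have e0 := edge_gt0 d0.
have re : edge_radius d s <= edge d.
  rewrite /edge_radius ger_pMr// -[leRHS]expR0 ler_expR oppr_le0.
  by rewrite divr_ge0// mulr_ge0// ltW.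
pose Z := n`!%:R * \prod_(p < n) (moment_scale d n p * lowtail (n%:R / d) (p.+1%:R / d) 0).
have N0 : 0 <= n%:R / d by exact: divr_ge0 (ler0n _ _) (ltW d0).
have a0 p : 0 < p.+1%:R / d by rewrite divr_gt0.
have Z0 : 0 < Z.
  rewrite mulr_gt0 ?ltr0n ?fact_gt0// prodr_gt0// => p _.
  by rewrite mulr_gt0 ?moment_scale_gt0 ?lowtail_gt0.
pose Q := localized (power_potential d) (disc (edge d)).
have ZE : @partition_function R Q n = Z%:E.
  rewrite /partition_function -(@partition_functionE d n 0)//; congr area_integral.
  by apply/funext => x; rewrite gibbs_weight_disc edge_radius0.
pose F (x : tup n) : \bar R := (vandermonde_sq x *
     \prod_(j < n) truncated_weight d n (edge_radius d s) (tnth x j))%:E.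
have F0 x : (0 <= F x)%E.
  rewrite lee_fin mulr_ge0 ?vandermonde_sq_ge0// prodr_ge0// => j _.
  exact: truncated_weight_ge0.
have mF : measurable_fun setT F.
  apply/measurable_EFinP; apply: measurable_funM; first exact: measurable_vandermonde_sq.
  apply: measurable_prod => j _.
  apply: (measurableT_comp (measurable_truncated_weight _ _ _)).
  exact: measurable_tnth.
have -> : joint_density Q (n := n) \_ [set x | [forall j, cabs (tnth x j) <= edge_radius d s]] =
   (fun x => (Z^-1)%:E * F x)%E.
  apply/funext => x; rewrite patchE /joint_density ZE inver gt_eqF//.
  rewrite gibbs_weight_disc muleC /F.
  case: ifPn => [|].
    rewrite inE /= => /forallP xr; congr (_ * (_ * _)%:E)%E.
    apply: eq_bigr => j _; rewrite /truncated_weight xr (le_trans _ re)//.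
  rewrite notin_setE/= => /negP/forallPn/= [j xj].
  by rewrite (bigD1 j)//= {1}/truncated_weight (negbTE xj) mul0r mulr0 mule0.
rewrite area_integralZl ?invr_ge0 ?ltW//.
rewrite /F partition_functionE// -EFinM; congr EFin.
rewrite invfM mulrACA mulVf ?mul1r; last by rewrite gt_eqF// ltr0n fact_gt0.
rewrite mulrC -prodf_div; apply: eq_bigr => p _.
rewrite -mulf_div divff ?mul1r ?lowtail0//.
by rewrite gt_eqF// moment_scale_gt0.
Qed.

End gap_probability.

(** * Uniform convergence of the spectral radius *)

Section uniform_convergence.
Context {R : realType}.
Notation tup n := (n.-tuple (plane R)).

(** Polya's argument: on an interval of length [e / 2] all functions are
    monotone and the limit varies by at most [e / 2]; the induction extends
    the interval of uniform convergence by one such step. *)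
Lemma uniform_monotone_cvg_expR (F : nat -> R -> R) :
  (forall n (x y : R), x <= y -> F n x <= F n y) ->
  (forall xi e : R, xi <= 0 -> 0 < e -> exists n0, forall n, (n0 <= n)%N ->
     `|F n xi - expR xi| <= e) ->
  forall a e : R, 0 < e -> exists n0, forall n, (n0 <= n)%N ->
    forall xi : R, a <= xi <= 0 -> `|F n xi - expR xi| <= e.
Proof.
move=> monF cvF a e e0.
pose h := e / 2; have h0 : 0 < h by rewrite divr_gt0.
have lip (x y : R) : x <= y -> y <= 0 -> expR y - expR x <= y - x.
  move=> xy y0; have -> : expR x = expR y * expR (x - y) by rewrite -expRD addrC subrK.
  have g1 : expR y <= 1 by rewrite -expR0 ler_expR.
  have g2 := expR_ge1Dx (x - y); have g3 := expR_ge0 y.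
  have g4 : expR (x - y) <= 1 by rewrite -[leRHS]expR0 ler_expR subr_le0.
  by move: (expR y) (expR (x - y)) g1 g2 g3 g4 => u v; nra.
have step k : exists n0, forall n, (n0 <= n)%N ->
    forall xi : R, - (k%:R * h) <= xi <= 0 -> `|F n xi - expR xi| <= e.
  elim: k => [|k [n0 IH]].
    have [n0 H] := cvF 0 e (lexx 0) e0.
    by exists n0 => n nn xi; rewrite mul0r oppr0 => /le_anti <-; exact: H.
  have kh : - (k%:R * h) <= 0 by rewrite oppr_le0 mulr_ge0// ltW.
  have k1h : - (k.+1%:R * h) <= 0 by rewrite oppr_le0 mulr_ge0// ltW.
  have [n1 H1] := cvF _ h kh h0; have [n2 H2] := cvF _ h k1h h0.
  exists (maxn n0 (maxn n1 n2)) => n; rewrite !geq_max => /and3P[nn0 nn1 nn2] xi /andP[lx x0].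
  have [xk|xk] := leP (- (k%:R * h)) xi; first by apply: IH => //; rewrite xk.
  have := lip _ _ (le_trans lx (ltW xk)) kh.
  have m1 : F n (- (k.+1%:R * h)) <= F n xi by apply: monF.
  have m2 : F n xi <= F n (- (k%:R * h)) by apply: monF; exact: ltW.
  have e1 : expR (- (k.+1%:R * h)) <= expR xi by rewrite ler_expR.
  have e2 : expR xi <= expR (- (k%:R * h)) by rewrite ler_expR ltW.
  have := H1 _ nn1; have := H2 _ nn2; rewrite !ler_norml.
  rewrite (_ : e = h + h); last by rewrite /h; lra.
  have -> : - (k%:R * h) - - (k.+1%:R * h) = h by rewrite -natr1; ring.
  move: m1 m2 e1 e2; clear; lra.
have [k kP] : exists k : nat, - a / h <= k%:R.
  by exists (Num.truncn `|- a / h|).+1; rewrite (le_trans (ler_norm _))// ltW// truncnS_gt.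
have [n0 H] := step k; exists n0 => n nn xi /andP[ax x0]; apply: H => //.
rewrite x0 andbT (le_trans _ ax)// lerNl; move: kP; by rewrite ler_pdivrMr.
Qed.

Lemma measurable_spectral_radius n : measurable_fun setT (@spectral_radius R n).
Proof.
rewrite /spectral_radius; elim: (index_enum _) => [|j s IH].
  by under eq_fun do rewrite big_nil; exact: measurable_cst.
under eq_fun do rewrite big_cons.
apply: measurable_maxr => //; apply: (measurableT_comp (@measurable_cabs R)).
exact: measurable_tnth.
Qed.

Lemma measurable_rescaled_radius (d : R) n : measurable_fun setT (@rescaled_radius R d n).
Proof.
rewrite /rescaled_radius; apply: measurable_funM => //; apply: measurable_funM => //.
apply: measurable_funB => //; apply: measurable_funM => //.
exact: measurable_spectral_radius.
Qed.

Lemma spectral_radius_cvg (d : R) (d0 : 0 < d) (dO : nat -> measure_display)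
    (Omega : forall n, measurableType (dO n))
    (P : forall n, probability (Omega n) R)
    (z : forall n, {RV (P n) >-> n.-tuple (plane R)}) :
  (forall n, is_hard_edge_ensemble (fun z : plane R => (cabs z `^ (2 * d))%:E)
     (disc (edge d)) (z n)) ->
  forall K : set R, compact K -> K `<=` [set xi | xi <= 0] ->
  {uniform K, (fun (n : nat) (xi : R) =>
      fine (P n [set w | rescaled_radius d (z n w) <= xi])) @ \oo -->
    (fun xi : R => expR xi)}.
Proof.
move=> hz K cK K0.
pose F n xi := fine (P n [set w | rescaled_radius d (z n w) <= xi]).
have mB n xi : measurable [set x : tup n | rescaled_radius d x <= xi].
  have := measurable_rescaled_radius d measurableT (measurable_itv `]-oo, xi]).
  by move=> /(_ n); rewrite setTI; congr measurable; apply/seteqP; split => x /=; rewrite in_itv.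
have mzB n xi : measurable [set w | rescaled_radius d (z n w) <= xi].
  rewrite -[X in measurable X]setTI.
  exact: (measurable_funPT (z n) measurableT _ (mB n xi)).
have monF n x y : x <= y -> F n x <= F n y.
  move=> xy; apply: fine_le; rewrite ?fin_num_measure//.
  apply: le_measure; rewrite ?inE// => w /= wx; exact: le_trans xy.
have cvF xi e : xi <= 0 -> 0 < e -> exists n0, forall n, (n0 <= n)%N ->
     `|F n xi - expR xi| <= e.
  move=> xi0 e0; have [n0 H] := edge_limit d0 xi0 e0.
  exists n0 => n /H[n_gt0 pos s0]; congr (`|_ - _| <= _).
  rewrite /F.
  have -> : P n [set w | rescaled_radius d (z n w) <= xi] =
     distribution (P n) (z n) [set x | rescaled_radius d x <= xi] by [].
  rewrite hz// (_ : [set x | _] = [set x : tup n |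
     [forall j, cabs (tnth x j) <= edge_radius d (edge_shift d xi n)]]).
    by rewrite gap_probability.
  by apply/seteqP; split => x /=; rewrite rescaled_radius_le.
have [a aK] : exists a, forall x, K x -> a <= x.
  have := compact_bounded cK => -[M [_ /(_ (M + 1))]].
  rewrite ltrDl => /(_ ltr01) KM; exists (- (M + 1)) => x Kx.
  by have := KM x Kx; rewrite /= ler_norml => /andP[].
move=> A /uniform_nbhs[E [+ EA]]; rewrite -entourage_ballE => -[e /= e0 eE].
have [n0 H] := uniform_monotone_cvg_expR monF cvF a (divr_gt0 e0 (@ltr0n R 2)).
exists n0 => // n /= nn; apply: EA => xi Kxi; apply: eE => /=.
rewrite /ball/= distrC (le_lt_trans (H n nn xi _))//; last first.
  by rewrite ltr_pdivrMr// ltr_pMr// ltr1n.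
by rewrite aK//= K0.
Qed.

End uniform_convergence.

(** * Borel sets, supports and equality of measures in the plane *)

Section plane_measures.
Context {R : realType}.
Notation Rm := (measurableTypeR R).
Implicit Types (U : set (plane R)) (z : plane R).

Definition quadrant (a : R * R) : set (plane R) :=
  (`]a.1, +oo[%classic : set Rm) `*` (`]a.2, +oo[%classic : set Rm).

Lemma measurable_quadrant a : measurable (quadrant a).
Proof. by apply: measurableX; exact: measurable_itv. Qed.

Lemma measurable_plane_quadrant :
  @measurable _ (plane R) = <<s [set quadrant a | a in [set: R * R]] >>.
Proof.
rewrite eqEsubset; split; last first.
  apply: smallest_sub; first exact: sigma_algebra_measurable.
  by move=> _ [a _ <-]; exact: measurable_quadrant.
set G := [set quadrant a | a in _].
have mG (a : R * R) : <<s G >> (quadrant a).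
  by apply: sub_sigma_algebra; exists a.
have bigG (F : nat -> set (plane R)) : (forall n, <<s G >> (F n)) ->
    <<s G >> (\bigcup_n F n) by apply: sigma_algebra_bigcup.
apply: smallest_sub; first exact: smallest_sigma_algebra.
rewrite subUset; split.
- move=> _ [A mA <-]; rewrite setTI.
  have : (@RGenOInfty.G R).-sigma.-measurable A by rewrite -RGenOInfty.measurableE.
  move=> mA'.
  have : preimage_set_system setT (@fst Rm Rm) ((@RGenOInfty.G R).-sigma.-measurable) (fst @^-1` A).
    by exists A => //; rewrite setTI.
  rewrite -g_sigma_preimageE; apply: smallest_sub; first exact: smallest_sigma_algebra.
  move=> _ [_ [x ->] <-]; rewrite setTI.
  have -> : fst @^-1` `]x, +oo[%classic = \bigcup_n quadrant (x, - n%:R).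
    apply/seteqP; split => [z /= zx|z [n _ []]//].
    exists (Num.truncn `|z.2|).+1 => //; split => //=.
    rewrite in_itv/= andbT ltrNl (le_lt_trans (ler_norm _))// normrN.
    exact: truncnS_gt.
  by apply: bigG.
- move=> _ [A mA <-]; rewrite setTI.
  have mA' : (@RGenOInfty.G R).-sigma.-measurable A by rewrite -RGenOInfty.measurableE.
  have : preimage_set_system setT (@snd Rm Rm) ((@RGenOInfty.G R).-sigma.-measurable) (snd @^-1` A).
    by exists A => //; rewrite setTI.
  rewrite -g_sigma_preimageE; apply: smallest_sub; first exact: smallest_sigma_algebra.
  move=> _ [_ [x ->] <-]; rewrite setTI.
  have -> : snd @^-1` `]x, +oo[%classic = \bigcup_n quadrant (- n%:R, x).
    apply/seteqP; split => [z /= zx|z [n _ []]//].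
    exists (Num.truncn `|z.1|).+1 => //; split => //=.
    rewrite in_itv/= andbT ltrNl (le_lt_trans (ler_norm _))// normrN.
    exact: truncnS_gt.
  by apply: bigG.
Qed.

Lemma eq_measure_quadrant (mu nu : probability (plane R) R) :
  (forall a, mu (quadrant a) = nu (quadrant a)) ->
  forall A, measurable A -> mu A = nu A.
Proof.
move=> munu A; apply: (measure_unique [set quadrant a | a in [set: R * R]]
  (fun n => quadrant (- n%:R, - n%:R))).
- exact: measurable_plane_quadrant.
- move=> _ _ [a _ <-] [b _ <-]; exists (Num.max a.1 b.1, Num.max a.2 b.2) => //.
  apply/seteqP; split => z; rewrite /quadrant/= !in_itv/= !andbT !gt_max.
    by move=> [/andP[-> ->] /andP[-> ->]].
  by move=> [[-> ->] [-> ->]].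
- by move=> n; exists (- n%:R, - n%:R).
- apply/seteqP; split => // z _.
  exists (Num.truncn (`|z.1| + `|z.2|)).+1 => //.
  have h := truncnS_gt (`|z.1| + `|z.2|); set n := (X in X%:R) in h *.
  have z1 : - z.1 <= `|z.1| by rewrite -normrN ler_norm.
  have z2 : - z.2 <= `|z.2| by rewrite -normrN ler_norm.
  have := normr_ge0 z.1; have := normr_ge0 z.2.
  by split => /=; rewrite in_itv/= andbT; lra.
- by move=> _ [a _ <-]; exact: munu.
- by move=> n; rewrite (le_lt_trans (probability_le1 _ _))// ?ltry//; exact: measurable_quadrant.
Qed.

Definition rat_box (c : rat * rat * nat) : set (plane R) :=
  ball ((ratr c.1.1, ratr c.1.2) : plane R) (c.2.+1%:R^-1 : R).

Lemma measurable_rat_box c : measurable (rat_box c).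
Proof.
have -> : rat_box c = (ball (ratr c.1.1 : R) (c.2.+1%:R^-1 : R) : set Rm) `*`
    (ball (ratr c.1.2 : R) (c.2.+1%:R^-1 : R) : set Rm).
  by apply/seteqP; split => z.
by apply: measurableX; exact: measurable_ball.
Qed.

Lemma open_rat_box U z : open U -> U z -> exists2 c, rat_box c z & rat_box c `<=` U.
Proof.
rewrite openE => /(_ z)/[apply]; rewrite /interior -nbhs_ballE => -[e /= e0 zU].
pose m := Num.truncn (2 / e); pose r := (m.+1%:R)^-1 : R.
have r0 : 0 < r by rewrite invr_gt0.
have re : r + r < e.
  have := truncnS_gt (2 / e); rewrite -/m ltr_pdivrMr// => h.
  by rewrite -mulr2n -mulr_natl ltr_pdivrMr// mulrC.
have near (x : R) : exists q : rat, `|ratr q - x| < r.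
  have /rat_in_itvoo[q] : x - r < x + r by rewrite ltrBlDr -addrA ltrDl addr_gt0.
  by rewrite in_itv/= => qx; exists q; rewrite ltr_distl.
have [p pz] := near z.1; have [q qz] := near z.2.
exists (p, q, m); first by split; rewrite /ball/=.
move=> w [/= w1 w2]; apply: zU; split; rewrite /ball/= (le_lt_trans _ re)//.
  rewrite (_ : z.1 - w.1 = - (ratr p - z.1) + (ratr p - w.1)); last by lra.
  by rewrite (le_trans (ler_normD _ _))// normrN lerD// ltW.
rewrite (_ : z.2 - w.2 = - (ratr q - z.2) + (ratr q - w.2)); last by lra.
by rewrite (le_trans (ler_normD _ _))// normrN lerD// ltW.
Qed.

(** The boxes with rational centres and radii, enumerated by natural numbers.
    *)
Definition box (n : nat) : set (plane R) :=
  if unpickle n is Some c then rat_box c else set0.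

Lemma measurable_box n : measurable (box n).
Proof.
rewrite /box; case: (unpickle n : option (rat * rat * nat)%type) => [c|] //.
exact: measurable_rat_box.
Qed.

Lemma open_box U z : open U -> U z -> exists2 n, box n z & box n `<=` U.
Proof.
move=> oU /(open_rat_box oU)[c cz cU].
by exists (pickle c); rewrite /box pickleK.
Qed.

Lemma open_measurable_plane U : open U -> measurable U.
Proof.
move=> oU.
have -> : U = \bigcup_(n in [set n | box n `<=` U]) box n.
  apply/seteqP; split => [z /(open_box oU)[n nz nU]|z [n nU]]; first by exists n.
  exact: nU.
by apply: bigcup_measurable => n _; exact: measurable_box.
Qed.

(** Countably many boxes of measure 0 cover the complement of the support. *)
Lemma negligible_msupportC (mu : probability (plane R) R) :
  mu.-negligible (~` msupport mu).
Proof.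
have sub : ~` msupport mu `<=` \bigcup_n (if mu (box n) == 0%E then box n else set0).
  move=> z /existsNP[U /not_implyP[oU /not_implyP[Uz /negP]]].
  rewrite -leNgt => U0; have [n nz nU] := open_box oU Uz.
  exists n => //; rewrite ifT//; apply/eqP/le_anti; rewrite measure_ge0 andbT.
  rewrite (le_trans _ U0)// le_measure ?inE//; first exact: measurable_box.
  exact: open_measurable_plane.
apply: (negligibleS sub); apply: negligible_bigcup => n; case: ifP => [/eqP n0|_]; last exact: negligible_set0.
by apply/negligibleP => //; exact: measurable_box.
Qed.

Lemma msupport_disc (mu : probability (plane R) R) : compact (msupport mu) ->
  exists2 r : R, 0 < r & forall s : R, r <= s -> mu (~` disc s) = 0%E.
Proof.
move=> /compact_bounded[M [_ /(_ (`|M| + 1))]].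
rewrite (le_lt_trans (ler_norm _)) ?ltrDl// => /(_ isT) KM.
set c := `|M| + 1 in KM; have c0 : 0 < c by rewrite ltr_wpDl.
pose r : R := 2 * c; have r0 : 0 < r by rewrite mulr_gt0.
exists r => // s rs; apply/negligibleP.
  exact: measurableC (measurable_disc _).
apply: negligibleS (negligible_msupportC mu); apply: subsetC => z /KM /=.
rewrite /disc/= => zM; rewrite (le_trans _ rs)//.
(* The norm of pairs is the sup norm. *)
have [z1 z2] : `|z.1| <= c /\ `|z.2| <= c.
  by move: zM; rewrite /Num.norm/= ge_max => /andP[].
rewrite -(@ler_pXn2r _ 2) ?nnegrE ?cabs_ge0 ?(ltW r0)// sqr_cabs -(real_normK (num_real z.1)) -(real_normK (num_real z.2)).
rewrite /r; have := normr_ge0 z.1; have := normr_ge0 z.2; clear - z1 z2 c0.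
move: `|_| `|_| z1 z2 => u v; nra.
Qed.

End plane_measures.

(** * The logarithm as a mixture of exponentials *)

Section logarithm_as_gaussian_mixture.
Context {R : realType}.
Notation leb := (@lebesgue_measure R).
Notation Rm := (measurableTypeR R).

(** The integrand of Frullani's formula for [- ln rho / 2]. It is nonnegative
    for [rho <= 1]; the positive part makes it so for all [rho]. *)
Definition log_slice (rho t : R) : R :=
  if 0 < t then Num.max 0 ((expR (- (t * rho)) - expR (- t)) / (2 * t)) else 0.

Definition log_mixture (rho : R) : \bar R := (\int[leb]_t (log_slice rho t)%:E)%E.

Lemma log_slice_ge0 rho t : 0 <= log_slice rho t.
Proof. by rewrite /log_slice; case: ifP => // _; rewrite le_max lexx. Qed.

Lemma measurable_log_slice :
  measurable_fun setT (fun x : Rm * Rm => log_slice x.1 x.2).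
Proof.
rewrite (_ : (fun x => _) = (fun x : Rm * Rm => if 0 < x.2 then
    Num.max 0 ((expR (- (x.2 * x.1)) - expR (- x.2)) * (2^-1 * expR (- ln x.2))) else 0)).
  apply: measurable_fun_ifT => //; first by apply: measurable_fun_ltr.
  have me (f : Rm * Rm -> Rm) : measurable_fun setT f ->
      measurable_fun setT (fun x => expR (- f x)).
    by move=> mf; apply: measurableT_comp => //; exact: measurableT_comp.
  apply: measurable_maxr => //; apply: measurable_funM.
    by apply: measurable_funB; apply: me => //; exact: measurable_funM.
  by apply: measurable_funM => //; apply: me; exact: measurableT_comp.
apply/funext => x; rewrite /log_slice; case: ifP => // x0.
by rewrite [expR (- ln _)]expRN lnK ?posrE// invfM.
Qed.

Lemma log_slice_nincr rho rho' t : rho <= rho' -> log_slice rho' t <= log_slice rho t.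
Proof.
move=> r; rewrite /log_slice; case: ifPn => // t0; rewrite ge_max !le_max lexx/=.
apply/orP; right; rewrite ler_pM2r ?invr_gt0 ?mulr_gt0// lerD2r ler_expR lerN2.
by rewrite ler_pM2l.
Qed.

Lemma log_mixture_ge0 rho : (0 <= log_mixture rho)%E.
Proof. by apply: integral_ge0 => t _; rewrite lee_fin log_slice_ge0. Qed.

Lemma is_derive_exp_expN (t v : R) : 0 < t ->
  is_derive v 1 (fun v : R => (2 * t)^-1 * expR (- (expR (- v) * t)))
    (2^-1 * (expR (- (expR (- v) * t)) * expR (- v))).
Proof.
move=> t0.
have d1 : is_derive v 1 (fun v : R => expR (- v)) (expR (- v) * - 1).
  by apply: is_derivef_exp; apply: is_derivefN; exact: is_derive_id.
have d2 : is_derive v 1 (fun v : R => - (t * expR (- v))) (- (t * (expR (- v) * - 1))).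
  by apply: is_derivefN; exact: is_derivefMl.
have := is_derivefMl (2 * t)^-1 (is_derivef_exp d2).
rewrite (_ : (fun x : R => _) = (fun v : R => (2 * t)^-1 * expR (- (expR (- v) * t)))); last first.
  by apply/funext => x; rewrite [t * _]mulrC.
move=> H; apply: is_derive_eq H _; rewrite [t * expR _]mulrC.
by field; rewrite gt_eqF.
Qed.

(** Frullani's integral: [exp (- t rho) - exp (- t)] over [t] is the integral
    over [v] between 0 and [L] of [exp (- t exp (- v)) exp (- v)], and the
    integral over [t] is computed first. *)
Lemma log_mixture_expRN (L : R) : 0 <= L -> log_mixture (expR (- L)) = (L / 2)%:E.
Proof.
move=> L0.
pose h (x : Rm * Rm) : R := if (0 < x.1) && (x.2 \in `[0, L]) then
  2^-1 * (expR (- (expR (- x.2) * x.1)) * expR (- x.2)) else 0.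
have h0 x : 0 <= h x.
  by rewrite /h; case: ifP => // _; rewrite !mulr_ge0 ?expR_ge0// invr_ge0.
have mh : measurable_fun setT (EFin \o h).
  apply/measurable_EFinP; apply: measurable_fun_ifT => //.
    rewrite (_ : (fun x => _) = (fun x : Rm * Rm => (0 < x.1) && ((0 <= x.2) && (x.2 <= L)))).
      apply: measurable_and; first exact: measurable_fun_ltr.
      by apply: measurable_and; exact: measurable_fun_ler.
    by apply/funext => x; rewrite in_itv.
  have me : measurable_fun setT (fun x : Rm * Rm => expR (- x.2)).
    by apply: measurableT_comp => //; exact: measurableT_comp.
  apply: measurable_funM => //; apply: measurable_funM => //.
  apply: measurableT_comp => //; apply: measurableT_comp => //.
  exact: measurable_funM.
transitivity (\int[leb]_t \int[leb]_v (EFin \o h) (t, v))%E.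
  apply/esym/eq_integral => t _; rewrite /log_slice /h /=.
  case: ifPn => t0; last by under eq_integral do rewrite /=; rewrite integral0.
  have dE v := is_derive_exp_expN v t0.
  have : (\int[leb]_(v in `[0%R, L])
     (2^-1 * (expR (- (expR (- v) * t)) * expR (- v)))%:E =
     (log_slice (expR (- L)) t)%:E)%E.
    rewrite (integral_FTC2 L0 dE) /log_slice ?t0; last first.
      move=> v; apply: cvgM; first exact: cvg_cst.
      have cN : (fun v : R => expR (- v)) @ v --> expR (- v).
        by apply: continuous_cvg; [exact: continuous_expR|apply: cvgN; exact: cvg_id].
      apply: cvgM => //; apply: continuous_cvg; first exact: continuous_expR.
      by apply: cvgN; apply: cvgM => //; exact: cvg_cst.
    congr EFin; rewrite oppr0 expR0 mul1r -mulrBr mulrC max_r 1?[t * _]mulrC//.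
    rewrite mulr_ge0 ?invr_ge0 ?mulr_ge0 ?(ltW t0)//.
    by rewrite subr_ge0 ler_expR lerN2 ger_pMl// -[leRHS]expR0 ler_expR oppr_le0.
  rewrite /log_slice t0 => <-; rewrite [RHS]integral_mkcond.
  by apply: eq_integral => v _; rewrite patchE mem_setE /=; case: ifP.
apply: (etrans (@fubini_tonelli _ _ _ _ _ leb leb (EFin \o h) mh (fun x => h0 x))).
have -> : (L / 2)%:E = (\int[leb]_(v in `[0%R, L]) (2^-1)%:E)%E.
  rewrite integral_cst//= lebesgue_measure_itv/= lte_fin.
  case: (ltgtP 0 L) L0 => // [L0 _|<-]; last by rewrite mul0r mule0.
  by rewrite -EFinM subr0 mulrC.
rewrite [RHS]integral_mkcond; apply: eq_integral => v _.
rewrite patchE mem_setE /h /=; case: ifPn => vL; last first.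
  by under eq_integral do rewrite andbF; rewrite integral0.
have c0 : 0 < expR (- v) by exact: expR_gt0.
have := @integral_exp_tail R _ 0 c0; rewrite mulr0 oppr0 expR0 mulr1 => E1.
transitivity ((2^-1 * expR (- v))%:E *
   \int[leb]_(t in `[0%R, +oo[) (expR (- (expR (- v) * t)))%:E)%E; last first.
  by rewrite E1 -EFinM -mulrA divff ?mulr1// gt_eqF.
rewrite -ge0_integralZl; last 4 first.
- exact: measurable_itv.
- apply/measurable_EFinP/measurable_funTS.
  by apply: measurableT_comp => //; apply: measurableT_comp => //; exact: measurable_funM.
- by move=> t _; rewrite lee_fin expR_ge0.
- by rewrite lee_fin mulr_ge0 ?invr_ge0 ?expR_ge0.
rewrite -integral_itv_obnd_cbnd; last first.
  apply: measurable_funTS; apply/measurable_EFinP; apply: measurable_funM => //.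
  by apply: measurableT_comp => //; apply: measurableT_comp => //; exact: measurable_funM.
rewrite [RHS]integral_mkcond; apply: eq_integral => t _.
rewrite patchE mem_setE in_itv/= !andbT; case: ifP => // _.
by rewrite -EFinM; congr EFin; ring.
Qed.

Lemma log_mixture0 : log_mixture 0 = +oo%E.
Proof.
apply/eqyP => A A0.
have A20 : 0 <= 2 * A by rewrite mulr_ge0// ltW.
have -> : A%:E = log_mixture (expR (- (2 * A))).
  by rewrite log_mixture_expRN// mulrAC divff ?mul1r.
have mls rho : measurable_fun setT (EFin \o log_slice rho).
  apply/measurable_EFinP.
  exact: measurableT_comp measurable_log_slice (pair1_measurable rho).
apply: ge0_le_integral => //.
- by move=> t _; rewrite lee_fin log_slice_ge0.
- exact: mls.
- exact: mls.
- by move=> t _; rewrite lee_fin log_slice_nincr// expR_ge0.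
Qed.

End logarithm_as_gaussian_mixture.

(** * Gaussian smoothing of measures *)

Section gaussian_smoothing.
Context {R : realType}.
Notation leb := (@lebesgue_measure R).
Notation Rm := (measurableTypeR R).
Implicit Types (z w x : plane R) (b : R).

Lemma measurable_dist :
  measurable_fun setT (fun p : plane R * plane R => cabs (p.1 - p.2)).
Proof.
apply: (measurableT_comp (@measurable_cabs R)); apply: measurable_fun_pair => /=.
  by apply: measurable_funB; apply: measurableT_comp.
by apply: measurable_funB; apply: measurableT_comp.
Qed.

Lemma cabs_subC z w : cabs (z - w) = cabs (w - z).
Proof. by rewrite /cabs/= -opprB sqrrN -(opprB w.2) sqrrN. Qed.

Lemma area_fubini d (T : measurableType d) (mu : {sigma_finite_measure set T -> \bar R})
    (f : T * plane R -> \bar R) :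
  measurable_fun setT f -> (forall p, 0 <= f p)%E ->
  (\int[mu]_t \int[@area R]_x f (t, x) = \int[@area R]_x \int[mu]_t f (t, x))%E.
Proof.
move=> mf f0.
have mft t : measurable_fun setT (fun x => f (t, x)).
  exact: measurableT_comp mf (pair1_measurable t).
have p0 : 0 <= pi^-1 :> R by rewrite invr_ge0 pi_ge0.
have mg1 : measurable_fun setT (fun x : plane R => \int[mu]_t f (t, x))%E.
  exact: (@measurable_fun_fubini_tonelli_G _ _ _ _ _ mu f mf f0).
have g10 x : (0 <= \int[mu]_t f (t, x))%E by exact: integral_ge0.
rewrite [RHS]area_integral_iterated//.
under eq_integral do rewrite area_integral_iterated//.
have mh : measurable_fun setT (fun p : (T * Rm) * Rm => f (p.1.1, (p.1.2, p.2))).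
  apply: (measurableT_comp mf); apply: measurable_fun_pair.
    exact: measurableT_comp measurable_fst measurable_fst.
  apply: measurable_fun_pair => //.
  exact: measurableT_comp measurable_snd measurable_fst.
have mk : measurable_fun setT (fun p : T * Rm => \int[leb]_y f (p.1, (p.2, y)))%E.
  exact: (@measurable_fun_fubini_tonelli_F _ _ _ _ _ leb _ mh (fun _ => f0 _)).
have k0 (p : T * Rm) : (0 <= \int[leb]_y f (p.1, (p.2, y)))%E by exact: integral_ge0.
rewrite ge0_integralZl//; last 2 first.
- exact: (@measurable_fun_fubini_tonelli_F _ _ _ _ _ leb _ mk k0).
- by move=> t _; apply: integral_ge0 => x _; exact: (k0 (t, x)).
congr (_ * _)%E.
rewrite (@fubini_tonelli _ _ _ _ _ mu leb _ mk k0).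
apply: eq_integral => x _.
have mfx : measurable_fun setT (fun p : T * Rm => f (p.1, (x, p.2))).
  by apply: (measurableT_comp mf); apply: measurable_fun_pair => //; exact: measurable_fun_pair.
exact: (@fubini_tonelli _ _ _ _ _ mu leb _ mfx (fun _ => f0 _)).
Qed.

Definition gauss b z x : R := expR (- (b * cabs (z - x) ^+ 2)).

Lemma gauss_ge0 b z x : 0 <= gauss b z x. Proof. exact: expR_ge0. Qed.

Lemma gauss_le1 b z x : 0 <= b -> gauss b z x <= 1.
Proof.
by move=> b0; rewrite -[leRHS]expR0 ler_expR oppr_le0 mulr_ge0// sqr_ge0.
Qed.

Lemma measurable_gauss b : measurable_fun setT (fun p : plane R * plane R => gauss b p.1 p.2).
Proof.
apply: measurableT_comp => //; apply: measurableT_comp => //.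
apply: measurable_funM => //; apply: measurable_funX; exact: measurable_dist.
Qed.

Lemma integral_gauss1 b (m : R) : 0 < b ->
  (\int[leb]_(u in setT) (expR (- (b * (m - u) ^+ 2)))%:E = (Num.sqrt (pi / b))%:E)%E.
Proof.
move=> b0; have s0 : 0 < Num.sqrt b by rewrite sqrtr_gt0.
have mg : measurable_fun setT (fun u : Rm => (expR (- u ^+ 2))%:E).
  apply/measurable_EFinP; apply: measurableT_comp => //.
  by apply: measurableT_comp => //; exact: measurable_funX.
have mf : measurable_fun setT (fun u : Rm => (expR (- (Num.sqrt b * u) ^+ 2))%:E).
  apply: (measurableT_comp mg); exact: measurable_funM.
transitivity (\int[leb]_u (expR (- (Num.sqrt b * (u + - m)) ^+ 2))%:E)%E.
  apply: eq_integral => u _; congr (expR (- _))%:E.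
  by rewrite exprMn sqr_sqrtr ?ltW// -(sqrrN (m - u)) opprB.
rewrite (@integral_shift _ (fun u : R => (expR (- (Num.sqrt b * u) ^+ 2))%:E))//.
rewrite (@integral_scale _ (fun u : R => (expR (- u ^+ 2))%:E) _ s0 mg); last first.
  by move=> u; rewrite lee_fin expR_ge0.
rewrite (_ : \int[leb]_u _ = (Num.sqrt pi)%:E)%E; last exact: integralT_gauss.
by rewrite -EFinM mulrC sqrtrM ?pi_ge0// sqrtrV ?ltW.
Qed.

Lemma integral_gauss b z : 0 < b -> (\int[@area R]_x (gauss b z x)%:E = (b^-1)%:E)%E.
Proof.
move=> b0.
have mg : measurable_fun setT (fun x => (gauss b z x)%:E).
  apply/measurable_EFinP.
  exact: (measurableT_comp (measurable_gauss b) (pair1_measurable z)).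
rewrite area_integral_iterated//; last by move=> x; rewrite lee_fin gauss_ge0.
have E (u v : R) : gauss b z (u, v) =
    expR (- (b * (z.1 - u) ^+ 2)) * expR (- (b * (z.2 - v) ^+ 2)).
  by rewrite /gauss sqr_cabs -expRD; congr expR => /=; ring.
have m1 (m : R) : measurable_fun setT (fun u : Rm => (expR (- (b * (m - u) ^+ 2)))%:E).
  apply/measurable_EFinP; apply: measurableT_comp => //; apply: measurableT_comp => //.
  by apply: measurable_funM => //; apply: measurable_funX; exact: measurable_funB.
have s2 : Num.sqrt (pi / b) * Num.sqrt (pi / b) = pi / b.
  by rewrite -expr2 sqr_sqrtr// divr_ge0 ?pi_ge0 ?ltW.
transitivity ((pi^-1)%:E * \int[leb]_u ((expR (- (b * (z.1 - u) ^+ 2)))%:E *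
    (Num.sqrt (pi / b))%:E))%E.
  congr (_ * _)%E; apply: eq_integral => u _.
  under eq_integral do rewrite E EFinM.
  rewrite ge0_integralZl//.
  by rewrite integral_gauss1.
rewrite ge0_integralZr//.
rewrite integral_gauss1// -!EFinM s2 mulrA mulVf ?mul1r//.
by rewrite gt_eqF// pi_gt0.
Qed.

(** The parallelogram identity in the exponent. *)
Lemma gauss_autocorrelation b z w : 0 < b ->
  (\int[@area R]_x (gauss (2 * b) z x * gauss (2 * b) w x)%:E =
   ((4 * b)^-1 * gauss b z w)%:E)%E.
Proof.
move=> b0; pose m : plane R := ((z.1 + w.1) / 2, (z.2 + w.2) / 2).
have E x : gauss (2 * b) z x * gauss (2 * b) w x = gauss b z w * gauss (4 * b) m x.
  by rewrite /gauss -!expRD; congr expR; rewrite !sqr_cabs /=; field.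
under eq_integral do rewrite E EFinM.
rewrite ge0_integralZl//; last 3 first.
- apply/measurable_EFinP.
  exact: (measurableT_comp (measurable_gauss _) (pair1_measurable m)).
- by move=> x _; rewrite lee_fin gauss_ge0.
- by rewrite lee_fin gauss_ge0.
by rewrite integral_gauss ?mulr_gt0// -EFinM mulrC.
Qed.

Definition smooth (mu : probability (plane R) R) b x : R :=
  fine (\int[mu]_z (gauss b z x)%:E)%E.

Lemma integral_gauss_le1 (mu : probability (plane R) R) b x : 0 <= b ->
  (\int[mu]_z (gauss b z x)%:E <= 1)%E.
Proof.
move=> b0; have <- : (\int[mu]_z (cst 1 z) = 1)%E by rewrite integral_cst//= mul1e probability_setT.
apply: ge0_le_integral => //.
- by move=> z _; rewrite lee_fin gauss_ge0.
- apply/measurable_EFinP.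
  exact: (measurableT_comp (measurable_gauss _) (pair2_measurable x)).
- by move=> z _; rewrite lee_fin gauss_le1.
Qed.

Lemma smoothE (mu : probability (plane R) R) b x : 0 <= b ->
  (\int[mu]_z (gauss b z x)%:E = (smooth mu b x)%:E)%E.
Proof.
move=> b0; rewrite /smooth fineK// ge0_fin_numE.
  by rewrite (le_lt_trans (integral_gauss_le1 _ _ b0))// ltry.
by apply: integral_ge0 => z _; rewrite lee_fin gauss_ge0.
Qed.

Lemma smooth_ge0 mu b x : 0 <= smooth mu b x.
Proof. by apply: fine_ge0; apply: integral_ge0 => z _; rewrite lee_fin gauss_ge0. Qed.

Lemma measurable_smooth mu b : measurable_fun setT (smooth mu b).
Proof.
apply: measurableT_comp => //.
apply: (@measurable_fun_fubini_tonelli_G _ _ _ _ _ mu (fun p => (gauss b p.1 p.2)%:E)) => //.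
  by apply/measurable_EFinP; exact: measurable_gauss.
by move=> p; rewrite lee_fin gauss_ge0.
Qed.

(** A Gaussian being an autocorrelation, the energy of two measures for a
    Gaussian kernel is the scalar product of their smoothings. *)
Lemma gauss_energy (mu nu : probability (plane R) R) b : 0 < b ->
  (\int[mu]_z \int[nu]_w (gauss b z w)%:E =
   (4 * b)%:E * \int[@area R]_x (smooth mu (2 * b) x * smooth nu (2 * b) x)%:E)%E.
Proof.
move=> b0; have c0 : 0 < 4 * b by rewrite mulr_gt0.
have b20 : 0 <= 2 * b by rewrite mulr_ge0// ltW.
pose g := gauss (2 * b).
have mg : measurable_fun setT (fun p : plane R * plane R => g p.1 p.2) := measurable_gauss _.
have mgz z : measurable_fun setT (g z).
  exact: measurableT_comp mg (pair1_measurable z).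
have mgx x : measurable_fun setT (fun z => g z x).
  exact: measurableT_comp mg (pair2_measurable x).
have g0 z x : 0 <= g z x by exact: gauss_ge0.
have inner z : (\int[nu]_w (gauss b z w)%:E =
    (4 * b)%:E * \int[@area R]_x (g z x * smooth nu (2 * b) x)%:E)%E.
  transitivity (\int[nu]_w ((4 * b)%:E * \int[@area R]_x (g z x * g w x)%:E))%E.
    apply: eq_integral => w _; rewrite gauss_autocorrelation// -EFinM mulrA divff ?mul1r//.
    by rewrite gt_eqF.
  have mgg : measurable_fun setT (fun p : plane R * plane R => (g z p.2 * g p.1 p.2)%:E).
    by apply/measurable_EFinP; apply: measurable_funM => //; exact: measurableT_comp.
  rewrite ge0_integralZl//; last 3 first.
  - apply: (@measurable_integral_area _ _ _ (fun p => (g z p.2 * g p.1 p.2)%:E)) => // p.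
    by rewrite lee_fin mulr_ge0.
  - by move=> w _; apply: integral_ge0 => x _; rewrite lee_fin mulr_ge0.
  - by rewrite lee_fin ltW.
  congr (_ * _)%E.
  rewrite (@area_fubini _ _ nu (fun p => (g z p.2 * g p.1 p.2)%:E))//; last first.
    by move=> p; rewrite lee_fin mulr_ge0.
  apply: eq_integral => x _ /=; under eq_integral do rewrite EFinM.
  rewrite ge0_integralZl//; last 3 first.
  - exact/measurable_EFinP.
  - by move=> w _; rewrite lee_fin.
  - by rewrite lee_fin.
  by rewrite smoothE.
under eq_integral do rewrite inner.
have mgs : measurable_fun setT (fun p : plane R * plane R => (g p.1 p.2 * smooth nu (2 * b) p.2)%:E).
  apply/measurable_EFinP; apply: measurable_funM => //.
  exact: measurableT_comp (measurable_smooth _ _) measurable_snd.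
have gs0 (p : plane R * plane R) : (0 <= (g p.1 p.2 * smooth nu (2 * b) p.2)%:E)%E.
  by rewrite lee_fin mulr_ge0// smooth_ge0.
rewrite ge0_integralZl//; last 3 first.
- exact: (@measurable_integral_area _ _ _ (fun p => (g p.1 p.2 * smooth nu (2 * b) p.2)%:E)).
- by move=> z _; apply: integral_ge0 => x _; exact: (gs0 (z, x)).
- by rewrite lee_fin ltW.
congr (_ * _)%E.
rewrite (@area_fubini _ _ mu (fun p => (g p.1 p.2 * smooth nu (2 * b) p.2)%:E))//.
apply: eq_integral => x _ /=; under eq_integral do rewrite EFinM.
rewrite ge0_integralZr//; last 3 first.
- exact/measurable_EFinP.
- by move=> w _; rewrite lee_fin.
- by rewrite lee_fin smooth_ge0.
by rewrite smoothE.
Qed.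

End gaussian_smoothing.

Lemma integral_parallelogram d (T : measurableType d) (R : realType)
    (m : {measure set T -> \bar R}) (f g h k : T -> \bar R) :
  measurable_fun setT f -> measurable_fun setT g -> measurable_fun setT h ->
  measurable_fun setT k -> (forall t, 0 <= f t)%E -> (forall t, 0 <= g t)%E ->
  (forall t, 0 <= h t)%E -> (forall t, 0 <= k t)%E ->
  (forall t, f t + g t = (h t + h t) + k t)%E ->
  (\int[m]_t f t + \int[m]_t g t =
   (\int[m]_t h t + \int[m]_t h t) + \int[m]_t k t)%E.
Proof.
move=> mf mg mh mk f0 g0 h0 k0 E.
rewrite -ge0_integralD// -ge0_integralD// -ge0_integralD//.
- by apply: eq_integral => t _; exact: E.
- by move=> t _; rewrite adde_ge0.
- exact: emeasurable_funD.
Qed.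

(** * The logarithmic energy as a Hilbert norm *)

Section energy_distance.
Context {R : realType}.
Notation leb := (@lebesgue_measure R).
Notation Rm := (measurableTypeR R).
Implicit Types (mu nu : probability (plane R) R) (z w : plane R).
Variable M : R.
Hypothesis M0 : 0 < M.

Definition sqr_ratio z w : R := (cabs (z - w) / M) ^+ 2.

Lemma measurable_sqr_ratio :
  measurable_fun setT (fun p : plane R * plane R => sqr_ratio p.1 p.2).
Proof.
apply: measurable_funX; apply: measurable_funM => //; exact: measurable_dist.
Qed.

(** [ln (M / |z - w|)] if [|z - w| <= M], and 0 beyond. Unlike the logarithmic
    kernel it is nonnegative, and for measures on the disc of radius [M / 2]
    it differs from it by a constant. *)
Definition log_kernel z w : \bar R := log_mixture (sqr_ratio z w).

Definition cross_energy mu nu : \bar R :=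
  (\int[mu]_z \int[nu]_w log_kernel z w)%E.

Definition energy_slice mu nu (t : R) : \bar R :=
  (\int[mu]_z \int[nu]_w (log_slice (sqr_ratio z w) t)%:E)%E.

Lemma measurable_slice_kernel : measurable_fun setT
  (fun p : (Rm * plane R) * plane R => (log_slice (sqr_ratio p.1.2 p.2) p.1.1)%:E).
Proof.
apply/measurable_EFinP; apply: (measurableT_comp (@measurable_log_slice R)
  (_ : measurable_fun _ (fun p : (Rm * plane R) * plane R => (sqr_ratio p.1.2 p.2, p.1.1)))).
apply: measurable_fun_pair; last exact: measurableT_comp measurable_fst measurable_fst.
apply: (measurableT_comp measurable_sqr_ratio
  (_ : measurable_fun _ (fun p : (Rm * plane R) * plane R => (p.1.2, p.2)))).
by apply: measurable_fun_pair => //; exact: measurableT_comp measurable_snd measurable_fst.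
Qed.

Let slice0 z w t : (0 <= (log_slice (sqr_ratio z w) t)%:E)%E.
Proof. by rewrite lee_fin log_slice_ge0. Qed.

Lemma measurable_energy_slice_inner nu : measurable_fun setT
  (fun p : Rm * plane R => \int[nu]_w (log_slice (sqr_ratio p.2 w) p.1)%:E)%E.
Proof.
exact: (@measurable_fun_fubini_tonelli_F _ _ _ _ _ nu _ measurable_slice_kernel
  (fun _ => slice0 _ _ _)).
Qed.

Lemma energy_slice_ge0 mu nu t : (0 <= energy_slice mu nu t)%E.
Proof. by apply: integral_ge0 => z _; exact: integral_ge0. Qed.

Lemma measurable_energy_slice mu nu : measurable_fun setT (energy_slice mu nu : Rm -> _).
Proof.
apply: (@measurable_fun_fubini_tonelli_F _ _ _ _ _ mu _ (measurable_energy_slice_inner nu)).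
by move=> p; exact: integral_ge0.
Qed.

Lemma cross_energy_slices mu nu :
  (cross_energy mu nu = \int[leb]_t energy_slice mu nu t)%E.
Proof.
rewrite /energy_slice.
rewrite (@fubini_tonelli _ _ _ _ _ leb mu _ (measurable_energy_slice_inner nu)); last first.
  by move=> p; exact: integral_ge0.
apply: eq_integral => z _ /=.
pose f (p : Rm * plane R) := (log_slice (sqr_ratio z p.2) p.1)%:E.
have mf : measurable_fun setT f.
  have mp : measurable_fun setT (fun p : Rm * plane R => ((p.1, z), p.2)).
    by apply: measurable_fun_pair => //; exact: measurable_fun_pair.
  exact: (measurableT_comp measurable_slice_kernel mp).
by rewrite (@fubini_tonelli _ _ _ _ _ leb nu f mf (fun _ => slice0 _ _ _)).
Qed.

Lemma log_slice_gauss z w t : 0 < t -> cabs (z - w) <= M ->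
  log_slice (sqr_ratio z w) t + (2 * t)^-1 * expR (- t) =
  (2 * t)^-1 * gauss (t / M ^+ 2) z w.
Proof.
move=> t0 zw.
have -> : gauss (t / M ^+ 2) z w = expR (- (t * sqr_ratio z w)).
  by rewrite /gauss /sqr_ratio; congr expR; field; rewrite gt_eqF.
rewrite /log_slice t0 max_r; first by rewrite mulrBl; ring.
rewrite mulr_ge0 ?invr_ge0 ?mulr_ge0 ?(ltW t0)// subr_ge0 ler_expR lerN2.
rewrite ger_pMr// exprn_ile1 ?divr_ge0 ?cabs_ge0 ?(ltW M0)//.
by rewrite ler_pdivrMr// mul1r.
Qed.

Lemma cabsD z w : cabs (z - w) <= cabs z + cabs w.
Proof.
rewrite -(@ler_pXn2r _ 2) ?nnegrE ?addr_ge0 ?cabs_ge0// sqrrD !sqr_cabs/=.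
have h : - (z.1 * w.1 + z.2 * w.2) <= cabs z * cabs w.
  have zw0 : 0 <= cabs z * cabs w by rewrite mulr_ge0 ?cabs_ge0.
  rewrite (le_trans (ler_norm _))// -(@ler_pXn2r _ 2) ?nnegrE//.
  rewrite real_normK ?num_real// exprMn !sqr_cabs.
  by have := sqr_ge0 (z.1 * w.2 - z.2 * w.1); nra.
by move: h; lra.
Qed.

Definition concentrated mu := mu (~` disc (M / 2)) = 0%E.

Lemma eq_integral_concentrated mu (f g : plane R -> \bar R) : concentrated mu ->
  measurable_fun setT f -> measurable_fun setT g ->
  (forall z, disc (M / 2) z -> f z = g z) ->
  (\int[mu]_z f z = \int[mu]_z g z)%E.
Proof.
move=> cmu mf mg fg; apply: ae_eq_integral => //.
exists (~` disc (M / 2)); split => //; first exact: measurableC (measurable_disc _).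
by move=> z /=; apply: contra_not => dz _; exact: fg.
Qed.

Lemma energy_slice_gauss mu nu t : concentrated mu -> concentrated nu -> 0 < t ->
  (energy_slice mu nu t + ((2 * t)^-1 * expR (- t))%:E =
   ((2 * t)^-1)%:E * \int[mu]_z \int[nu]_w (gauss (t / M ^+ 2) z w)%:E)%E.
Proof.
move=> cmu cnu t0; set c := (2 * t)^-1 * _.
have k0 : 0 <= (2 * t)^-1 by rewrite invr_ge0 mulr_ge0// ltW.
have c0 : 0 <= c by rewrite mulr_ge0 ?expR_ge0.
have mu1 (m : probability (plane R) R) : (\int[m]_z c%:E = c%:E)%E.
  by rewrite integral_cst//= probability_setT mule1.
have b0 : 0 <= t / M ^+ 2 by rewrite divr_ge0 ?ltW// exprn_gt0.
have mg : measurable_fun setT (fun p : plane R * plane R => (gauss (t / M ^+ 2) p.1 p.2)%:E).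
  by apply/measurable_EFinP; exact: measurable_gauss.
have g0 (p : plane R * plane R) : (0 <= (gauss (t / M ^+ 2) p.1 p.2)%:E)%E.
  by rewrite lee_fin gauss_ge0.
have msl z : measurable_fun setT (fun w : plane R => (log_slice (sqr_ratio z w) t)%:E).
  exact: measurableT_comp measurable_slice_kernel (pair1_measurable (t : Rm, z)).
have mi : measurable_fun setT (fun z => \int[nu]_w (log_slice (sqr_ratio z w) t)%:E)%E.
  exact: measurableT_comp (measurable_energy_slice_inner nu) (pair1_measurable (t : Rm)).
have mgi : measurable_fun setT (fun z => \int[nu]_w (gauss (t / M ^+ 2) z w)%:E)%E.
  exact: (@measurable_fun_fubini_tonelli_F _ _ _ _ _ nu _ mg g0).
have i0 z : (0 <= \int[nu]_w (log_slice (sqr_ratio z w) t)%:E)%E by exact: integral_ge0.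
rewrite -ge0_integralZl//; last first.
  by move=> z _; apply: integral_ge0 => w _; exact: (g0 (z, w)).
rewrite -{1}(mu1 mu) -ge0_integralD//.
apply: eq_integral_concentrated; first exact: cmu.
- by apply: emeasurable_funD.
- by apply: measurable_funeM.
move=> z dz; rewrite -{1}(mu1 nu) -ge0_integralD// -ge0_integralZl//; last 2 first.
- exact: measurableT_comp mg (pair1_measurable z).
- by move=> w _; exact: (g0 (z, w)).
apply: eq_integral_concentrated; first exact: cnu.
- by apply: emeasurable_funD.
- by apply: measurable_funeM; exact: measurableT_comp mg (pair1_measurable z).
move=> w dw; rewrite -EFinD -EFinM log_slice_gauss//.
rewrite (le_trans (cabsD _ _))//; move: dz dw; rewrite /disc/=; lra.
Qed.

(** The integrand over the scale [t] of the distance between two measures for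
    the logarithmic energy. *)
Definition dispersion mu nu (t : R) : \bar R := if 0 < t then
  ((2 / M ^+ 2)%:E * \int[@area R]_x
    ((smooth mu (2 * (t / M ^+ 2)) x - smooth nu (2 * (t / M ^+ 2)) x) ^+ 2)%:E)%E else 0%E.

Lemma measurable_smooth2 mu : measurable_fun setT
  (fun p : Rm * plane R => smooth mu (2 * (p.1 / M ^+ 2)) p.2).
Proof.
apply: measurableT_comp => //.
pose f (q : (Rm * plane R) * plane R) : \bar R := (gauss (2 * (q.1.1 / M ^+ 2)) q.2 q.1.2)%:E.
apply: (@measurable_fun_fubini_tonelli_F _ _ _ _ _ mu f); last first.
  by move=> q; rewrite lee_fin gauss_ge0.
apply/measurable_EFinP; apply: measurableT_comp => //; apply: measurableT_comp => //.
apply: measurable_funM.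
  apply: measurable_funM => //; apply: measurable_funM => //.
  exact: measurableT_comp measurable_fst measurable_fst.
apply: measurable_funX.
have mq : measurable_fun setT (fun q : (Rm * plane R) * plane R => (q.2, q.1.2)).
  by apply: measurable_fun_pair => //; exact: measurableT_comp measurable_snd measurable_fst.
exact: (measurableT_comp (@measurable_dist R) mq).
Qed.

Lemma measurable_dispersion mu nu : measurable_fun setT (dispersion mu nu : Rm -> _).
Proof.
apply: measurable_fun_ifT => //; first exact: measurable_fun_ltr.
apply: measurable_funeM.
pose f (q : Rm * plane R) : \bar R := ((smooth mu (2 * (q.1 / M ^+ 2)) q.2 -
  smooth nu (2 * (q.1 / M ^+ 2)) q.2) ^+ 2)%:E.
apply: (@measurable_integral_area _ _ _ f); last by move=> q; rewrite lee_fin sqr_ge0.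
apply/measurable_EFinP; apply: measurable_funX; apply: measurable_funB;
  exact: measurable_smooth2.
Qed.

Lemma dispersion_ge0 mu nu t : (0 <= dispersion mu nu t)%E.
Proof.
rewrite /dispersion; case: ifP => // _; rewrite mule_ge0//.
  by rewrite lee_fin divr_ge0 ?exprn_ge0 ?ltW.
by apply: integral_ge0 => x _; rewrite lee_fin sqr_ge0.
Qed.

Lemma energy_slice_dispersion mu nu t : concentrated mu -> concentrated nu ->
  (energy_slice mu mu t + energy_slice nu nu t =
   (energy_slice mu nu t + energy_slice mu nu t) + dispersion mu nu t)%E.
Proof.
move=> cmu cnu; have [t0|t0] := ltP 0 t; last first.
  have h m m' : energy_slice m m' t = 0%E.
    rewrite /energy_slice; under eq_integral do under eq_integral do
      rewrite /log_slice ltNge t0/=.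
    by under eq_integral do rewrite integral0; rewrite integral0.
  by rewrite !h /dispersion ltNge t0/= !adde0.
have b0 : 0 < t / M ^+ 2 by rewrite divr_gt0// exprn_gt0.
set b := t / M ^+ 2 in b0 *; set c := (2 * t)^-1 * expR (- t).
pose a := smooth mu (2 * b); pose s := smooth nu (2 * b).
pose k := (2 * t)^-1 * (4 * b); have k0 : 0 <= k.
  by rewrite ltW// !mulr_gt0 ?invr_gt0 ?mulr_gt0.
have G m m' : concentrated m -> concentrated m' -> (energy_slice m m' t + c%:E =
   \int[@area R]_x (k * (smooth m (2 * b) x * smooth m' (2 * b) x))%:E)%E.
  move=> cm cm'; rewrite energy_slice_gauss// gauss_energy// muleA -EFinM -/k.
  under [RHS]eq_integral do rewrite EFinM.
  rewrite ge0_integralZl//.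
    by apply/measurable_EFinP; apply: measurable_funM; exact: measurable_smooth.
  by move=> x _; rewrite lee_fin mulr_ge0 ?smooth_ge0.
have mm m m' : measurable_fun setT
    (fun x => (k * (smooth m (2 * b) x * smooth m' (2 * b) x))%:E).
  apply/measurable_EFinP; apply: measurable_funM => //.
  by apply: measurable_funM; exact: measurable_smooth.
have m0 m m' x : (0 <= (k * (smooth m (2 * b) x * smooth m' (2 * b) x))%:E)%E.
  by rewrite lee_fin (mulr_ge0 k0)// mulr_ge0 ?smooth_ge0.
have md : measurable_fun setT (fun x => (k * (a x - s x) ^+ 2)%:E).
  apply/measurable_EFinP; apply: measurable_funM => //; apply: measurable_funX.
  by apply: measurable_funB; exact: measurable_smooth.
have d0 x : (0 <= (k * (a x - s x) ^+ 2)%:E)%E by rewrite lee_fin mulr_ge0 ?sqr_ge0.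
have D : (dispersion mu nu t = \int[@area R]_x (k * (a x - s x) ^+ 2)%:E)%E.
  rewrite /dispersion t0 -/b -/a -/s; under [RHS]eq_integral do rewrite EFinM.
  rewrite ge0_integralZl//; last 2 first.
  - apply/measurable_EFinP; apply: measurable_funX.
    by apply: measurable_funB; exact: measurable_smooth.
  - by move=> x _; rewrite lee_fin sqr_ge0.
  congr (_%:E * _)%E; rewrite /k /b; field; rewrite !gt_eqF//.
have : ((energy_slice mu mu t + c%:E) + (energy_slice nu nu t + c%:E) =
  ((energy_slice mu nu t + c%:E) + (energy_slice mu nu t + c%:E)) + dispersion mu nu t)%E.
  rewrite !G// D -!ge0_integralD//; last 2 first.
  - by move=> x _; rewrite adde_ge0.
  - exact: emeasurable_funD.
  apply: eq_integral => x _; rewrite -!EFinD; congr EFin; rewrite -/a -/s.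
  by rewrite /a /s; ring.
rewrite addeACA [X in _ = (X + _)%E -> _]addeACA [X in _ = X -> _]addeAC.
by move=> /(congr1 (fun e => e - (c%:E + c%:E))%E); rewrite !addeK.
Qed.

(** Slice by slice this is the identity [a ^ 2 + s ^ 2 = 2 a s + (a - s) ^ 2]
    for the Gaussian smoothings. No integral is subtracted, so that infinite
    energies are covered. *)
Lemma cross_energy_dispersion mu nu : concentrated mu -> concentrated nu ->
  (cross_energy mu mu + cross_energy nu nu =
   (cross_energy mu nu + cross_energy mu nu) + \int[leb]_t dispersion mu nu t)%E.
Proof.
move=> cmu cnu; rewrite !cross_energy_slices.
apply: (@integral_parallelogram _ Rm).
- exact: measurable_energy_slice.
- exact: measurable_energy_slice.
- exact: measurable_energy_slice.
- exact: measurable_dispersion.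
- exact: energy_slice_ge0.
- exact: energy_slice_ge0.
- exact: energy_slice_ge0.
- exact: dispersion_ge0.
- by move=> t; exact: energy_slice_dispersion.
Qed.

End energy_distance.

(** * Measures with the same smoothings are equal *)

Section uniqueness.
Context {R : realType}.
Notation leb := (@lebesgue_measure R).
Notation Rm := (measurableTypeR R).
Implicit Types (mu nu : probability (plane R) R) (z w x : plane R) (c : R) (U V : set (plane R)).

Definition gauss_mass c U z : \bar R :=
  (c%:E * \int[@area R]_(x in U) (gauss c z x)%:E)%E.

Lemma measurable_gauss_r c z : measurable_fun setT (fun x => (gauss c z x)%:E).
Proof.
apply/measurable_EFinP.
exact: (measurableT_comp (measurable_gauss c) (pair1_measurable z)).
Qed.

Lemma gauss_mass_ge0 c U z : 0 <= c -> (0 <= gauss_mass c U z)%E.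
Proof.
move=> c0; rewrite mule_ge0//; apply: integral_ge0 => x _.
by rewrite lee_fin gauss_ge0.
Qed.

Lemma gauss_massT c z : 0 < c -> gauss_mass c setT z = 1%E.
Proof.
by move=> c0; rewrite /gauss_mass integral_gauss// -EFinM divff// gt_eqF.
Qed.

Lemma gauss_massC c U z : 0 < c -> measurable U ->
  (gauss_mass c U z + gauss_mass c (~` U) z = 1)%E.
Proof.
move=> c0 mU; rewrite -(gauss_massT z c0) /gauss_mass -ge0_muleDr; last 2 first.
- by apply: integral_ge0 => x _; rewrite lee_fin gauss_ge0.
- by apply: integral_ge0 => x _; rewrite lee_fin gauss_ge0.
rewrite -(setUv U) ge0_integral_setU//.
- exact: measurableC.
- by apply: measurable_funTS; exact: measurable_gauss_r.
- by move=> x _; rewrite lee_fin gauss_ge0.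
- by rewrite disj_set2E setICr.
Qed.

Lemma gauss_mass_far c (r : R) V z : 0 < c -> 0 <= r -> measurable V ->
  (forall x, V x -> r <= cabs (z - x)) ->
  (gauss_mass c V z <= (2 * expR (- (c / 2 * r ^+ 2)))%:E)%E.
Proof.
move=> c0 r0 mV Vr.
have -> : ((2 * expR (- (c / 2 * r ^+ 2)))%:E = c%:E * ((expR (- (c / 2 * r ^+ 2)))%:E *
   \int[@area R]_x (gauss (c / 2) z x)%:E))%E.
  by rewrite integral_gauss ?divr_gt0// -!EFinM; congr EFin; field; rewrite gt_eqF.
rewrite /gauss_mass lee_pmul2l// -ge0_integralZl; last 4 first.
- exact: measurableT.
- exact: measurable_gauss_r.
- by move=> x _; rewrite lee_fin gauss_ge0.
- by rewrite lee_fin expR_ge0.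
rewrite [X in (X <= _)%E]integral_mkcond; apply: ge0_le_integral => //.
- by move=> x _; rewrite patchE; case: ifP => // _; rewrite lee_fin gauss_ge0.
- apply: (measurable_restrictT _ _).1 => //.
  by apply: measurable_funTS; exact: measurable_gauss_r.
- by apply: measurable_funeM; exact: measurable_gauss_r.
move=> x _; rewrite patchE; case: ifPn => [|_]; last first.
  by rewrite -EFinM lee_fin mulr_ge0 ?expR_ge0 ?gauss_ge0.
rewrite inE => /Vr rx; rewrite -EFinM lee_fin /gauss -expRD ler_expR.
have : r ^+ 2 <= cabs (z - x) ^+ 2 by rewrite ler_pXn2r// nnegrE ?cabs_ge0.
move: (cabs _ ^+ 2) (r ^+ 2) => u v vu; clear - c0 vu; nra.
Qed.

Let restricted_gauss c U (p : plane R * plane R) : \bar R :=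
  (gauss c p.1 p.2 * \1_U p.2)%:E.

Let measurable_restricted_gauss c U : measurable U ->
  measurable_fun setT (restricted_gauss c U).
Proof.
move=> mU; apply/measurable_EFinP; apply: measurable_funM; first exact: measurable_gauss.
exact: measurableT_comp (measurable_indic mU) measurable_snd.
Qed.

Let restricted_gauss_ge0 c U p : (0 <= restricted_gauss c U p)%E.
Proof. by rewrite lee_fin mulr_ge0 ?gauss_ge0. Qed.

Let gauss_massE c U z :
  gauss_mass c U z = (c%:E * \int[@area R]_x restricted_gauss c U (z, x))%E.
Proof.
rewrite /gauss_mass integral_mkcond; congr (_ * _)%E; apply: eq_integral => x _.
by rewrite patchE /restricted_gauss indicE /=; case: (_ \in _); rewrite ?mulr1 ?mulr0.
Qed.

Lemma integral_gauss_mass mu c U : 0 < c -> measurable U ->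
  (\int[mu]_z gauss_mass c U z = c%:E * \int[@area R]_(x in U) (smooth mu c x)%:E)%E.
Proof.
move=> c0 mU; have mf := measurable_restricted_gauss c mU.
under eq_integral do rewrite gauss_massE.
rewrite ge0_integralZl//; last 3 first.
- exact: (@measurable_integral_area _ _ _ _ mf (restricted_gauss_ge0 c U)).
- by move=> z _; apply: integral_ge0 => x _; exact: restricted_gauss_ge0.
- by rewrite lee_fin ltW.
congr (_ * _)%E; rewrite (@area_fubini _ _ _ mu _ mf (restricted_gauss_ge0 c U)).
rewrite [RHS]integral_mkcond.
apply: eq_integral => x _; rewrite patchE /restricted_gauss /= indicE; case: (_ \in _).
  by under eq_integral do rewrite mulr1; rewrite smoothE// ltW.
by under eq_integral do rewrite mulr0; rewrite integral0.
Qed.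

Lemma measurable_gauss_mass c U : measurable U -> measurable_fun setT (gauss_mass c U).
Proof.
move=> mU; rewrite (_ : gauss_mass c U =
  (fun z => c%:E * \int[@area R]_x restricted_gauss c U (z, x))%E).
  apply: measurable_funeM.
  exact: (@measurable_integral_area _ _ _ _ (measurable_restricted_gauss c mU)
    (restricted_gauss_ge0 c U)).
by apply/funext => z; rewrite gauss_massE.
Qed.

(** The quadrant is shrunk by [1 / n.+1], a distance beyond which a Gaussian
    with parameter [c n >= 2 n.+1 ^ 3] has negligible mass; so the limit is 0
    also on the boundary of the open quadrant. *)
Lemma gauss_mass_quadrant_cvg (a : R * R) (c : nat -> R) :
  (forall n, 2 * n.+1%:R ^+ 3 <= c n) ->
  forall z, gauss_mass (c n) (quadrant (a.1 + n.+1%:R^-1, a.2 + n.+1%:R^-1)) z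
    @[n --> \oo] --> (\1_(quadrant a) z)%:E.
Proof.
move=> cn z; pose e n : R := 2 * n.+1%:R^-1.
pose U n := quadrant (a.1 + n.+1%:R^-1 : R, a.2 + n.+1%:R^-1).
have n0 n : 0 < n.+1%:R :> R by rewrite ltr0n.
have c0 n : 0 < c n.
  by apply: lt_le_trans (cn n); rewrite mulr_gt0// exprn_gt0.
have ecvg : (e n @[n --> \oo] --> (0 : R)).
  by rewrite -(mulr0 2); apply: cvgM; [exact: cvg_cst|exact: cvg_harmonic].
have far n V : measurable V -> (forall x, V x -> n.+1%:R^-1 <= cabs (z - x)) ->
    (gauss_mass (c n) V z <= (e n)%:E)%E.
  move=> mV Vz; apply: le_trans (gauss_mass_far (c0 n) _ mV Vz) _.
    by rewrite invr_ge0 ltW.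
  rewrite lee_fin /e ler_pM2l// expRN lef_pV2 ?posrE ?expR_gt0//.
  apply: le_trans (expR_ge1Dx _); rewrite -[leLHS]add0r lerD//.
  rewrite exprVn ler_pdivlMr ?exprn_gt0//.
  by rewrite -exprS ler_pdivlMr// mulrC; exact: cn.
have coord x : `|z.1 - x.1| <= cabs (z - x) /\ `|z.2 - x.2| <= cabs (z - x).
  by split; [exact: (@normr_fst_le_cabs R (z - x))|exact: (@normr_snd_le_cabs R (z - x))].
have lt_of_shift (u v y k : R) : u + k < y -> y - v < k -> u < v by lra.
rewrite indicE; case: (boolP (z \in quadrant a)) => [|]; last first.
  rewrite notin_setE => za.
  have cE : (fun n => (e n)%:E) @ \oo --> (0%:E : \bar R) by apply/cvg_EFin; [exact: nearW|exact: ecvg].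
  apply: (squeeze_cvge _ (cvg_cst 0%:E) cE); apply: nearW => n.
  rewrite gauss_mass_ge0 ?(ltW (c0 n))//=; apply: far; first exact: measurable_quadrant.
  move=> x [/=]; rewrite !in_itv/= !andbT => x1 x2.
  have [z1 z2] := coord x; rewrite leNgt; apply/negP => xz; apply: za.
  have h1 : a.1 < z.1 :> R.
    apply: (lt_of_shift _ _ _ _ x1); apply: le_lt_trans xz; apply: le_trans z1.
    by rewrite distrC; exact: ler_norm.
  have h2 : a.2 < z.2 :> R.
    apply: (lt_of_shift _ _ _ _ x2); apply: le_lt_trans xz; apply: le_trans z2.
    by rewrite distrC; exact: ler_norm.
  by split; rewrite /= in_itv/= andbT.
rewrite inE => -[/=]; rewrite !in_itv/= !andbT => z1 z2.
pose m := Num.min (z.1 - a.1) (z.2 - a.2); have m0 : 0 < m by rewrite lt_min !subr_gt0 z1.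
have cE : (fun n => (1 - e n)%:E) @ \oo --> (1%:E : \bar R).
  apply/cvg_EFin; first exact: nearW.
  by rewrite -[X in _ --> X]subr0; apply: cvgB; [exact: cvg_cst|exact: ecvg].
apply: (squeeze_cvge _ cE (cvg_cst 1%:E)).
have : \forall n \near \oo, e n < m.
  by move/cvgrPdist_lt : ecvg => /(_ _ m0); apply: filterS => n; rewrite sub0r normrN; apply: le_lt_trans; exact: ler_norm.
apply: filterS => n en.
have C := gauss_massC z (c0 n) (measurable_quadrant (a.1 + n.+1%:R^-1 : R, a.2 + n.+1%:R^-1)).
have p0 V : (0 <= gauss_mass (c n) V z)%E by apply: gauss_mass_ge0; exact: ltW.
have : (gauss_mass (c n) (~` U n) z <= (e n)%:E)%E.
  apply: far; first exact: measurableC (measurable_quadrant _).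
  move=> x Ux; have [x1 x2] := coord x; rewrite leNgt; apply/negP => xz; apply: Ux.
  move: en; rewrite /m lt_min => /andP[]; rewrite /e => e1 e2.
  have h (u v y k l : R) : 2 * k < v - u -> `|v - y| <= l -> l < k -> u + k < y.
    by have := ler_norm (v - y); lra.
  have h1 : a.1 + n.+1%:R^-1 < x.1 :> R := h _ _ _ _ _ e1 x1 xz.
  have h2 : a.2 + n.+1%:R^-1 < x.2 :> R := h _ _ _ _ _ e2 x2 xz.
  by split; rewrite /= in_itv/= andbT.
move: C (p0 (U n)) (p0 (~` U n)); rewrite -/(U n).
case: (gauss_mass _ (U n) z) => [u| |]//; case: (gauss_mass _ (~` U n) z) => [v| |]//.
by rewrite -EFinD => -[uv]; rewrite !lee_fin; lra.
Qed.

Lemma eq_measure_smooth mu nu (c : nat -> R) :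
  (forall n, 2 * n.+1%:R ^+ 3 <= c n) ->
  (forall n U, measurable U -> \int[@area R]_(x in U) (smooth mu (c n) x)%:E =
     \int[@area R]_(x in U) (smooth nu (c n) x)%:E)%E ->
  forall A, measurable A -> mu A = nu A.
Proof.
move=> cn E; apply: eq_measure_quadrant => a.
have c0 n : 0 < c n.
  by apply: lt_le_trans (cn n); rewrite mulr_gt0// exprn_gt0.
pose U n := quadrant (a.1 + n.+1%:R^-1 : R, a.2 + n.+1%:R^-1).
have mU n : measurable (U n) by exact: measurable_quadrant.
have lim (m : probability (plane R) R) :
    (\int[m]_z gauss_mass (c n) (U n) z)%E @[n --> \oo] --> m (quadrant a).
  rewrite (_ : m (quadrant a) = \int[m]_z (\1_(quadrant a) z)%:E)%E; last first.
    by rewrite integral_indic ?setIT//; exact: measurable_quadrant.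
  apply: (@dominated_cvg _ _ _ m setT measurableT _ _ (cst 1%E)) => //.
  - by move=> n; exact: measurable_gauss_mass.
  - by move=> z _; exact: gauss_mass_quadrant_cvg.
  - exact: finite_measure_integrable_cst.
  - move=> n z _; rewrite gee0_abs; last by apply: gauss_mass_ge0; exact: ltW.
    rewrite /= -(gauss_massC z (c0 n) (mU n)) leeDl//.
    by apply: gauss_mass_ge0; exact: ltW.
have := lim nu; rewrite (_ : (fun n => _) = (fun n => \int[mu]_z gauss_mass (c n) (U n) z)%E).
  by move=> l; have /= := cvg_unique _ (lim mu) l; apply; exact: ereal_hausdorff.
by apply/funext => n; rewrite !integral_gauss_mass// E.
Qed.

(** If the dispersion vanishes, the smoothings agree for almost all [t], in
    particular for some arbitrarily large ones; they recover the measures of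
    quadrants. *)
Lemma eq_measure_dispersion (M : R) mu nu : 0 < M ->
  (\int[leb]_t dispersion M mu nu t = 0)%E ->
  forall A, measurable A -> mu A = nu A.
Proof.
move=> M0 D0.
have aeD : ae_eq leb setT (dispersion M mu nu : Rm -> _) (cst 0%E).
  apply/(ae_eq_integral_abs leb measurableT (measurable_dispersion _ _ _)).
  rewrite -D0; apply: eq_integral => t _; rewrite gee0_abs//.
  exact: dispersion_ge0.
have [N [mN N0 subN]] := aeD.
have pick (K : R) : exists t, K < t /\ dispersion M mu nu t = 0%E.
  apply: contrapT => /forallNP Kt.
  have sub : `]K, +oo[%classic `<=` N.
    move=> t /=; rewrite in_itv/= andbT => tK; apply: subN => /= /(_ I) t0.
    by apply: (Kt t); split.
  have : (leb `]K, +oo[%classic <= 0)%E by rewrite -N0 le_measure ?inE//; exact: measurable_itv.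
  by rewrite lebesgue_measure_itv/= ltry.
have [t tP] := choice (fun n : nat => pick (n.+1%:R ^+ 3 * M ^+ 2)).
have t0 n : 0 < t n.
  by have [+ _] := tP n; apply: le_lt_trans; rewrite mulr_ge0 ?exprn_ge0 ?ltW.
apply: (@eq_measure_smooth mu nu (fun n => 2 * (t n / M ^+ 2))) => n.
  rewrite ler_pM2l// ler_pdivlMr ?exprn_gt0//.
  by have [+ _] := tP n; exact: ltW.
move=> U mU; apply: ae_eq_integral => //.
- by apply: measurable_funTS; apply/measurable_EFinP; exact: measurable_smooth.
- by apply: measurable_funTS; apply/measurable_EFinP; exact: measurable_smooth.
have [_] := tP n; rewrite /dispersion t0 => /eqP.
rewrite mule_eq0 eqe gt_eqF ?divr_gt0 ?exprn_gt0//= => /eqP D.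
pose f x : \bar R := ((smooth mu (2 * (t n / M ^+ 2)) x - smooth nu (2 * (t n / M ^+ 2)) x) ^+ 2)%:E.
have mf : measurable_fun setT f.
  apply/measurable_EFinP; apply: measurable_funX; apply: measurable_funB;
  exact: measurable_smooth.
have [B [mB B0 subB]] : ae_eq (@area R) setT f (cst 0%E).
  apply/(ae_eq_integral_abs _ measurableT mf).
  by rewrite -D; apply: eq_integral => x _; rewrite gee0_abs// lee_fin sqr_ge0.
exists B; split => // x /= xU; apply: subB => /= /(_ I) fx; apply: xU => _.
move: fx => [] /eqP; rewrite sqrf_eq0 subr_eq0 => /eqP; exact: congr1.
Qed.

End uniqueness.

(** * Integrals against the exponential law *)

Section exponential_law_integrals.
Context {R : realType}.
Notation leb := (@lebesgue_measure R).
Notation Rm := (measurableTypeR R).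
Implicit Types (theta c : R).

Lemma integral_min_exp theta : 0 <= theta ->
  (\int[leb]_(t in `[0%R, +oo[) (Num.min theta t * expR (- t))%:E =
   (1 - expR (- theta))%:E)%E.
Proof.
move=> h0.
pose f (p : Rm * Rm) : R := if (p.2 \in `[0, theta]) && (p.2 <= p.1) then expR (- p.1) else 0.
have f0 p : (0 <= (f p)%:E)%E by rewrite lee_fin /f; case: ifP => // _; exact: expR_ge0.
have mf : measurable_fun setT (EFin \o f).
  apply/measurable_EFinP; apply: measurable_fun_ifT => //.
    rewrite (_ : (fun x => _) = (fun p : Rm * Rm => ((0 <= p.2) && (p.2 <= theta)) && (p.2 <= p.1))).
      apply: measurable_and; last exact: measurable_fun_ler.
      by apply: measurable_and; exact: measurable_fun_ler.
    by apply/funext => p; rewrite in_itv.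
  by apply: measurableT_comp => //; exact: measurableT_comp.
transitivity (\int[leb]_t \int[leb]_s (f (t, s))%:E)%E.
  rewrite integral_mkcond; apply: eq_integral => t _; rewrite patchE mem_setE.
  rewrite in_itv/= andbT; case: leP => t0; last first.
    apply/esym; rewrite -[RHS](integral0 leb setT); apply: eq_integral => s _; rewrite /f in_itv/=.
    case: ifPn => // /andP[/andP[s0 _] st].
    by have := le_lt_trans (le_trans s0 st) t0; rewrite ltxx.
  have mt0 : 0 <= Num.min theta t by rewrite le_min h0.
  transitivity (\int[leb]_(s in `[0%R, Num.min theta t]) (expR (- t))%:E)%E.
    rewrite integral_cst//= lebesgue_measure_itv/= lte_fin.
    case: ltgtP mt0 => // [m0 _|<- _]; last by rewrite mul0r mule0.
    by rewrite -EFinM subr0 mulrC.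
  rewrite integral_mkcond; apply: eq_integral => s _; rewrite patchE mem_setE /f /=.
  by rewrite !in_itv/= le_min andbA; case: ifP.
rewrite (@fubini_tonelli _ _ _ _ _ leb leb (EFin \o f) mf f0).
have dF (s : R) : is_derive s 1 (fun s : R => - expR (- s)) (expR (- s)).
  have d1 : is_derive s 1 (fun s : R => expR (- s)) (expR (- s) * - 1).
    by apply: is_derivef_exp; apply: is_derivefN; exact: is_derive_id.
  by apply: is_derive_eq (is_derivefN d1) _; rewrite mulrN1 opprK.
have cexp : continuous (fun s : R => expR (- s)).
  move=> s; apply: continuous_cvg; [exact: continuous_expR|apply: cvgN; exact: cvg_id].
have := integral_FTC2 h0 dF cexp; rewrite oppr0 expR0 opprK addrC => <-.
rewrite [RHS]integral_mkcond; apply: eq_integral => s _; rewrite patchE mem_setE.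
case: ifPn => [sh|sh]; last first.
  by rewrite -[RHS](integral0 leb setT); apply: eq_integral => t _; rewrite /f/= (negbTE sh).
have := @integral_exp_tail R 1 s ltr01; rewrite invr1 !mul1r => <-.
rewrite [RHS]integral_mkcond; apply: eq_integral => t _; rewrite patchE mem_setE.
by rewrite /f/= sh/= in_itv/= andbT mul1r; case: ifP.
Qed.

(** Layer by layer: the set where [- ln |t| > s] has length [2 exp (- s)]. *)
Lemma integral_neg_ln : (\int[leb]_t (Num.max 0 (- ln `|t|))%:E <= 2%:E)%E.
Proof.
pose f (p : Rm * Rm) : R := if (0 <= p.2) && (`|p.1| < expR (- p.2)) then 1 else 0.
have f0 p : (0 <= (f p)%:E)%E by rewrite lee_fin /f; case: ifP.
have mf : measurable_fun setT (EFin \o f).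
  apply/measurable_EFinP; apply: measurable_fun_ifT => //.
  apply: measurable_and; first exact: measurable_fun_ler.
  apply: measurable_fun_ltr; first exact: measurableT_comp.
  by apply: measurableT_comp => //; exact: measurableT_comp.
have mfF : measurable_fun setT (fun t : Rm => \int[leb]_s (f (t, s))%:E)%E.
  exact: (@measurable_fun_fubini_tonelli_F _ _ _ _ _ leb _ mf f0).
apply: (@le_trans _ _ (\int[leb]_t \int[leb]_s (f (t, s))%:E)%E).
  apply: ge0_le_integral => //.
  - by move=> t _; rewrite lee_fin le_max lexx.
  - apply/measurable_EFinP; apply: measurable_maxr => //.
    by apply: measurableT_comp => //; apply: measurableT_comp => //; exact: measurableT_comp.
  move=> t _; have [->|t0] := eqVneq t 0.
    by rewrite normr0 ln0// oppr0 maxxx; exact: integral_ge0.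
  have t0' : 0 < `|t| by rewrite normr_gt0.
  have -> : (\int[leb]_s (f (t, s))%:E = \int[leb]_(s in `[0%R, (- ln `|t|)%R[) (cst 1%E s))%E.
    rewrite [RHS]integral_mkcond; apply: eq_integral => s _; rewrite patchE mem_setE.
    have E : (s < - ln `|t|) = (`|t| < expR (- s)).
      by rewrite ltrNr -ltr_expR lnK ?posrE.
    by rewrite /f/= in_itv/= E; case: ifP.
  rewrite integral_cst//= mul1e lebesgue_measure_itv/= lte_fin maxEge.
  by case: leP => [l0|l0]; rewrite ?sube0//; case: ltP.
rewrite (@fubini_tonelli _ _ _ _ _ leb leb (EFin \o f) mf f0).
have := @integral_exp_tail R 1 0 ltr01; rewrite invr1 mulr0 oppr0 expR0 !mul1r => E.
have -> : (\int[leb]_y \int[leb]_x (EFin \o f) (x, y) =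
    2%:E * \int[leb]_(t in `[0%R, +oo[) (expR (- (1 * t)))%:E)%E.
  rewrite -ge0_integralZl//; last first.
    apply: measurable_funTS; apply/measurable_EFinP; apply: measurableT_comp => //.
    by apply: measurableT_comp => //; exact: measurable_funM.
  rewrite [RHS]integral_mkcond; apply: eq_integral => s _; rewrite patchE mem_setE.
  rewrite in_itv/= andbT /f /=; case: ifPn => s0; last by rewrite integral0.
  have e0 : 0 < expR (- s) by exact: expR_gt0.
  transitivity (\int[leb]_(t in `](- expR (- s))%R, expR (- s)[) (cst 1%E t))%E.
    rewrite [RHS]integral_mkcond; apply: eq_integral => t _; rewrite patchE mem_setE.
    by rewrite in_itv/= -ltr_norml; case: ifP.
  rewrite integral_cst//= mul1e lebesgue_measure_itv/= lte_fin.
  by rewrite (lt_trans _ e0) ?oppr_lt0// mul1r -EFinM opprK; congr EFin; ring.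
by rewrite E mule1.
Qed.

(** The singularity at [t = theta] is logarithmic, because [1 - exp (- v) >= v
    exp (- v)]. *)
Lemma integral_ln_gap theta c : 0 < c ->
  (\int[leb]_(t in `[0%R, +oo[)
     (- ln (1 - expR (- (`|theta - t| / c))) * expR (- t))%:E < +oo)%E.
Proof.
move=> c0; pose v t := `|theta - t| / c.
have v0 t : 0 <= v t by rewrite divr_ge0// ltW.
pose H t := - ln (1 - expR (- v t)).
have H0 t : 0 <= H t.
  rewrite /H oppr_ge0 ln_le0// lerBlDr lerDl; exact: expR_ge0.
have HS t : H t <= v t + Num.max 0 (- ln (v t)).
  rewrite /H; have [->|vt] := eqVneq (v t) 0.
    by rewrite oppr0 expR0 subrr ln0// oppr0 add0r maxxx.
  have vt0 : 0 < v t by rewrite lt_neqAle eq_sym vt v0.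
  have h1 : v t * expR (- v t) <= 1 - expR (- v t).
    have := expR_ge1Dx (v t); rewrite -(@ler_pM2r _ (expR (- v t))) ?expR_gt0//.
    by rewrite -expRD subrr expR0 mulrDl mul1r; lra.
  have p1 : 0 < v t * expR (- v t) by rewrite mulr_gt0 ?expR_gt0.
  have {h1} : ln (v t * expR (- v t)) <= ln (1 - expR (- v t)).
    by rewrite ler_ln ?posrE// (lt_le_trans p1).
  rewrite lnM ?posrE ?expR_gt0// expRK => h1.
  by have : - ln (v t) <= Num.max 0 (- ln (v t)); [rewrite le_max lexx orbT|lra].
pose C := (`|theta| + 2) / c.
have C0 : 0 <= C by rewrite divr_ge0 ?addr_ge0 ?(ltW c0).
pose S (t : R) := Num.max 0 (- ln `|c^-1 * (t + - theta)|).
have S0 t : 0 <= S t by rewrite le_max lexx.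
have dom t : 0 <= t -> H t * expR (- t) <= C * expR (- (2^-1 * t)) + S t.
  move=> t0; have -> : S t = Num.max 0 (- ln (v t)).
    by rewrite /S normrM gtr0_norm ?invr_gt0// distrC mulrC.
  have e1 : expR (- t) <= 1 by rewrite -[leRHS]expR0 ler_expR oppr_le0.
  have vC : v t * expR (- t) <= C * expR (- (2^-1 * t)).
    rewrite /v /C ![_ / c * _]mulrAC ler_pM2r ?invr_gt0//.
    have -> : expR (- t) = expR (- (2^-1 * t)) * expR (- (2^-1 * t)).
      by rewrite -expRD; congr expR; lra.
    have g : `|theta - t| <= `|theta| + t by rewrite (le_trans (ler_normB _ _))// (ger0_norm t0).
    set e := expR (- (2^-1 * t)).
    have eE : expR (2^-1 * t) * e = 1 by rewrite -expRD subrr expR0.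
    have e2 := expR_ge1Dx (2^-1 * t).
    have e3 : 0 < e by exact: expR_gt0.
    have e4 : (1 + 2^-1 * t) * e <= 1 by rewrite -[leRHS]eE ler_pM2r.
    rewrite mulrA ler_pM2r//.
    apply: (@le_trans _ _ ((`|theta| + t) * e)); first by rewrite ler_pM2r.
    have := normr_ge0 theta; move: `|theta| => u u0; clear - u0 e4 e3 t0; nra.
  have H1 : H t * expR (- t) <= (v t + Num.max 0 (- ln (v t))) * expR (- t).
    by rewrite ler_pM2r ?expR_gt0.
  apply: le_trans H1 _; rewrite mulrDl lerD//.
  by rewrite ler_piMr// le_max lexx.
have mS : measurable_fun setT S.
  apply: measurable_maxr => //; apply: measurableT_comp => //; apply: measurableT_comp => //.
  apply: measurableT_comp => //; apply: measurable_funM => //; exact: measurable_funD.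
have mH : measurable_fun setT H.
  apply: measurableT_comp => //; apply: measurableT_comp => //; apply: measurable_funB => //.
  apply: measurableT_comp => //; apply: measurableT_comp => //; apply: measurable_funM => //.
  by apply: measurableT_comp => //; exact: measurable_funB.
have mexp (k : R) : measurable_fun setT (fun t : R => expR (- (k * t))).
  by apply: measurableT_comp => //; apply: measurableT_comp => //; exact: measurable_funM.
have h2 : 0 < 2^-1 :> R by rewrite invr_gt0.
have mE : measurable_fun setT (fun t : R => expR (- t)).
  by apply: measurableT_comp => //; exact: measurableT_comp.
apply: (@le_lt_trans _ _ (\int[leb]_(t in `[0%R, +oo[) (C * expR (- (2^-1 * t)) + S t)%:E)%E).
  apply: ge0_le_integral => //.
  - by move=> t _; rewrite lee_fin mulr_ge0 ?expR_ge0//; exact: H0.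
  - by apply: measurable_funTS; apply/measurable_EFinP; exact: (measurable_funM mH mE).
  - apply: measurable_funTS; apply/measurable_EFinP; apply: measurable_funD => //.
    exact: (measurable_funM (measurable_cst C) (mexp _)).
  - by move=> t /=; rewrite in_itv/= andbT lee_fin; exact: dom.
under eq_integral do rewrite EFinD EFinM.
rewrite ge0_integralD//; last 4 first.
- by move=> t _; rewrite -EFinM lee_fin mulr_ge0 ?expR_ge0.
- by apply: measurable_funTS; apply: measurable_funeM; apply/measurable_EFinP; exact: mexp.
- by move=> t _; rewrite lee_fin; exact: S0.
- by apply: measurable_funTS; apply/measurable_EFinP; exact: mS.
rewrite ge0_integralZl//; last first.
  by apply: measurable_funTS; apply/measurable_EFinP; exact: mexp.
rewrite integral_exp_tail// -EFinM lte_add_pinfty ?ltry//.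
apply: (@le_lt_trans _ _ (\int[leb]_t (S t)%:E)%E).
  apply: ge0_subset_integral; [exact: measurable_itv|exact: measurableT| | |by []].
    by apply/measurable_EFinP; exact: mS.
  by move=> t _; rewrite lee_fin; exact: S0.
pose f (u : R) : \bar R := (Num.max 0 (- ln `|u|))%:E.
have mf : measurable_fun setT f.
  apply/measurable_EFinP; apply: measurable_maxr => //.
  by apply: measurableT_comp => //; apply: measurableT_comp => //; exact: measurableT_comp.
have f0 u : (0 <= f u)%E by rewrite lee_fin le_max lexx.
have mf' : measurable_fun setT (fun u : R => f (c^-1 * u)).
  apply: (measurableT_comp mf); exact: measurable_funM.
rewrite (@integral_shift _ (fun u => f (c^-1 * u)) (- theta) mf')//.
rewrite (@integral_scale _ f c^-1) ?invr_gt0// invrK.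
apply: (@le_lt_trans _ _ (c%:E * 2%:E)%E); last by rewrite -EFinM ltry.
by rewrite lee_pmul2l// integral_neg_ln.
Qed.

End exponential_law_integrals.

(** * The equilibrium measure *)

Section equilibrium_measure.
Context {R : realType}.
Notation leb := (@lebesgue_measure R).
Notation Rm := (measurableTypeR R).
Implicit Types (z w x u : plane R).
Variable d : R.
Hypothesis d0 : 0 < d.

Definition equilibrium_scale : R := disc_area * edge d ^+ 2 / d.
Notation kappa := equilibrium_scale.

(** Under area, [logdepth] has a law proportional to [exp (- t / d)] on the
    half-line; this density, proportional to [|z| ^ (2 d - 2)], turns it into
    the standard exponential law. *)
Definition equilibrium_density z : R :=
  if cabs z <= edge d then kappa^-1 * expR (- ((1 - d^-1) * logdepth d z)) else 0.
Notation rho := equilibrium_density.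

Lemma equilibrium_scale_gt0 : 0 < kappa.
Proof. by rewrite !mulr_gt0 ?invr_gt0 ?exprn_gt0 ?edge_gt0 ?disc_area_gt0. Qed.

Lemma equilibrium_density_ge0 z : 0 <= rho z.
Proof.
rewrite /rho; case: ifP => // _.
by rewrite mulr_ge0 ?expR_ge0 ?invr_ge0// ltW// equilibrium_scale_gt0.
Qed.

Lemma equilibrium_density_gt0 z : disc (edge d) z -> 0 < rho z.
Proof.
rewrite /disc /= /rho => ->.
by rewrite mulr_gt0 ?expR_gt0 ?invr_gt0// equilibrium_scale_gt0.
Qed.

Lemma measurable_equilibrium_density : measurable_fun setT rho.
Proof.
apply: measurable_fun_ifT => //.
  by apply: measurable_fun_ler => //; exact: measurable_cabs.
apply: measurable_funM => //; apply: measurableT_comp => //.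
apply: measurableT_comp => //; apply: measurable_funM => //.
exact: measurable_logdepth.
Qed.

Lemma logdepth_pmul u z : cabs u = 1 -> logdepth d (pmul u z) = logdepth d z.
Proof. by move=> u1; rewrite /logdepth cabs_pmul u1 mul1r. Qed.

Lemma equilibrium_density_pmul u z : cabs u = 1 -> rho (pmul u z) = rho z.
Proof. by move=> u1; rewrite /rho cabs_pmul u1 mul1r logdepth_pmul. Qed.

Lemma area_equilibrium_density (f : R -> \bar R) :
  measurable_fun setT f -> (forall t, 0 <= f t)%E ->
  (\int[@area R]_z (f (logdepth d z) * (rho z)%:E) =
   \int[leb]_(t in `[0%R, +oo[) (f t * (expR (- t))%:E))%E.
Proof.
move=> mf f0.
pose g t := (f t * (kappa^-1 * expR (- ((1 - d^-1) * t)))%:E)%E.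
have k0 := equilibrium_scale_gt0.
have g0 t : (0 <= g t)%E.
  by rewrite mule_ge0// lee_fin mulr_ge0 ?expR_ge0// invr_ge0 ltW.
have mg : measurable_fun setT g.
  apply: emeasurable_funM => //; apply/measurable_EFinP; apply: measurable_funM => //.
  by apply: measurableT_comp => //; apply: measurableT_comp => //; exact: measurable_funM.
transitivity (\int[@area R]_(z in disc (edge d)) g (logdepth d z))%E.
  rewrite [RHS]integral_mkcond; apply: eq_integral => z _; rewrite patchE.
  case: ifPn => [|].
    by rewrite inE /disc/= /g /rho => ->.
  rewrite notin_setE /disc/= => /negP ez.
  by rewrite /rho (negbTE ez) mule0.
rewrite integral_logdepth// -/kappa -ge0_integralZl; last 4 first.
- exact: measurable_itv.
- apply: measurable_funTS; apply: emeasurable_funM => //.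
  by apply/measurable_EFinP; apply: measurableT_comp => //; apply: measurableT_comp.
- by move=> t _; rewrite mule_ge0// lee_fin expR_ge0.
- by rewrite lee_fin ltW.
apply: eq_integral => t _; rewrite /g.
have -> (y : \bar R) (a b e : R) : (e%:E * ((y * a%:E) * b%:E) = y * (e * (a * b))%:E)%E.
  by rewrite !EFinM -!muleA [LHS]muleCA.
congr (_ * _%:E)%E.
rewrite -[_^-1 * _ * _]mulrA mulVKf ?gt_eqF// -expRD; congr expR.
by field; rewrite gt_eqF.
Qed.

Lemma equilibrium_measure_exists : exists sigma : probability (plane R) R,
  forall A, sigma A = (\int[@area R]_(z in A) (rho z)%:E)%E.
Proof.
have [nu nuE] := density_measure_exists (@area R) measurable_equilibrium_density
  equilibrium_density_ge0.
have nuT : nu setT = 1%E.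
  rewrite nuE.
  transitivity (\int[@area R]_z (cst 1%E (logdepth d z) * (rho z)%:E))%E.
    by apply: eq_integral => z _; rewrite /cst mul1e.
  rewrite area_equilibrium_density//.
  have := @integral_exp_tail R 1 0 ltr01; rewrite invr1 mulr0 oppr0 expR0 mul1r => E.
  rewrite -[RHS]E; apply: eq_integral => t _; by rewrite /cst mul1e mul1r.
case: nu => nu cnu in nuE nuT *.
pose sigma : probability (plane R) R :=
  HB.pack nu cnu (Measure_isProbability.Build _ _ _ (Measure.Pack cnu) nuT).
by exists sigma.
Qed.

Variable sigma : probability (plane R) R.
Hypothesis sigmaE : forall A, sigma A = (\int[@area R]_(z in A) (rho z)%:E)%E.

Lemma integral_equilibrium (f : plane R -> \bar R) : measurable_fun setT f ->
  (forall z, 0 <= f z)%E ->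
  (\int[sigma]_z f z = \int[@area R]_z (f z * (rho z)%:E))%E.
Proof.
exact: (integral_density measurable_equilibrium_density equilibrium_density_ge0
  (fun A _ => sigmaE A)).
Qed.

Lemma integral_equilibrium_logdepth (f : R -> \bar R) : measurable_fun setT f ->
  (forall t, 0 <= f t)%E ->
  (\int[sigma]_z f (logdepth d z) =
   \int[leb]_(t in `[0%R, +oo[) (f t * (expR (- t))%:E))%E.
Proof.
move=> mf f0; rewrite integral_equilibrium ?area_equilibrium_density//.
exact: measurableT_comp mf (measurable_logdepth _).
Qed.

Lemma integral_equilibrium_rotation u (f : plane R -> \bar R) : cabs u = 1 ->
  measurable_fun setT f -> (forall z, 0 <= f z)%E ->
  (\int[sigma]_z f (pmul u z) = \int[sigma]_z f z)%E.
Proof.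
move=> u1 mf f0; rewrite !integral_equilibrium//; last first.
  exact: measurableT_comp mf (measurable_pmul u).
rewrite -[RHS](integral_rotation u1); last 2 first.
- apply: emeasurable_funM => //; apply/measurable_EFinP; exact: measurable_equilibrium_density.
- by move=> z; rewrite mule_ge0// lee_fin equilibrium_density_ge0.
by apply: eq_integral => z _; rewrite equilibrium_density_pmul.
Qed.

Lemma equilibrium_outside : sigma (~` disc (edge d)) = 0%E.
Proof.
rewrite sigmaE integral_mkcond -[RHS](integral0 (@area R) setT).
apply: eq_integral => z _; rewrite patchE; case: ifPn => //.
by rewrite inE /disc/= => /negP ez; rewrite /rho (negbTE ez).
Qed.

Lemma equilibrium_origin : sigma [set (0, 0)] = 0%E.
Proof.
have m0 : measurable ([set (0, 0)] : set (plane R)) by rewrite set1_pair; apply: measurableX.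
rewrite sigmaE -(@integral_abs_eq0 _ _ _ (@area R) [set (0, 0)] (fun z => (rho z)%:E))//.
- by apply: eq_integral => z _; rewrite gee0_abs// lee_fin equilibrium_density_ge0.
- apply: measurable_funTS; apply/measurable_EFinP; exact: measurable_equilibrium_density.
- exact: area_origin.
Qed.

Lemma equilibrium_level (theta : R) : sigma [set z | logdepth d z = theta] = 0%E.
Proof.
have mth : measurable ([set theta] : set Rm) by exact: measurable_set1.
have mA : measurable [set z | logdepth d z = theta].
  by have := measurable_logdepth d measurableT mth; rewrite setTI.
have := integral_indic sigma measurableT mA; rewrite setIT => <-.
transitivity (\int[sigma]_z (\1_[set theta] (logdepth d z))%:E)%E.
  by apply: eq_integral => z _; rewrite !indicE.
rewrite (@integral_equilibrium_logdepth (fun t => (\1_([set theta] : set Rm) t)%:E))//; last first.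
  by apply/measurable_EFinP; exact: measurable_indic.
rewrite integral_mkcond.
transitivity (\int[leb]_(t in [set theta]) ((expR (- t))%:E * (\1_(`[0, +oo[%classic : set R) t)%:E))%E.
  rewrite [RHS]integral_mkcond; apply: eq_integral => t _; rewrite !patchE !indicE.
  by case: ifP; case: ifP => _ _; rewrite ?mul1e ?mule1 ?mul0e ?mule0.
exact: integral_set1.
Qed.

Lemma equilibrium_ae theta : {ae sigma, forall w,
  [/\ 0 < cabs w, cabs w <= edge d & logdepth d w != theta]}.
Proof.
exists ([set (0, 0)] `|` ~` disc (edge d) `|` [set z | logdepth d z = theta]).
have m0 : measurable ([set (0, 0)] : set (plane R)) by rewrite set1_pair; apply: measurableX.
have mth : measurable ([set theta] : set Rm) by exact: measurable_set1.
have mA : measurable [set z | logdepth d z = theta].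
  by have := measurable_logdepth d measurableT mth; rewrite setTI.
have mD := measurableC (measurable_disc (edge d)).
split.
- by apply: measurableU => //; exact: measurableU.
- apply/eqP; rewrite -measure_le0.
  apply: le_trans (measureU2 _ _ _) _ => //; first exact: measurableU.
  rewrite [X in (_ + X)%E]equilibrium_level adde0.
  apply: le_trans (measureU2 _ _ _) _ => //.
  by rewrite [X in (X + _)%E]equilibrium_origin [X in (_ + X)%E]equilibrium_outside adde0.
move=> w /= H; apply: contrapT => nw; apply: H; split.
- rewrite lt_neqAle cabs_ge0 andbT; apply/eqP => /esym/cabs_eq0 w0.
  by apply: nw; left; left.
- by apply: contrapT => /negP ew; apply: nw; left; right; exact/negP.
- by apply/eqP => wt; apply: nw; right.
Qed.

End equilibrium_measure.

(** * The truncated logarithmic kernel *)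

Section logarithmic_potential.
Context {R : realType}.
Notation leb := (@lebesgue_measure R).
Notation Rm := (measurableTypeR R).
Implicit Types (z w x u : plane R).

Lemma log_kernelE (M : R) z w : 0 < M -> 0 < cabs (z - w) <= M ->
  log_kernel M z w = (ln M - ln (cabs (z - w)))%:E.
Proof.
move=> M0 /andP[zw0 zwM]; rewrite /log_kernel.
have L0 : 0 <= 2 * (ln M - ln (cabs (z - w))).
  by rewrite mulr_ge0// subr_ge0 ler_ln ?posrE.
have -> : sqr_ratio M z w = expR (- (2 * (ln M - ln (cabs (z - w))))).
  rewrite /sqr_ratio -mulrN opprB expRM_natl expRB !lnK ?posrE//.
by rewrite log_mixture_expRN// mulrAC divff ?mul1r.
Qed.

Lemma log_kernel_ge0 (M : R) z w : (0 <= log_kernel M z w)%E.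
Proof. exact: log_mixture_ge0. Qed.

Lemma measurable_log_kernel (M : R) : measurable_fun setT
  (fun p : plane R * plane R => log_kernel M p.1 p.2).
Proof.
have mL : measurable_fun setT (@log_mixture R : Rm -> \bar R).
  apply: (@measurable_fun_fubini_tonelli_F _ _ _ _ _ leb
    (fun p : Rm * Rm => (log_slice p.1 p.2)%:E)).
    by apply/measurable_EFinP; exact: measurable_log_slice.
  by move=> p; rewrite lee_fin log_slice_ge0.
exact: (measurableT_comp mL (measurable_sqr_ratio M)).
Qed.

(** In the conclusion [exp (- |ln a - ln b|)] is the quotient of the smaller
    radius by the larger one. *)
Lemma ln_cyclotomic_bounds (a b P : R) n : (0 < n)%N -> 0 < a -> 0 < b -> a != b ->
  `|a ^+ n - b ^+ n| <= P <= a ^+ n + b ^+ n ->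
  [/\ 0 < P, - ln P <= - (n%:R * ln (Num.max a b)) - ln (1 - expR (- `|ln a - ln b|))
    & ln P <= n%:R * ln (Num.max a b) + ln 2].
Proof.
move=> n0; wlog ab : a b / b < a.
  move=> H a0 b0; rewrite neq_lt => /orP[ab|ab] h.
    have := H b a ab b0 a0; rewrite gt_eqF//= => /(_ isT).
    rewrite [Num.max b a]maxC [`|b ^+ n - _|]distrC [`|ln b - _|]distrC [b ^+ n + _]addrC.
    exact.
  by apply: H => //; rewrite gt_eqF.
move=> a0 b0 _; rewrite (max_l (ltW ab)).
have ba : b / a < 1 by rewrite ltr_pdivrMr// mul1r.
have q0 : 0 < b / a by rewrite divr_gt0.
have qE : expR (- `|ln a - ln b|) = b / a.
  have lab : ln b < ln a by rewrite ltr_ln ?posrE.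
  by rewrite gtr0_norm ?subr_gt0// opprB expRB !lnK ?posrE.
have an0 : 0 < a ^+ n by rewrite exprn_gt0.
have bn : b ^+ n = a ^+ n * (b / a) ^+ n.
  by rewrite expr_div_n mulrCA divff ?mulr1// gt_eqF.
have qn : (b / a) ^+ n <= b / a.
  by case: n n0 {an0 bn} => // n _; rewrite exprS ger_pMr// exprn_ile1// ltW.
rewrite qE => /andP[/(le_trans (ler_norm _)) P1 P2].
have P3 : a ^+ n * (1 - b / a) <= P.
  apply: le_trans P1; rewrite bn -[X in _ <= X - _]mulr1 -mulrBr ler_pM2l//.
  by rewrite lerB.
have p0 : 0 < a ^+ n * (1 - b / a) by rewrite mulr_gt0// subr_gt0.
have P0 := lt_le_trans p0 P3.
have lnan : ln (a ^+ n) = n%:R * ln a by rewrite lnXn// mulr_natl.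
split => //.
  have : ln (a ^+ n * (1 - b / a)) <= ln P by rewrite ler_ln.
  by rewrite lnM ?posrE ?subr_gt0// lnan; lra.
rewrite -lnan -lnM ?posrE// ler_ln ?posrE ?mulr_gt0//.
apply: le_trans P2 _; rewrite mulr_natr mulr2n lerD2l.
by rewrite lerXn2r ?nnegrE ?ltW.
Qed.

End logarithmic_potential.

(** * The potential of the equilibrium measure *)

Section equilibrium_potential.
Context {R : realType}.
Notation leb := (@lebesgue_measure R).
Notation Rm := (measurableTypeR R).
Implicit Types (z w x u : plane R).
Variables (d M : R) (sigma : probability (plane R) R).
Hypothesis d0 : 0 < d.
Hypothesis M0 : 0 < M.
Hypothesis edgeM : edge d <= M / 2.
Hypothesis sigmaE : forall A, sigma A = (\int[@area R]_(z in A) (equilibrium_density d z)%:E)%E.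

Definition log_potential z : \bar R := (\int[sigma]_w log_kernel M z w)%E.

Let c := ln M + ln d / (2 * d).

(** For [t >= 0], the mean of the logarithmic kernel at a point of depth
    [theta] over the circle of depth [t]. Replacing [t] by its positive part
    keeps it nonnegative. *)
Definition averaged_kernel (theta t : R) : R :=
  c + Num.min theta (Num.max 0 t) / (2 * d).

Let gap (theta t : R) : R := - ln (1 - expR (- (`|theta - t| / (2 * d)))).

Let gap_ge0 theta t : 0 <= gap theta t.
Proof.
rewrite /gap oppr_ge0 ln_le0// lerBlDr lerDl; exact: expR_ge0.
Qed.

Lemma ln_cabs_logdepth w : ln (cabs w) = - (logdepth d w + ln d) / (2 * d).
Proof. by rewrite /logdepth; field; rewrite gt_eqF. Qed.

Lemma ln_max (a b : R) : 0 < a -> 0 < b -> ln (Num.max a b) = Num.max (ln a) (ln b).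
Proof.
move=> a0 b0; case: (leP a b) => ab.
  by rewrite max_r// ler_ln ?posrE.
by rewrite max_l// ler_ln ?posrE// ltW.
Qed.

Lemma averaged_kernelE z w : 0 < cabs z -> 0 < cabs w -> cabs w <= edge d ->
  averaged_kernel (logdepth d z) (logdepth d w) = ln M - ln (Num.max (cabs z) (cabs w)).
Proof.
move=> z0 w0 we; rewrite ln_max// !ln_cabs_logdepth /averaged_kernel /c.
have t0 : 0 <= logdepth d w by rewrite le_logdepth// mul0r oppr0 expR0 mulr1.
rewrite [Num.max 0 _]max_r//.
have e0 : 0 < 2 * d by rewrite mulr_gt0.
case: (leP (logdepth d z) (logdepth d w)) => tt.
  rewrite max_l; first by field; rewrite gt_eqF.
  by rewrite ler_pM2r ?invr_gt0// lerN2 lerD2r.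
rewrite max_r; first by field; rewrite gt_eqF.
by rewrite ler_pM2r ?invr_gt0// lerN2 lerD2r ltW.
Qed.

Lemma averaged_kernel_ge0 z t : 0 < cabs z -> cabs z <= M ->
  0 <= averaged_kernel (logdepth d z) t.
Proof.
move=> z0 zM; have e0 : 0 < 2 * d by rewrite mulr_gt0.
have zM' : ln (cabs z) <= ln M by rewrite ler_ln ?posrE.
rewrite ln_cabs_logdepth in zM'.
have eM : ln (edge d) <= ln M.
  by rewrite ler_ln ?posrE ?edge_gt0// (le_trans edgeM)// ler_piMr ?invf_le1 ?ler1n ?ltW.
have lE : ln (edge d) = - ln d / (2 * d).
  by rewrite /edge ln_powR; field; rewrite gt_eqF.
rewrite /averaged_kernel /c minElt; case: ifP => _.
  by move: zM'; rewrite mulNr mulrDl; lra.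
have : 0 <= Num.max 0 t / (2 * d) by rewrite divr_ge0 ?(ltW e0)// le_max lexx.
by move: eM; rewrite lE mulNr; lra.
Qed.

Lemma measurable_averaged_kernel theta : measurable_fun setT (averaged_kernel theta).
Proof.
apply: measurable_funD => //; apply: measurable_funM => //; apply: measurable_minr => //.
exact: measurable_maxr.
Qed.

Let measurable_gap theta : measurable_fun setT (gap theta).
Proof.
apply: measurableT_comp => //; apply: measurableT_comp => //; apply: measurable_funB => //.
apply: measurableT_comp => //; apply: measurableT_comp => //; apply: measurable_funM => //.
by apply: measurableT_comp => //; exact: measurable_funB.
Qed.

Let rotated_kernel_bounds n z (rot : 'I_n -> plane R) : (0 < n)%N -> (forall k, cabs (rot k) = 1) ->
  (forall z w, `|cabs z ^+ n - cabs w ^+ n| <=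
    \prod_(k < n) cabs (z - pmul (rot k) w) <= cabs z ^+ n + cabs w ^+ n) ->
  0 < cabs z -> cabs z <= M / 2 -> forall w, 0 < cabs w -> cabs w <= edge d ->
  logdepth d w != logdepth d z ->
  (\sum_(k < n) log_kernel M z (pmul (rot k) w) <=
    (n%:R * averaged_kernel (logdepth d z) (logdepth d w) +
     gap (logdepth d z) (logdepth d w))%:E)%E /\
  ((n%:R * averaged_kernel (logdepth d z) (logdepth d w))%:E <=
   \sum_(k < n) log_kernel M z (pmul (rot k) w) + (ln 2)%:E)%E.
Proof.
move=> n0 rot1 rotP z0 zM w w0 we zw.
have e0 : 0 < 2 * d by rewrite mulr_gt0.
have ab : cabs z != cabs w.
  by apply: contra_neq zw => E; rewrite /logdepth E.
have [P0 P1 P2] := ln_cyclotomic_bounds n0 z0 w0 ab (rotP z w).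
set P := \prod_(k < n) _ in P0 P1 P2.
have fac k : 0 < cabs (z - pmul (rot k) w).
  rewrite lt_neqAle cabs_ge0 andbT; apply/eqP => E; move: P0.
  by rewrite /P (bigD1 k)//= -E mul0r ltxx.
have kE : (\sum_(k < n) log_kernel M z (pmul (rot k) w) = (n%:R * ln M - ln P)%:E)%E.
  transitivity (\sum_(k < n) (ln M - ln (cabs (z - pmul (rot k) w)))%:E)%E.
    apply: eq_bigr => k _; rewrite log_kernelE// fac/=.
    rewrite (le_trans (cabsD _ _))// cabs_pmul rot1 mul1r.
    by move: (le_trans we edgeM) zM; lra.
  rewrite sumEFin sumrB sumr_const card_ord mulr_natl; congr (_ - _)%:E.
  have : forall (s : seq 'I_n), ln (\prod_(k <- s) cabs (z - pmul (rot k) w)) =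
      \sum_(k <- s) ln (cabs (z - pmul (rot k) w)).
    elim => [|k s IH]; first by rewrite !big_nil ln1.
    by rewrite !big_cons lnM ?posrE ?IH ?fac// prodr_gt0.
  by move=> ->.
have gE : - ln (1 - expR (- `|ln (cabs z) - ln (cabs w)|)) =
    gap (logdepth d z) (logdepth d w).
  rewrite /gap; congr (- ln (1 - expR (- _))).
  rewrite !ln_cabs_logdepth -mulrBl normrM [`|(2 * d)^-1|]gtr0_norm ?invr_gt0//.
  by rewrite -normrN; congr (`|_| * _); ring.
rewrite kE averaged_kernelE// -gE -EFinD !lee_fin mulrBr.
by split; [move: P1|move: P2]; lra.
Qed.

Let exp_mass : (\int[leb]_(t in `[0%R, +oo[) (expR (- t))%:E = 1%E)%E.
Proof.
have := @integral_exp_tail R 1 0 ltr01; rewrite invr1 mulr0 oppr0 expR0 mul1r => E.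
by rewrite -[RHS]E; apply: eq_integral => t _; rewrite mul1r.
Qed.

Let measurable_expN : measurable_fun setT (fun t : Rm => expR (- t)).
Proof. by apply: measurableT_comp => //; exact: measurableT_comp. Qed.

(** The value of the equilibrium potential at depth [theta]; outside of the
    droplet, where [theta < 0], it is that of a unit charge at the origin. *)
Definition potential_profile (theta : R) : R :=
  c + (if 0 <= theta then 1 - expR (- theta) else theta) / (2 * d).

Lemma integral_averaged_kernel z : 0 < cabs z -> cabs z <= M ->
  (\int[sigma]_w (averaged_kernel (logdepth d z) (logdepth d w))%:E =
   (potential_profile (logdepth d z))%:E)%E.
Proof.
move=> z0 zM; set theta := logdepth d z.
have e0 : 0 < 2 * d by rewrite mulr_gt0.
have B0 t : 0 <= averaged_kernel theta t by exact: averaged_kernel_ge0.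
rewrite (integral_equilibrium_logdepth d0 sigmaE (f := fun t => (averaged_kernel theta t)%:E)); last 2 first.
- by apply/measurable_EFinP; exact: measurable_averaged_kernel.
- by move=> t; rewrite lee_fin.
rewrite /potential_profile; case: ifPn => th.
  have c0 : 0 <= c.
    have := B0 0; rewrite /averaged_kernel maxxx min_r//.
    by rewrite mul0r addr0.
  transitivity (\int[leb]_(t in `[0%R, +oo[) (c%:E * (expR (- t))%:E +
      ((2 * d)^-1)%:E * (Num.min theta t * expR (- t))%:E))%E.
    apply: eq_integral => t; rewrite inE/= in_itv/= andbT => t0.
    by rewrite /averaged_kernel max_r// -!EFinM -EFinD; congr EFin; ring.
  have mm : measurable_fun setT (fun t : Rm => (Num.min theta t * expR (- t))%:E).
    apply/measurable_EFinP; apply: measurable_funM => //; exact: measurable_minr.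
  rewrite ge0_integralD; last 5 first.
  - exact: measurable_itv.
  - by move=> t _; rewrite -EFinM lee_fin mulr_ge0 ?expR_ge0.
  - by apply: measurable_funTS; apply: measurable_funeM; exact/measurable_EFinP.
  - move=> t /=; rewrite in_itv/= andbT => t0; rewrite -EFinM lee_fin.
    by rewrite mulr_ge0 ?invr_ge0 ?(ltW e0)// mulr_ge0 ?expR_ge0// le_min th.
  - by apply: measurable_funTS; exact: measurable_funeM.
  rewrite ge0_integralZl; last 4 first.
  - exact: measurable_itv.
  - by apply: measurable_funTS; exact/measurable_EFinP.
  - by move=> t _; rewrite lee_fin expR_ge0.
  - by rewrite lee_fin.
  rewrite ge0_integralZl; last 4 first.
  - exact: measurable_itv.
  - exact: measurable_funTS.
  - by move=> t /=; rewrite in_itv/= andbT => t0; rewrite lee_fin mulr_ge0 ?expR_ge0// le_min th.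
  - by rewrite lee_fin invr_ge0 ltW.
  by rewrite exp_mass integral_min_exp// mule1 -EFinM -EFinD mulrC.
rewrite -ltNge in th; pose k := c + theta / (2 * d).
have k0 : 0 <= k.
  have := B0 0; rewrite /averaged_kernel maxxx min_l//; exact: ltW.
transitivity (\int[leb]_(t in `[0%R, +oo[) (k%:E * (expR (- t))%:E))%E.
  apply: eq_integral => t; rewrite inE/= in_itv/= andbT => t0.
  by rewrite /averaged_kernel max_r// min_l// (le_trans (ltW th)).
rewrite ge0_integralZl; last 4 first.
- exact: measurable_itv.
- by apply: measurable_funTS; exact/measurable_EFinP.
- by move=> t _; rewrite lee_fin expR_ge0.
- by rewrite lee_fin.
by rewrite exp_mass mule1.
Qed.

Let gap_finite theta : exists2 h : R, 0 <= h &
  (\int[sigma]_w (gap theta (logdepth d w))%:E = h%:E)%E.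
Proof.
have i0 : (0 <= \int[sigma]_w (gap theta (logdepth d w))%:E)%E.
  by apply: integral_ge0 => w _; rewrite lee_fin.
have : (\int[sigma]_w (gap theta (logdepth d w))%:E < +oo)%E.
  rewrite (integral_equilibrium_logdepth d0 sigmaE (f := fun t => (gap theta t)%:E)); last 2 first.
  - by apply/measurable_EFinP; exact: measurable_gap.
  - by move=> t; rewrite lee_fin.
  under eq_integral do rewrite -EFinM.
  by apply: integral_ln_gap; rewrite mulr_gt0.
case: integral i0 => [h h0 _|//|//].
by exists h => //; rewrite -lee_fin.
Qed.

(** Averaging over the rotations by the [n]-th roots of unity replaces
    [ln |z - w|] by [ln |z ^ n - w ^ n| / n], which is within [O(1 / n)] of
    [ln (max |z| |w|)] in mean. *)
Lemma log_potential_squeeze z : 0 < cabs z -> cabs z <= M / 2 ->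
  exists2 h : R, 0 <= h & forall n, (0 < n)%N ->
    (n%:R%:E * log_potential z <=
      (n%:R * potential_profile (logdepth d z) + h)%:E)%E /\
    ((n%:R * potential_profile (logdepth d z))%:E <=
      n%:R%:E * log_potential z + (ln 2)%:E)%E.
Proof.
move=> z0 zM; set theta := logdepth d z.
have zM' : cabs z <= M by apply: le_trans zM _; rewrite ler_piMr ?invf_le1 ?ler1n ?ltW.
have [h h0 hE] := gap_finite theta.
exists h => // n n0; have [rot [rot1 rotP]] := @cyclotomic_product_bounds R n n0.
have mk : measurable_fun setT (log_kernel M z).
  exact: measurableT_comp (measurable_log_kernel M) (pair1_measurable z).
have mkr k : measurable_fun setT (fun w => log_kernel M z (pmul (rot k) w)).
  exact: measurableT_comp mk (measurable_pmul _).
have VE : (n%:R%:E * log_potential z =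
    \int[sigma]_w \sum_(k < n) log_kernel M z (pmul (rot k) w))%E.
  rewrite ge0_integral_sum//; last by move=> k w _; exact: log_kernel_ge0.
  rewrite (eq_bigr (fun=> log_potential z)); last first.
    move=> k _; rewrite (integral_equilibrium_rotation d0 sigmaE (f := log_kernel M z))//.
    by move=> w; exact: log_kernel_ge0.
  rewrite big_const cardT size_enum_ord.
  rewrite (_ : iter _ _ _ = log_potential z *+ n)%E; last first.
    by case: n {n0 rot rot1 rotP mkr} => //; elim => [|k] /=; [rewrite adde0|move=> ->].
  by rewrite mule_natl.
have B0 t : 0 <= averaged_kernel theta t by exact: averaged_kernel_ge0.
have mB : measurable_fun setT (fun w => (averaged_kernel theta (logdepth d w))%:E).
  by apply/measurable_EFinP; exact: measurableT_comp (measurable_averaged_kernel _) (measurable_logdepth _).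
have mG : measurable_fun setT (fun w => (gap theta (logdepth d w))%:E).
  by apply/measurable_EFinP; exact: measurableT_comp (measurable_gap _) (measurable_logdepth _).
have ms : measurable_fun setT (fun w => \sum_(k < n) log_kernel M z (pmul (rot k) w))%E.
  exact: emeasurable_sum.
have s0 w : (0 <= \sum_(k < n) log_kernel M z (pmul (rot k) w))%E.
  by apply: sume_ge0 => k _; exact: log_kernel_ge0.
have nB : (\int[sigma]_w (n%:R%:E * (averaged_kernel theta (logdepth d w))%:E) =
    (n%:R * potential_profile theta)%:E)%E.
  rewrite ge0_integralZl//; last first.
    by move=> w _; rewrite lee_fin.
  by rewrite integral_averaged_kernel// -EFinM.
have mnB : measurable_fun setT (fun w => n%:R%:E * (averaged_kernel theta (logdepth d w))%:E)%E.
  exact: measurable_funeM.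
have nB0 w : (0 <= n%:R%:E * (averaged_kernel theta (logdepth d w))%:E)%E.
  by rewrite -EFinM lee_fin mulr_ge0.
have ae := equilibrium_ae d0 sigmaE theta.
have l2 : 0 <= ln 2 :> R by rewrite ln_ge0// ler1n.
split.
  rewrite VE EFinD -nB -hE -ge0_integralD//; last first.
    by move=> w _; rewrite lee_fin.
  apply: ae_ge0_le_integral => //.
  - by move=> w _; rewrite adde_ge0// lee_fin.
  - exact: emeasurable_funD.
  apply: filterS ae => w [w0 we wt] _.
  by have [] := rotated_kernel_bounds n0 rot1 rotP z0 zM w0 we wt.
have -> : ((ln 2)%:E = \int[sigma]_w (cst (ln 2)%:E w))%E.
  by rewrite integral_cst//= probability_setT mule1.
rewrite VE -nB -ge0_integralD//.
apply: ae_ge0_le_integral => //.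
- by move=> w _; rewrite adde_ge0.
- exact: emeasurable_funD.
apply: filterS ae => w [w0 we wt] _.
by have [] := rotated_kernel_bounds n0 rot1 rotP z0 zM w0 we wt.
Qed.

Lemma log_potentialE z : 0 < cabs z -> cabs z <= M / 2 ->
  log_potential z = (potential_profile (logdepth d z))%:E.
Proof.
move=> z0 zM; have [h h0 H] := log_potential_squeeze z0 zM.
have V0 : (0 <= log_potential z)%E by apply: integral_ge0 => w _; exact: log_kernel_ge0.
move: H V0; case: (log_potential z) => [v| |]//; last first.
  by move=> /(_ 1%N isT)[+ _]; rewrite mul1e.
move: (potential_profile _) => g H _; congr EFin; apply/eqP/contraT => vg.
pose e := `|v - g|; have e0 : 0 < e by rewrite normr_gt0 subr_eq0.
pose n := (Num.truncn ((h + ln 2) / e)).+1.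
have := truncnS_gt ((h + ln 2) / e); rewrite -/n ltr_pdivrMr// => nh.
have [] := H n isT; rewrite -EFinM -EFinD !lee_fin => H1 H2.
have l2 : 0 <= ln 2 :> R by rewrite ln_ge0// ler1n.
suff : n%:R * e <= h + ln 2 by rewrite leNgt nh.
rewrite /e -[n%:R]ger0_norm// -normrM ler_norml mulrBr; apply/andP; split; lra.
Qed.

Lemma potential_profile_sum z : 0 < cabs z ->
  (1 + ln d) / d + 2 * ln M <= 2 * potential_profile (logdepth d z) + cabs z `^ (2 * d).
Proof.
move=> z0; rewrite powR_cabs// /potential_profile /c.
set theta := logdepth d z.
have -> : 2 * (ln M + ln d / (2 * d) + (if 0 <= theta then 1 - expR (- theta) else theta) / (2 * d)) +
  expR (- theta) / d = (ln d + (if 0 <= theta then 1 - expR (- theta) else theta) + expR (- theta)) / d + 2 * ln M.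
  by field; rewrite gt_eqF.
rewrite lerD2r ler_pM2r ?invr_gt0//; case: ifP => _; first by lra.
by have := expR_ge1Dx (- theta); lra.
Qed.

Lemma potential_profile_sum_disc z : 0 < cabs z -> cabs z <= edge d ->
  2 * potential_profile (logdepth d z) + cabs z `^ (2 * d) = (1 + ln d) / d + 2 * ln M.
Proof.
move=> z0 ze; rewrite powR_cabs// /potential_profile /c.
have -> : 0 <= logdepth d z by rewrite le_logdepth// mul0r oppr0 expR0 mulr1.
by field; rewrite gt_eqF.
Qed.

End equilibrium_potential.

(** * The support of the equilibrium measure *)

Section equilibrium_support.
Context {R : realType}.
Notation leb := (@lebesgue_measure R).
Notation Rm := (measurableTypeR R).
Implicit Types (z w x u : plane R) (U : set (plane R)).

Lemma cabs_le_norm1 z : cabs z <= `|z.1| + `|z.2|.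
Proof.
rewrite -(@ler_pXn2r _ 2) ?nnegrE ?addr_ge0 ?cabs_ge0// sqr_cabs.
rewrite -(real_normK (num_real z.1)) -(real_normK (num_real z.2)) sqrrD.
by rewrite lerD2r lerDl mulrn_wge0// mulr_ge0.
Qed.

Lemma cabs_ball z w (e : R) : ball z e w -> cabs (z - w) < e + e.
Proof.
move=> [/= zw1 zw2]; apply: le_lt_trans (cabs_le_norm1 _) _.
by rewrite ltrD.
Qed.

Lemma cabs_triangle z w : cabs z <= cabs (z - w) + cabs w.
Proof.
have := cabsD (z - w) (- w); rewrite opprK subrK.
by rewrite (_ : cabs (- w) = cabs w)// /cabs/= !sqrrN.
Qed.

Lemma open_disc r : open [set z : plane R | cabs z < r].
Proof.
rewrite openE => z /= zr; rewrite /interior -nbhs_ballE.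
exists ((r - cabs z) / 2) => /=; first by rewrite divr_gt0// subr_gt0.
move=> w /cabs_ball; have := cabs_triangle w z; rewrite (cabs_subC w z) => h1 h2 /=.
by move: h1 h2; clear; lra.
Qed.

Lemma open_discC r : open (~` disc r : set (plane R)).
Proof.
rewrite openE => z /= /negP; rewrite -ltNge => zr; rewrite /interior -nbhs_ballE.
exists ((cabs z - r) / 2) => /=; first by rewrite divr_gt0// subr_gt0.
move=> w /cabs_ball; have := cabs_triangle z w => h1 h2; apply/negP; rewrite -ltNge.
by move: h1 h2; clear; lra.
Qed.

Lemma compact_disc r : compact (disc r : set (plane R)).
Proof.
apply: (@subclosed_compact _ _ (`[- r, r]%classic `*` `[- r, r]%classic)).
- by rewrite -openC; exact: open_discC.
- by apply: compact_setX; exact: segment_compact.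
- move=> z; rewrite /disc/= => zr; rewrite !in_itv/= -!ler_norml.
  by split; apply: le_trans zr; [exact: normr_fst_le_cabs|exact: normr_snd_le_cabs].
Qed.

Lemma area_rat_box_gt0 c : (0 < @area R (rat_box c))%E.
Proof.
pose r : R := c.2.+1%:R^-1; have r0 : 0 < r by rewrite invr_gt0.
have -> : rat_box c = (ball (ratr c.1.1 : R) r : set Rm) `*` (ball (ratr c.1.2 : R) r : set Rm).
  by apply/seteqP; split => z.
rewrite area_rectangle; [|exact: measurable_ball|exact: measurable_ball].
rewrite !lebesgue_measure_ball ?(ltW r0)// -!EFinM lte_fin.
by rewrite !mulr_gt0 ?invr_gt0 ?pi_gt0// mulrn_wgt0.
Qed.

Lemma area_open_gt0 U z : open U -> U z -> (0 < @area R U)%E.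
Proof.
move=> oU /(open_rat_box oU)[c cz cU].
apply: lt_le_trans (area_rat_box_gt0 c) _.
apply: le_measure; rewrite ?inE//; first exact: measurable_rat_box.
exact: open_measurable_plane.
Qed.

Lemma open_disc_interior r U z : 0 < r -> open U -> U z -> cabs z <= r ->
  exists2 w, U w & cabs w < r.
Proof.
move=> r0 oU Uz; rewrite le_eqVlt => /orP[/eqP zr|zr]; last by exists z.
have : nbhs z U by move: oU; rewrite openE; exact.
rewrite -nbhs_ballE => -[e /= e0 zU].
pose k := 1 - Num.min 2^-1 (e / (2 * r)).
have m0 : 0 < Num.min 2^-1 (e / (2 * r)) by rewrite lt_min invr_gt0 ltr0n divr_gt0// mulr_gt0.
have m1 : Num.min 2^-1 (e / (2 * r)) <= 2^-1 by rewrite ge_min lexx.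
have m2 : Num.min 2^-1 (e / (2 * r)) * r < e.
  apply: (@le_lt_trans _ _ (e / (2 * r) * r)).
    by rewrite ler_pM2r// ge_min lexx orbT.
  rewrite (_ : e / (2 * r) * r = e / 2); last by field; rewrite gt_eqF.
  by rewrite ltr_pdivrMr// ltr_pMr// ltr1n.
have k0 : 0 <= k by rewrite /k; move: m1; lra.
have k1 : k < 1 by rewrite /k; move: m0; lra.
have near (s : R) : `|s| <= r -> `|s - k * s| < e.
  move=> sr; rewrite (_ : s - k * s = Num.min 2^-1 (e / (2 * r)) * s); last by rewrite /k; ring.
  by rewrite normrM gtr0_norm// (le_lt_trans _ m2)// ler_pM2l.
exists (pscale k z).
  apply: zU; split; apply: near; rewrite -zr.
    exact: normr_fst_le_cabs.
  exact: normr_snd_le_cabs.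
by rewrite cabs_pscale// zr gtr_pMl.
Qed.

(** Nonempty open sets have positive area, and the density is positive on the
    disc. *)
Lemma msupport_equilibrium (d : R) (sigma : probability (plane R) R) : 0 < d ->
  (forall A, sigma A = (\int[@area R]_(z in A) (equilibrium_density d z)%:E)%E) ->
  msupport sigma = disc (edge d).
Proof.
move=> d0 sigmaE; apply/seteqP; split => z.
  move=> zs; apply: contrapT => zd.
  have := zs _ (@open_discC (edge d)) zd.
  by rewrite [X in (_ < X)%E](equilibrium_outside sigmaE) ltxx.
move=> zd U oU Uz; rewrite lt0e measure_ge0 andbT; apply/eqP => U0.
have [w Uw wd] := open_disc_interior (edge_gt0 d0) oU Uz zd.
pose V := U `&` [set z | cabs z < edge d].
have oV : open V by apply: openI => //; exact: open_disc.
have mV := open_measurable_plane oV.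
have V0 : sigma V = 0%E.
  apply/eqP; rewrite -measure_le0 -U0; apply: le_measure; rewrite ?inE//.
    exact: open_measurable_plane.
  by move=> x [].
have mrho : measurable_fun V (fun z => (equilibrium_density d z)%:E).
  by apply: measurable_funTS; apply/measurable_EFinP; exact: measurable_equilibrium_density.
have : ae_eq (@area R) V (fun z => (equilibrium_density d z)%:E) (cst 0%E).
  apply/(ae_eq_integral_abs _ mV mrho); rewrite -V0 sigmaE.
  by apply: eq_integral => x _; rewrite gee0_abs// lee_fin equilibrium_density_ge0.
move=> [B [mB B0 VB]].
have VsubB : V `<=` B.
  move=> x Vx; apply: VB => /= /(_ Vx)[] /eqP; rewrite gt_eqF//.
  by apply: equilibrium_density_gt0 => //; case: Vx => _ /= /ltW.
have := area_open_gt0 oV (conj Uw wd); rewrite lt0e => /andP[+ _].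
apply/negP; rewrite negbK -measure_le0 -B0.
by apply: le_measure; rewrite ?inE.
Qed.

End equilibrium_support.

(** * Adding a constant to a nonnegative function *)

Section energy_of_equilibrium.
Context {R : realType}.
Notation leb := (@lebesgue_measure R).
Notation Rm := (measurableTypeR R).
Implicit Types (z w x u : plane R) (mu : probability (plane R) R).

Lemma integral_addc mu (f : plane R -> \bar R) (c : R) : measurable_fun setT f ->
  (forall z, 0 <= f z)%E ->
  (\int[mu]_z (f z + c%:E) = \int[mu]_z f z + c%:E)%E.
Proof.
move=> mf f0.
have ic : mu.-integrable setT (fun=> c%:E) by exact: finite_measure_integrable_cst.
have iE : (\int[mu]_z c%:E = c%:E)%E by rewrite integral_cst//= probability_setT mule1.
have i0 : (0 <= \int[mu]_z f z)%E by exact: integral_ge0.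
have [fy|fy] := ltP (\int[mu]_z f z)%E +oo%E.
  rewrite integralD// ?iE//; apply/integrableP; split => //.
  by under eq_integral do rewrite gee0_abs//.
move: fy; rewrite leye_eq => /eqP fy; rewrite fy addye//.
pose h z : \bar R := (f z + c%:E)%E.
have mh : measurable_fun setT h by exact: emeasurable_funD.
have neg_le z : (h^\- z <= `|c|%:E)%E.
  rewrite funenegE /h ge_max lee_fin normr_ge0 andbT.
  have := f0 z; case: (f z) => [r| |]//; last by rewrite leNye.
  rewrite lee_fin => r0; rewrite -EFinD -EFinN lee_fin.
  by have := ler_norm (- c); rewrite normrN; lra.
have pos_ge z : (f z <= h^\+ z + `|c|%:E)%E.
  rewrite funeposE /h; have := f0 z; case: (f z) => [r| |]//.
  rewrite lee_fin => r0; apply: (@le_trans _ _ ((r + c)%:E + `|c|%:E)%E).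
    by rewrite -EFinD lee_fin; have := ler_norm (- c); rewrite normrN; lra.
  by rewrite leeD2r// le_max EFinD lexx.
have iN : (\int[mu]_z h^\- z <= `|c|%:E)%E.
  have <- : (\int[mu]_z (`|c|%:E) = `|c|%:E)%E by rewrite integral_cst//= probability_setT mule1.
  apply: ge0_le_integral => //; exact: measurable_funeneg.
have iP : (\int[mu]_z h^\+ z = +oo)%E.
  have : (+oo <= \int[mu]_z h^\+ z + `|c|%:E)%E.
    have iC : (\int[mu]_z (`|c|%:E) = `|c|%:E)%E by rewrite integral_cst//= probability_setT mule1.
    rewrite -fy -{1}iC -ge0_integralD//; last exact: measurable_funepos.
    apply: ge0_le_integral => //.
    by apply: emeasurable_funD => //; exact: measurable_funepos.
  rewrite leye_eq => /eqP; have : (0 <= \int[mu]_z h^\+ z)%E by exact: integral_ge0.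
  by case: (\int[mu]_z h^\+ z)%E.
rewrite -[LHS]/(\int[mu]_z h z)%E integralE iP addye//.
have : (0 <= \int[mu]_z h^\- z)%E by exact: integral_ge0.
by move: iN; case: (\int[mu]_z h^\- z)%E.
Qed.

End energy_of_equilibrium.

(** * The droplet is a disc *)

Section droplet.
Context {R : realType}.
Notation leb := (@lebesgue_measure R).
Notation Rm := (measurableTypeR R).
Implicit Types (z w x u : plane R) (mu : probability (plane R) R).
Notation power_potential d := (fun z : plane R => (cabs z `^ (2 * d))%:E).

Lemma lne_log_kernel (M : R) z w : 0 < M -> cabs (z - w) <= M ->
  (- lne (cabs (z - w))%:E = log_kernel M z w + (- ln M)%:E)%E.
Proof.
move=> M0 zwM; rewrite /lne; case: ifPn => [zw|].
  have zw0 : cabs (z - w) = 0 by apply/eqP; rewrite eq_le zw cabs_ge0.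
  by rewrite /log_kernel /sqr_ratio zw0 mul0r expr0n log_mixture0 addye.
rewrite -ltNge => zw; rewrite log_kernelE ?zw// -EFinD -EFinN; congr EFin.
by ring.
Qed.

Lemma measurable_lne_dist : measurable_fun setT
  (fun p : plane R * plane R => - lne (cabs (p.1 - p.2))%:E)%E.
Proof.
apply: measurableT_comp => //.
rewrite (_ : (fun p => _) = (fun p : plane R * plane R => if cabs (p.1 - p.2) <= 0
    then -oo%E else (ln (cabs (p.1 - p.2)))%:E)) //.
apply: measurable_fun_ifT => //.
  by apply: measurable_fun_ler => //; exact: measurable_dist.
by apply/measurable_EFinP; apply: measurableT_comp => //; exact: measurable_dist.
Qed.

Lemma energy_cross_energy (M : R) (Q : plane R -> \bar R) mu : 0 < M -> concentrated M mu ->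
  energy Q mu = (cross_energy M mu mu + (- ln M)%:E + \int[mu]_z Q z)%E.
Proof.
move=> M0 cmu; rewrite /energy; congr (_ + _)%E.
have mk := measurable_log_kernel M.
have k0 z w : (0 <= log_kernel M z w)%E by exact: log_kernel_ge0.
have mki : measurable_fun setT (fun z => \int[mu]_w log_kernel M z w)%E.
  exact: (@measurable_fun_fubini_tonelli_F _ _ _ _ _ mu _ mk (fun _ => k0 _ _)).
have ki0 z : (0 <= \int[mu]_w log_kernel M z w)%E by exact: integral_ge0.
rewrite /cross_energy -(@integral_addc _ mu _ (- ln M) mki ki0).
have ml := measurable_lne_dist.
apply: eq_integral_concentrated; first exact: cmu.
- rewrite (_ : (fun z => _) = (fun z =>
    \int[mu]_w ((fun p : plane R * plane R => - lne (cabs (p.1 - p.2))%:E)^\+ (z, w)) -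
    \int[mu]_w ((fun p : plane R * plane R => - lne (cabs (p.1 - p.2))%:E)^\- (z, w)))%E).
    apply: emeasurable_funB.
      apply: (@measurable_fun_fubini_tonelli_F _ _ _ _ _ mu
        ((fun p : plane R * plane R => - lne (cabs (p.1 - p.2))%:E)^\+)%E) => //.
      exact: measurable_funepos.
    apply: (@measurable_fun_fubini_tonelli_F _ _ _ _ _ mu
      ((fun p : plane R * plane R => - lne (cabs (p.1 - p.2))%:E)^\-)%E) => //.
    exact: measurable_funeneg.
  by apply/funext => z; rewrite integralE; congr (_ - _)%E;
    apply: eq_integral => w _; [rewrite !funeposE|rewrite !funenegE].
- exact: emeasurable_funD mki (measurable_cst _).
move=> z dz.
have mkz : measurable_fun setT (log_kernel M z).
  exact: measurableT_comp mk (pair1_measurable z).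
rewrite -(@integral_addc _ mu _ (- ln M) mkz (k0 z)).
apply: eq_integral_concentrated; first exact: cmu.
- exact: measurableT_comp ml (pair1_measurable z).
- exact: emeasurable_funD mkz (measurable_cst _).
move=> w dw; apply: lne_log_kernel => //.
rewrite (le_trans (cabsD _ _))//; move: dz dw; rewrite /disc/=; lra.
Qed.

Lemma measurable_power_potential (d : R) : measurable_fun setT (power_potential d).
Proof.
apply/measurable_EFinP; apply: (measurableT_comp (measurable_powR _)).
exact: measurable_cabs.
Qed.

(** Off the origin the potential is explicit and the inequality is [1 + x <=
    exp x]. At the origin, which may be an atom of a competing measure, the
    potential is bounded below by its values on small circles. *)
Lemma frostman_lower (d M : R) (sigma : probability (plane R) R) : 0 < d -> 0 < M ->
  edge d <= M / 2 ->
  (forall A, sigma A = (\int[@area R]_(z in A) (equilibrium_density d z)%:E)%E) ->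
  forall z, cabs z <= M / 2 ->
  (((1 + ln d) / d + 2 * ln M)%:E <=
    log_potential M sigma z + log_potential M sigma z + (cabs z `^ (2 * d))%:E)%E.
Proof.
move=> d0 M0 eM sigmaE z zM; have [z0|z0] := ltP 0 (cabs z).
  rewrite (log_potentialE d0 M0 eM sigmaE z0 zM) -!EFinD lee_fin.
  by have := potential_profile_sum M d0 z0; rewrite mulr2n mulrDl mul1r; lra.
have e0 := edge_gt0 d0.
have {}z0 : z = (0, 0) by apply: cabs_eq0; apply/eqP; rewrite eq_le z0 cabs_ge0.
have M2M : M / 2 <= M by rewrite ler_piMr ?invf_le1 ?ler1n ?ltW.
set C := (1 + ln d) / d + _; set V := log_potential M sigma z.
have below (r : R) : 0 < r -> r <= edge d ->
    (C%:E <= V + V + (r `^ (2 * d))%:E)%E.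
  move=> r0 re; pose y : plane R := (r, 0).
  have yr : cabs y = r by rewrite /cabs/= expr0n addr0 sqrtr_sqr gtr0_norm.
  have y0 : 0 < cabs y by rewrite yr.
  have yM : cabs y <= M by rewrite yr (le_trans re)// (le_trans eM).
  have mB : measurable_fun setT
      (fun w => (averaged_kernel d M (logdepth d y) (logdepth d w))%:E).
    by apply/measurable_EFinP; exact: measurableT_comp (measurable_averaged_kernel _ _ _) (measurable_logdepth _).
  have yV : ((potential_profile d M (logdepth d y))%:E <= V)%E.
    rewrite -(integral_averaged_kernel d0 M0 eM sigmaE y0 yM) /V /log_potential.
    apply: ae_ge0_le_integral => //.
    - by move=> w _; rewrite lee_fin (averaged_kernel_ge0 d0 M0 eM).
    - by move=> w _; exact: log_kernel_ge0.
    - exact: measurableT_comp (measurable_log_kernel M) (pair1_measurable z).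
    apply: filterS (equilibrium_ae d0 sigmaE 0) => w [w0 we _] _.
    have zw : cabs (z - w) = cabs w by rewrite z0 /cabs/= !sub0r !sqrrN.
    rewrite (averaged_kernelE M d0 y0 w0 we) log_kernelE// zw; last first.
      by rewrite w0 (le_trans we)// (le_trans eM).
    rewrite lee_fin lerD2l lerN2 ler_ln ?posrE//; last first.
      by rewrite lt_max w0 orbT.
    by rewrite le_max lexx orbT.
  have := potential_profile_sum M d0 y0; rewrite yr -/C => H.
  apply: (@le_trans _ _ ((potential_profile d M (logdepth d y))%:E +
     (potential_profile d M (logdepth d y))%:E + (r `^ (2 * d))%:E)%E).
    by rewrite -!EFinD lee_fin; move: H; lra.
  by rewrite leeD2r// leeD.
have V0 : (0 <= V)%E by apply: integral_ge0 => w _; exact: log_kernel_ge0.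
have -> : cabs z `^ (2 * d) = 0 by rewrite z0 cabs0 powR0// gt_eqF// mulr_gt0.
rewrite adde0; move: V0 below; clearbody V; case: V => [v| |]//; last first.
  by move=> _ _; rewrite addye// leey.
move=> _ below; rewrite -EFinD lee_fin leNgt; apply/negP => vC.
pose e := C - (v + v); have e1 : 0 < e by rewrite subr_gt0.
pose r := Num.min (edge d) ((e / 2) `^ (1 / (2 * d))).
have r0 : 0 < r by rewrite lt_min e0 powR_gt0// divr_gt0.
have := below r r0; rewrite ge_min lexx => /(_ isT); rewrite -!EFinD lee_fin.
have : r `^ (2 * d) <= e / 2.
  have -> : e / 2 = ((e / 2) `^ (1 / (2 * d))) `^ (2 * d).
    rewrite -powRrM divfK; last by rewrite gt_eqF// mulr_gt0.
    by rewrite powRr1// divr_ge0// ltW.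
  apply: ge0_ler_powR; rewrite ?nnegrE ?powR_ge0 ?(ltW r0) ?mulr_ge0 ?(ltW d0)//.
  by rewrite ge_min lexx orbT.
by rewrite /e; lra.
Qed.

(** The integral of the Frostman inequality against [mu] bounds the cross
    energy of [mu] and [sigma] from below, with equality for [mu = sigma]; the
    rest is the polarization identity. *)
Lemma energy_equilibrium_le (d M : R) (sigma mu : probability (plane R) R) : 0 < d -> 0 < M ->
  edge d <= M / 2 ->
  (forall A, sigma A = (\int[@area R]_(z in A) (equilibrium_density d z)%:E)%E) ->
  concentrated M mu -> concentrated M sigma ->
  (exists e : R, energy (power_potential d) sigma = e%:E) /\
  (energy (power_potential d) sigma + \int[leb]_t dispersion M mu sigma t <=
   energy (power_potential d) mu)%E.
Proof.
move=> d0 M0 eM sigmaE cmu cs; set Q := power_potential d.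
pose C := (1 + ln d) / d + 2 * ln M.
have mQ : measurable_fun setT Q by exact: measurable_power_potential.
have Q0 z : (0 <= Q z)%E by rewrite lee_fin powR_ge0.
have mV : measurable_fun setT (log_potential M sigma).
  apply: (@measurable_fun_fubini_tonelli_F _ _ _ _ _ sigma _ (measurable_log_kernel M)).
  by move=> p; exact: log_kernel_ge0.
have V0 z : (0 <= log_potential M sigma z)%E.
  by apply: integral_ge0 => w _; exact: log_kernel_ge0.
pose F z := (log_potential M sigma z + log_potential M sigma z + Q z)%E.
have mF : measurable_fun setT F by apply: emeasurable_funD => //; exact: emeasurable_funD.
have F0 z : (0 <= F z)%E by apply: adde_ge0 => //; exact: adde_ge0.
have FE (m : probability (plane R) R) : (\int[m]_z F z = cross_energy M m sigma + cross_energy M m sigma +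
    \int[m]_z Q z)%E.
  rewrite ge0_integralD//; last 2 first.
  - by move=> z _; rewrite adde_ge0.
  - exact: emeasurable_funD.
  by rewrite ge0_integralD.
have cst_int (m : probability (plane R) R) (k : R) : (\int[m]_z k%:E = k%:E)%E.
  by rewrite integral_cst//= probability_setT mule1.
have HS : (cross_energy M sigma sigma + cross_energy M sigma sigma + \int[sigma]_z Q z = C%:E)%E.
  rewrite -FE -(cst_int sigma C); apply: ae_eq_integral => //.
  apply: filterS (equilibrium_ae d0 sigmaE 0) => w [w0 we _] _.
  rewrite /F (log_potentialE d0 M0 eM sigmaE w0 (le_trans we eM)) /Q -!EFinD; congr EFin.
  by have := potential_profile_sum_disc M d0 w0 we; rewrite /C; lra.
have HM : (C%:E <= cross_energy M mu sigma + cross_energy M mu sigma + \int[mu]_z Q z)%E.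
  rewrite -FE; have [C0|C0] := ltP C 0.
    by apply: (@le_trans _ _ 0%E); [rewrite lee_fin ltW|exact: integral_ge0].
  have -> : (\int[mu]_z F z = \int[mu]_z maxe (F z) C%:E)%E.
    apply: eq_integral_concentrated; first exact: cmu.
    - exact: mF.
    - exact: measurable_maxe.
    move=> z dz; apply/esym/max_idPl; exact: (frostman_lower d0 M0 eM sigmaE).
  rewrite -{1}(cst_int mu C); apply: ge0_le_integral => //.
  - exact: measurable_maxe.
  - by move=> z _; rewrite le_max lexx orbT.
have par := cross_energy_dispersion M0 cmu cs.
have e1 := energy_cross_energy Q M0 cmu; have e2 := energy_cross_energy Q M0 cs.
rewrite e1 e2.
have E0 (m m' : probability (plane R) R) : (0 <= cross_energy M m m')%E.
  by apply: integral_ge0 => z _; apply: integral_ge0 => w _; exact: log_kernel_ge0.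
have D0 : (0 <= \int[leb]_t dispersion M mu sigma t)%E.
  by apply: integral_ge0 => t _; exact: dispersion_ge0.
have q0 (m : probability (plane R) R) : (0 <= \int[m]_z Q z)%E by exact: integral_ge0.
move: HS HM par (E0 sigma sigma) (E0 mu mu) (E0 mu sigma) D0 (q0 sigma) (q0 mu).
(* All the quantities are nonnegative, those of the equilibrium measure finite. *)
case: (cross_energy M sigma sigma) => [e| |]; case: (\int[sigma]_z Q z)%E => [q| |] //.
case: (\int[leb]_t dispersion M mu sigma t)%E => [D| |];
case: (cross_energy M mu mu) => [x| |]; case: (cross_energy M mu sigma) => [y| |];
case: (\int[mu]_z Q z)%E => [p| |] // HS HM par _ _ _ _ _ _; split;
  rewrite -?EFinD; try (by eexists); try (by rewrite ?leey).
move: HS HM par; rewrite -!EFinD !lee_fin => -[HS] HM [par].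
by move: HS HM par; rewrite /C; lra.
Qed.

Lemma power_potential_droplet (d : R) : 0 < d ->
  is_droplet (power_potential d) (disc (edge d)).
Proof.
move=> d0; have [sigma sigmaE] := equilibrium_measure_exists d0.
have supp := msupport_equilibrium d0 sigmaE.
have key (mu : probability (plane R) R) : compact (msupport mu) -> exists M : R,
    [/\ 0 < M, exists e : R, energy (power_potential d) sigma = e%:E &
    (energy (power_potential d) sigma + \int[leb]_t dispersion M mu sigma t <=
     energy (power_potential d) mu)%E].
  move=> /msupport_disc[r r0 mur]; pose M := 2 * Num.max r (edge d).
  have M2 : M / 2 = Num.max r (edge d) by rewrite /M mulrAC divff ?mul1r.
  have eM : edge d <= M / 2 by rewrite M2 le_max lexx orbT.
  have M0 : 0 < M by rewrite mulr_gt0// lt_max r0.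
  have cmu : concentrated M mu by apply: mur; rewrite M2 le_max lexx.
  have cs : concentrated M sigma.
    apply/eqP; rewrite -measure_le0 -(equilibrium_outside sigmaE).
    apply: le_measure; rewrite ?inE; [| |].
    - exact: measurableC (measurable_disc _).
    - exact: measurableC (measurable_disc _).
    - by apply: subsetC => z /= ze; exact: le_trans ze eM.
  by exists M; have [] := energy_equilibrium_le d0 M0 eM sigmaE cmu cs.
have D0 (M : R) mu : 0 < M -> (0 <= \int[leb]_t dispersion M mu sigma t)%E.
  by move=> M0; apply: integral_ge0 => t _; exact: dispersion_ge0.
exists sigma => //; split.
- by rewrite supp; exact: compact_disc.
- move=> mu /key[M [M0 _ le]]; apply: le_trans le.
  by rewrite leeDl// D0.
- move=> mu /key[M [M0 [e ee] le]] E; apply: (@eq_measure_dispersion R M) => //.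
  move: le (D0 M mu M0); rewrite E ee.
  case: (\int[leb]_t dispersion M mu sigma t)%E => [D| |]//.
  by rewrite -EFinD !lee_fin => h1 h2; congr EFin; lra.
Qed.

End droplet.

Theorem theorem1p1 (R : realType) (d : R) (hd : 0 < d) :
  let Q : plane R -> \bar R := fun z => (cabs z `^ (2 * d))%:E in
  let S : set (plane R) := [set z | cabs z <= d `^ (- (1 / (2 * d)))] in
  is_droplet Q S /\
  forall (dO : nat -> measure_display)
    (Omega : forall n, measurableType (dO n))
    (P : forall n, probability (Omega n) R)
    (z : forall n, {RV (P n) >-> n.-tuple (plane R)}),
  (forall n, is_hard_edge_ensemble Q S (z n)) ->
  forall K : set R, compact K -> K `<=` [set xi | xi <= 0] ->
  {uniform K, (fun (n : nat) (xi : R) =>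
      fine (P n [set w | rescaled_radius d (z n w) <= xi])) @ \oo -->
    (fun xi : R => expR xi)}.
Proof.
move=> Q S; split; first exact: power_potential_droplet.
by move=> dO Omega P z hz K cK K0; exact: (spectral_radius_cvg hd hz cK K0).
Qed.
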